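(* Let $F\colon\mathbb{R}^d\to\mathbb{R}^m$ be a $C^2$-smooth map, $h\colon\mathbb{R}^m\to\mathbb{R}$ a convex function, and $r\colon\mathbb{R}^d\to\mathbb{R}\cup\{\infty\}$ a closed $\rho$-weakly convex function, and suppose $\beta>0$ is a constant with $|h(F(y))-h(F(x)+\nabla F(x)(y-x))|\le\frac{\beta}{2}\|y-x\|^2$ for all $x,y\in\mathbb{R}^d$. Let $\bar x$ be any composite strict saddle point of the problem $\min_x f(x)=h(F(x))+r(x)$. Choose any constant $\mu\in(0,(\rho+2\beta)^{-1})$ and a damping parameter $\alpha\in(0,1)$ satisfying $$\alpha\cdot\left(1+\left(1+\sqrt{\frac{2\beta\mu}{1-\mu\beta-\mu\rho}}\right)\cdot\max\left\{1,\frac{\mu\rho+\mu\beta}{1-\mu\rho-2\mu\beta}\right\}\right)<1.$$ Define the damped proximal linear update $T(x)=(1-\alpha)x+\alpha S(x)$, where $$S(x):=\mathrm{argmin}_{y}\ h(F(x)+\nabla F(x)(y-x))+r(y)+\frac{1}{2\mu}\|y-x\|^2.$$ Then there exists a neighborhood $U$ of $\bar x$ such that the set of initial conditions $$\{x\in U:\ T^k(x)\in U\text{ for all }k\ge0\}$$ has zero Lebesgue measure.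
   Context: A function $\varphi\colon\mathbb{R}^n\to\mathbb{R}\cup\{\infty\}$ is closed if its epigraph is closed; it is $\rho$-weakly convex ($\rho>0$) if $x\mapsto \varphi(x)+\frac{\rho}{2}\|x\|^2$ is convex. $T^k$ denotes the $k$-fold composition of $T$. Subdifferential: if $\varphi(\bar x)$ is finite, $\partial\varphi(\bar x)$ is the set of $v$ with $\varphi(x)\ge\varphi(\bar x)+\langle v,x-\bar x\rangle+o(\|x-\bar x\|)$ as $x\to\bar x$; otherwise $\partial\varphi(\bar x)=\emptyset$. A point $\bar x$ is critical for $\varphi$ if $0\in\partial\varphi(\bar x)$. Manifolds: $\mathcal{M}\subset\mathbb{R}^n$ is a $C^p$ manifold of dimension $k$ around $\bar x\in\mathcal{M}$ if there are an open neighborhood $U$ of $\bar x$ and a $C^p$ map $G\colon\mathbb{R}^n\to\mathbb{R}^{n-k}$ with $\nabla G(\bar x)$ of full rank and $\mathcal{M}\cap U=\{x\in U:G(x)=0\}$. The tangent space is $T_{\mathcal{M}}(\bar x)=\ker\nabla G(\bar x)$. Active manifold: for a closed weakly convex $\varphi$ with critical point $\bar x$, a set $\mathcal{M}\ni\bar x$ is an active $C^p$ manifold at $\bar x$ if there is a neighborhood $U$ of $\bar x$ such that $\mathcal{M}\cap U$ is a $C^p$-smooth manifold, the restriction of $\varphi$ to $\mathcal{M}\cap U$ is $C^p$-smooth, and $\inf\{\|v\|:v\in\partial\varphi(x),\ x\in U\setminus\mathcal{M}\}>0$ (with $\inf\emptyset=+\infty$). For $x$ and $v\in\partial\varphi(x)$,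 a set $\mathcal{R}\ni x$ is a $C^2$ active manifold of $\varphi$ at $x$ for $v$ if it is a $C^2$ active manifold of $\varphi-\langle v,\cdot\rangle$ at $x$. Composite active manifold: let $\bar x$ be critical for $f=h\circ F+r$. Fix $\bar w\in\partial h(F(\bar x))$ and $\bar v\in\partial r(\bar x)$ with $0=\nabla F(\bar x)^*\bar w+\bar v$. Suppose (1) there exist $C^2$-smooth manifolds $\mathcal{R}\subset\mathbb{R}^d$ and $\mathcal{H}\subset\mathbb{R}^m$ containing $\bar x$ and $F(\bar x)$, respectively, with $\nabla F(\bar x)[T_{\mathcal{R}}(\bar x)]+T_{\mathcal{H}}(F(\bar x))=\mathbb{R}^m$; and (2) $\mathcal{R}$ is an active manifold of $r$ at $\bar x$ for $\bar v$ and $\mathcal{H}$ is an active manifold of $h$ at $F(\bar x)$ for $\bar w$ (both $C^2$). Then $\mathcal{M}:=\mathcal{R}\cap F^{-1}(\mathcal{H})$ is called a composite $C^2$ active manifold at $\bar x$. If in addition $d^2f_{\mathcal{M}}(\bar x)(u)<0$ for some $u\in T_{\mathcal{M}}(\bar x)$, then $\bar x$ is called a composite strict saddle point. Here $f_{\mathcal{M}}:=f+\delta_{\mathcal{M}}$ ($\delta_{\mathcal M}$ is $0$ on $\mathcal M$, $+\infty$ off it), and for $u\in T_{\mathcal{M}}(\bar x)$, $d^2f_{\mathcal{M}}(\bar x)(u)$ is the parabolic subderivative $\liminf_{t\searrow0,\,w'\to w}\frac{f_{\mathcal{M}}(\bar x+tu+\frac12t^2w')-f_{\mathcal{M}}(\bar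 x)}{\frac12t^2}$, whose value is the same for all $w$ for which it is finite. Equivalently, if $\hat f$ is a $C^2$ function agreeing with $f$ on $\mathcal{M}$ near $\bar x$, $G=0$ are local defining equations of $\mathcal{M}$, and $\bar\lambda$ is the multiplier with $\nabla\hat f(\bar x)+\sum_i\bar\lambda_i\nabla G_i(\bar x)=0$, then $d^2f_{\mathcal{M}}(\bar x)(u)=\langle(\nabla^2\hat f(\bar x)+\sum_i\bar\lambda_i\nabla^2G_i(\bar x))u,u\rangle$. *)

(* Defs.v *)
From HB Require Import structures.
From mathcomp Require Import all_boot all_order all_algebra.
From mathcomp Require Import all_classical all_reals all_analysis.

Set Implicit Arguments.
Unset Strict Implicit.
Unset Printing Implicit Defensive.

Import Order.TTheory GRing.Theory Num.Theory.
Import numFieldNormedType.Exports.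

Local Open Scope classical_set_scope.
Local Open Scope ring_scope.

(* R^n is 'rV[R]_n. Its library norm is the sup norm: it is used only through
   the topology and differentiability, which do not depend on the norm. Metric
   quantities use the Euclidean norm enorm below. The library convention for
   Jacobians is 'd f x u = u *m 'J f x. *)

Definition dotp (R : realType) (n : nat) (u v : 'rV[R]_n) : R :=
  \sum_(i < n) u ord0 i * v ord0 i.

Definition enorm (R : realType) (n : nat) (u : 'rV[R]_n) : R :=
  Num.sqrt (dotp u u).

Fixpoint Cp (R : realType) (V W : normedModType R) (p : nat) (f : V -> W)
    : Prop :=
  match p with
  | 0%N => continuous f
  | q.+1 => (forall x, differentiable f x) /\
            (forall v, Cp q (fun x => 'd f x v))
  end.

(* Functions with values in R \cup {+oo} are functions to \bar R that avoid
   -oo. *)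

Definition avoids_ninfty (R : realType) (T : Type) (phi : T -> \bar R) : Prop :=
  forall x, phi x != -oo%E.

Definition closed_fun (R : realType) (n : nat) (phi : 'rV[R]_n -> \bar R)
    : Prop :=
  closed [set z : 'rV[R]_n * R | (phi z.1 <= (z.2)%:E)%E].

Definition econvex (R : realType) (n : nat) (phi : 'rV[R]_n -> \bar R) : Prop :=
  forall (x y : 'rV[R]_n) (t : R), 0 < t < 1 ->
    (phi (t *: x + (1 - t) *: y)%R <= t%:E * phi x + (1 - t)%:E * phi y)%E.

Definition weakly_convex (R : realType) (n : nat) (rho : R)
    (phi : 'rV[R]_n -> \bar R) : Prop :=
  econvex (fun x => phi x + (rho / 2 * enorm x ^+ 2)%:E)%E.

Definition subdiff (R : realType) (n : nat) (phi : 'rV[R]_n -> \bar R)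
    (x : 'rV[R]_n) : set 'rV[R]_n :=
  [set v | phi x \is a fin_num /\
    forall e : R, 0 < e ->
      \forall y \near x,
        (phi x + (dotp v (y - x) - e * enorm (y - x))%:E <= phi y)%E].

Definition critical (R : realType) (n : nat) (phi : 'rV[R]_n -> \bar R)
    (x : 'rV[R]_n) : Prop :=
  subdiff phi x 0.

Definition local_equation (R : realType) (n p k : nat) (M : set 'rV[R]_n)
    (x : 'rV[R]_n) (G : 'rV[R]_n -> 'rV[R]_(n - k)) : Prop :=
  [/\ (k <= n)%N, Cp p G, \rank ('J G x) = (n - k)%N &
      exists U : set 'rV[R]_n,
        [/\ open U, U x & M `&` U = [set y | U y /\ G y = 0]]].

Definition manifold_around (R : realType) (n p k : nat) (M : set 'rV[R]_n)
    (x : 'rV[R]_n) : Prop :=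
  M x /\ exists G, @local_equation R n p k M x G.

Definition smooth_manifold (R : realType) (n p : nat) (M : set 'rV[R]_n)
    : Prop :=
  exists k : nat, forall x, M x -> manifold_around p k M x.

(* ker 'd G x is the same for all local equations G of M at x. *)
Definition tangent_space (R : realType) (n p : nat) (M : set 'rV[R]_n)
    (x : 'rV[R]_n) : set 'rV[R]_n :=
  [set u | exists k G, @local_equation R n p k M x G /\ 'd G x u = 0].

Definition smooth_on (R : realType) (n p : nat) (A : set 'rV[R]_n)
    (phi : 'rV[R]_n -> \bar R) : Prop :=
  forall x, A x -> exists V (g : 'rV[R]_n -> R^o),
    [/\ nbhs x V, Cp p g & forall y, A y -> V y -> phi y = (g y)%:E].

(* The infimum of the empty set is +oo. *)
Definition active_manifold (R : realType) (n p : nat)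
    (phi : 'rV[R]_n -> \bar R) (x : 'rV[R]_n) (M : set 'rV[R]_n) : Prop :=
  [/\ critical phi x, M x &
      exists U : set 'rV[R]_n,
        [/\ nbhs x U, smooth_manifold p (M `&` U), smooth_on p (M `&` U) phi &
            (0 < ereal_inf [set s | exists y v,
               [/\ U y, ~ M y, subdiff phi y v & s = (enorm v)%:E]])%E]].

Definition active_manifold_for (R : realType) (n p : nat)
    (phi : 'rV[R]_n -> \bar R) (x v : 'rV[R]_n) (M : set 'rV[R]_n) : Prop :=
  subdiff phi x v /\
  active_manifold p (fun y => phi y - (dotp v y)%:E)%E x M.

Definition composite (R : realType) (d m : nat) (F : 'rV[R]_d -> 'rV[R]_m)
    (h : 'rV[R]_m -> R) (r : 'rV[R]_d -> \bar R) : 'rV[R]_d -> \bar R :=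
  fun x => ((h (F x))%:E + r x)%E.

(* The adjoint of 'd F x sends w to w *m ('J F x)^T. *)
Definition composite_active_manifold (R : realType) (d m : nat)
    (F : 'rV[R]_d -> 'rV[R]_m) (h : 'rV[R]_m -> R) (r : 'rV[R]_d -> \bar R)
    (x : 'rV[R]_d) (M : set 'rV[R]_d) : Prop :=
  critical (composite F h r) x /\
  exists (w : 'rV[R]_m) (v : 'rV[R]_d) (A : set 'rV[R]_d) (H : set 'rV[R]_m),
    [/\ [/\ subdiff (EFin \o h) (F x) w, subdiff r x v &
            w *m ('J F x)^T + v = 0],
        [/\ smooth_manifold 2 A, smooth_manifold 2 H, A x, H (F x) &
            [set 'd F x a + b | a in tangent_space 2 A x
                              & b in tangent_space 2 H (F x)] = setT],
        active_manifold_for 2 r x v A,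
        active_manifold_for 2 (EFin \o h) (F x) w H &
        M = A `&` F @^-1` H].

Definition indicator (R : realType) (T : Type) (M : set T) (x : T) : \bar R :=
  if `[< M x >] then 0%E else +oo%E.

Definition parabolic_subderivative (R : realType) (n : nat)
    (phi : 'rV[R]_n -> \bar R) (x u w : 'rV[R]_n) : \bar R :=
  limf_einf
    (fun z : R * 'rV[R]_n =>
       ((phi (x + z.1 *: u + (z.1 ^+ 2 / 2) *: z.2)%R - phi x)
          * ((z.1 ^+ 2 / 2)^-1)%:E)%E)
    (filter_prod (0^'+) (nbhs w)).

(* The value of the parabolic subderivative at any w for which it is finite;
   +oo if there is no such w. *)
Definition d2 (R : realType) (n : nat) (phi : 'rV[R]_n -> \bar R)
    (x u : 'rV[R]_n) : \bar R :=
  xget +oo%E [set c | c \is a fin_num /\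
                      exists w, parabolic_subderivative phi x u w = c].

Definition composite_strict_saddle (R : realType) (d m : nat)
    (F : 'rV[R]_d -> 'rV[R]_m) (h : 'rV[R]_m -> R) (r : 'rV[R]_d -> \bar R)
    (x : 'rV[R]_d) : Prop :=
  exists M : set 'rV[R]_d,
    composite_active_manifold F h r x M /\
    exists u, tangent_space 2 M x u /\
      (d2 (fun y => composite F h r y + indicator R M y) x u < 0)%E.

Definition argmin (R : realType) (T : Type) (g : T -> \bar R) : set T :=
  [set y | forall z, (g y <= g z)%E].

(* xget picks an element of the argmin, with the junk value x if it is empty. *)
Definition prox_linear (R : realType) (d m : nat) (F : 'rV[R]_d -> 'rV[R]_m)
    (h : 'rV[R]_m -> R) (r : 'rV[R]_d -> \bar R) (mu : R) (x : 'rV[R]_d)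
    : 'rV[R]_d :=
  xget x (argmin (fun y =>
    (h (F x + 'd F x (y - x)))%:E + r y
      + ((2 * mu)^-1 * enorm (y - x) ^+ 2)%:E)%E).

Definition damped (R : realType) (d : nat) (alpha : R)
    (S : 'rV[R]_d -> 'rV[R]_d) (x : 'rV[R]_d) : 'rV[R]_d :=
  (1 - alpha) *: x + alpha *: S x.

Definition box (R : realType) (d : nat) (a b : 'rV[R]_d) : set 'rV[R]_d :=
  [set x | forall i, a ord0 i <= x ord0 i <= b ord0 i].

(* Lebesgue outer measure: infimum over coverings by families of closed boxes
   indexed by D `<=` nat (allowing D finite or empty matters when d = 0). *)
Definition lebesgue_outer (R : realType) (d : nat) (A : set 'rV[R]_d) : \bar R :=
  ereal_inf [set s | exists (D : set nat) (a b : nat -> 'rV[R]_d),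
    [/\ forall k i, a k ord0 i <= b k ord0 i,
        A `<=` \bigcup_(k in D) box (a k) (b k) &
        s = (\esum_(k in D) (\prod_(i < d) (b k ord0 i - a k ord0 i))%:E)%E]].

(* Main.v *)
(* Near xbar the prox-linear step y = S x solves, together with multipliers
   w in dh(F x + F'(x)(y - x)) and v in dr(y), the optimality condition
   F'(x)^* w + v + (y - x)/mu = 0; such solutions are limits of minimizers of a
   penalized problem. By transversality (w, v) tends to (wbar, vbar), so the
   sharpness of the active manifolds forces y in R and F x + F'(x)(y - x) in H.
   Writing v and w as gradients of Lagrangians plus small normal vectors turns
   the condition into a smooth KKT system with invertible matrix
   [[M2, C], [C^T, 0]]; strict differentiability of its data shows directly,
   without an implicit function theorem, that S is strictly differentiable at
   xbar, with derivative (M2 - D) E, where E is the corner block of the inverse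
   and D the Hessian of the Lagrangian of f on M. The negative curvature of f
   on M is a tangent u with <u D, u> < 0, which makes the derivative A of T
   expand u in the M2-inner product.
   No stable manifold theorem is needed: there are g > 1 and a symmetric form V
   with V(u) > 0 such that V(z A) - g V(z) is positive definite. If x and y stay
   near xbar forever then V(T^k x - T^k y) remains bounded, so V(x - y) <= 0.
   Hence the set of initial conditions is a Lipschitz graph over a hyperplane
   transversal to u, and such a graph is a null set. *)
From HB Require Import structures.
Require Import Defs.
From mathcomp Require Import all_boot all_order all_algebra.
From mathcomp Require Import all_classical all_reals all_analysis.
From mathcomp Require Import ring lra.

Set Implicit Arguments.
Unset Strict Implicit.
Unset Printing Implicit Defensive.

Import Order.TTheory GRing.Theory Num.Theory.
Import numFieldNormedType.Exports.

Local Open Scope classical_set_scope.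
Local Open Scope ring_scope.

(** * Euclidean products and the sup norm *)

Section Dotp.
Variable R : realType.

(** Derivatives are taken in the strict sense, with error [o(|a - b|)] as both points tend to the
    base point. The escape argument compares two arbitrary orbits, and the KKT system is linearized
    by subtracting it at two points, so one-point expansions would not do. Terms [l *m (J P y)^T]
    linearize with a frozen Jacobian only if the multiplier [l] tends to 0. Hence each smooth
    representative is replaced by a Lagrangian whose gradient vanishes at the base point, and [l]
    measures the deviation from the limiting multiplier. [M2] is positive definite on tangent
    vectors for second-order reasons: there the Hessian of the Lagrangian of [h] is nonnegative,
    that of [r] is at least [- rho], and [mu * rho < 1]. Limits of multipliers are taken along
    ultrafilters in place of subsequences. The number [g] lies strictly between 1 and the squared
    expansion factor of [u], and off the spectrum of the square of [A]; the form measuring expansion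
    beyond [g] is then itself expanded with a strict gap. *)

Lemma dotpE n (u v : 'rV[R]_n) : dotp u v = (u *m v^T) ord0 ord0.
Proof. by rewrite /dotp !mxE; apply: eq_bigr => i _; rewrite mxE. Qed.

Lemma dotpC n (u v : 'rV[R]_n) : dotp u v = dotp v u.
Proof. by apply: eq_bigr => i _; rewrite mulrC. Qed.

Lemma dotpDl n (u v w : 'rV[R]_n) : dotp (u + v) w = dotp u w + dotp v w.
Proof. by rewrite !dotpE mulmxDl mxE. Qed.

Lemma dotpNl n (u w : 'rV[R]_n) : dotp (- u) w = - dotp u w.
Proof. by rewrite !dotpE mulNmx mxE. Qed.

Lemma dotpZl n k (u w : 'rV[R]_n) : dotp (k *: u) w = k * dotp u w.
Proof. by rewrite !dotpE -scalemxAl mxE. Qed.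

Lemma dotp0l n (w : 'rV[R]_n) : dotp 0 w = 0.
Proof. by rewrite dotpE mul0mx mxE. Qed.

Lemma dotpBl n (u v w : 'rV[R]_n) : dotp (u - v) w = dotp u w - dotp v w.
Proof. by rewrite dotpDl dotpNl. Qed.

Lemma dotpDr n (u v w : 'rV[R]_n) : dotp w (u + v) = dotp w u + dotp w v.
Proof. by rewrite !(dotpC w) dotpDl. Qed.

Lemma dotpNr n (u w : 'rV[R]_n) : dotp w (- u) = - dotp w u.
Proof. by rewrite !(dotpC w) dotpNl. Qed.

Lemma dotpZr n k (u w : 'rV[R]_n) : dotp w (k *: u) = k * dotp w u.
Proof. by rewrite !(dotpC w) dotpZl. Qed.

Lemma dotp0r n (w : 'rV[R]_n) : dotp w 0 = 0.
Proof. by rewrite dotpC dotp0l. Qed.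

Lemma dotpBr n (u v w : 'rV[R]_n) : dotp w (u - v) = dotp w u - dotp w v.
Proof. by rewrite !(dotpC w) dotpBl. Qed.

Lemma dotp_mulmx n p (u : 'rV[R]_n) (M : 'M[R]_(n, p)) (v : 'rV[R]_p) :
  dotp (u *m M) v = dotp u (v *m M^T).
Proof. by rewrite !dotpE trmx_mul trmxK mulmxA. Qed.

Lemma dotp_ge0 n (u : 'rV[R]_n) : 0 <= dotp u u.
Proof. by apply: sumr_ge0 => i _; rewrite -expr2 sqr_ge0. Qed.

Lemma coord_le_norm m n (M : 'M[R]_(m, n)) i j : `|M i j| <= `|M|.
Proof.
rewrite [leRHS]/Num.norm/= mx_normrE.
by apply/bigmax_geP; right; exists (i, j).
Qed.

Lemma norm_le_coord m n (M : 'M[R]_(m, n)) c :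
  0 <= c -> (forall i j, `|M i j| <= c) -> `|M| <= c.
Proof.
by move=> c0 Mc; rewrite [leLHS]/Num.norm/= mx_normrE; apply/bigmax_leP; split.
Qed.

(** The norm of a matrix is its largest entry, which is not submultiplicative: the inner dimension
    appears as a factor. This is the origin of the factors [n%:R] in the constants below. *)
Lemma mulmx_norm_le m n p (A : 'M[R]_(m, n)) (B : 'M[R]_(n, p)) :
  `|A *m B| <= n%:R * `|A| * `|B|.
Proof.
apply: norm_le_coord => [|i j]; first by rewrite !mulr_ge0.
rewrite mxE; apply: le_trans (ler_norm_sum _ _ _) _.
have -> : n%:R * `|A| * `|B| = \sum_(k < n) `|A| * `|B|.
  by rewrite sumr_const card_ord -mulrA mulr_natl.
by apply: ler_sum => k _; rewrite normrM ler_pM//; exact: coord_le_norm.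
Qed.

Lemma norm_tr m n (A : 'M[R]_(m, n)) : `|A^T| = `|A|.
Proof.
apply/eqP; rewrite eq_le; apply/andP; split.
  by apply: norm_le_coord => // i j; rewrite mxE; exact: coord_le_norm.
apply: norm_le_coord => // i j.
by have := coord_le_norm A^T j i; rewrite mxE.
Qed.

Lemma dotp_le n (u v : 'rV[R]_n) : `|dotp u v| <= n%:R * `|u| * `|v|.
Proof.
rewrite dotpE; apply: le_trans (coord_le_norm _ _ _) _.
by rewrite -[`|v|]norm_tr; exact: mulmx_norm_le.
Qed.

Lemma sqr_norm_le_dotp n (u : 'rV[R]_n) : `|u| ^+ 2 <= dotp u u.
Proof.
rewrite -(@ler_sqrt _ _ (dotp u u)) ?dotp_ge0// sqrtr_sqr normr_id.
apply: norm_le_coord => [|i j]; first exact: sqrtr_ge0.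
rewrite -sqrtr_sqr ler_sqrt ?dotp_ge0// (ord1 i).
rewrite /dotp (bigD1 j)//= -expr2 lerDl.
by apply: sumr_ge0 => k _; rewrite -expr2 sqr_ge0.
Qed.

Lemma dotp_le_sqr_norm n (u : 'rV[R]_n) : dotp u u <= n%:R * `|u| ^+ 2.
Proof. by rewrite expr2 mulrA (le_trans (ler_norm _)) ?dotp_le. Qed.

Lemma dotp_eq0 n (u : 'rV[R]_n) : dotp u u = 0 -> u = 0.
Proof.
move=> u0; have := sqr_norm_le_dotp u; rewrite u0 => h.
by apply/eqP; rewrite -normr_eq0 -sqrf_eq0 eq_le h sqr_ge0.
Qed.

Lemma enorm_sqr n (u : 'rV[R]_n) : enorm u ^+ 2 = dotp u u.
Proof. by rewrite sqr_sqrtr ?dotp_ge0. Qed.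

Lemma enorm_ge0 n (u : 'rV[R]_n) : 0 <= enorm u.
Proof. exact: sqrtr_ge0. Qed.

Lemma enorm_le n (u : 'rV[R]_n) : enorm u <= n%:R * `|u|.
Proof.
rewrite -[leRHS]ger0_norm ?mulr_ge0// -sqrtr_sqr ler_sqrt ?sqr_ge0//.
rewrite (le_trans (dotp_le_sqr_norm u))// exprMn ler_wpM2r ?sqr_ge0//.
by rewrite -natrX ler_nat; case: n {u} => // n; rewrite expnS leq_pmulr.
Qed.

Lemma dotp_delta n (u : 'rV[R]_n) j : dotp (delta_mx ord0 j) u = u ord0 j.
Proof. by rewrite dotpE -rowE !mxE. Qed.

End Dotp.

(** * Strict differentiability and second-order expansions *)

Section StrictDiff.
Variable R : realType.

Lemma is_derive_line n (g : 'rV[R]_n -> R^o) (a v : 'rV[R]_n) (s : R) :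
  differentiable g (a + s *: v) ->
  is_derive (s : R^o) 1 (fun t : R^o => g (a + (t : R) *: v)) ('d g (a + s *: v) v).
Proof.
move=> dg; pose line (s : R^o) : 'rV[R]_n := a + (s : R) *: v.
have lineE (h : R) : line (h *: (1 : R^o) + s) = h *: v + line s.
  by rewrite /line scalerDl [h *: 1]mulr1 addrCA.
have D := @diff_derivable _ _ _ g (line s) v dg.
have E : (fun h : R => h^-1 *: (((g \o line) \o shift (s : R^o)) (h *: (1 : R^o))
    - (g \o line) s)) =
    (fun h : R => h^-1 *: ((g \o shift (line s)) (h *: v) - g (line s))).
  by apply/funext => h /=; rewrite lineE.
apply: DeriveDef; first by rewrite /derivable E; exact: D.
by rewrite -deriveE// /derive E.
Qed.

Lemma mvt01 (f df : R -> R) : (forall s : R, is_derive (s : R^o) 1 (f : R^o -> R^o) (df s)) ->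
  exists2 s : R, 0 <= s <= 1 & f 1 - f 0 = df s.
Proof.
move=> dphi.
have cphi : {within `[0, 1], continuous (f : R -> R)}.
  apply: continuous_subspaceT => s; apply: differentiable_continuous.
  by apply/derivable1_diffP; case: (dphi s).
have [s] := @MVT_segment R _ _ 0 1 ler01 (fun s _ => dphi s) cphi.
by rewrite in_itv/= subr0 mulr1 => s01 e; exists s.
Qed.

Lemma mvt_diff n (g : 'rV[R]_n -> R^o) (a b : 'rV[R]_n) :
  (forall x, differentiable g x) ->
  exists2 s : R, 0 <= s <= 1 & g b - g a = 'd g (a + s *: (b - a)) (b - a).
Proof.
move=> dg.
have [s s01] := mvt01 (fun s => is_derive_line (dg (a + s *: (b - a)))).
by rewrite scale1r scale0r addr0 [a + (b - a)]addrC subrK => e; exists s.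
Qed.

Lemma near_fst (T U : topologicalType) (x : T) (y : U) (P : T -> Prop) :
  (\forall a \near x, P a) -> \forall p \near (x, y), P p.1.
Proof.
move=> xP; exists (P, setT); first by split => //=; exact: filterT.
by move=> [a b] /= [].
Qed.

Lemma near_snd (T U : topologicalType) (x : T) (y : U) (P : U -> Prop) :
  (\forall b \near y, P b) -> \forall p \near (x, y), P p.2.
Proof.
move=> yP; exists (setT, P); first by split => //=; exact: filterT.
by move=> [a b] /= [].
Qed.

Definition grad n (g : 'rV[R]_n -> R^o) (x : 'rV[R]_n) : 'rV[R]_n :=
  \row_i 'd g x (delta_mx ord0 i).

Lemma diff_grad n (g : 'rV[R]_n -> R^o) x v : differentiable g x ->
  'd g x v = dotp (grad g x) v.
Proof.
move=> dg; rewrite {1}(row_sum_delta v) linear_sum; apply: eq_bigr => i _.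
by rewrite linearZ mxE mulrC.
Qed.

Definition has_grad n (g : 'rV[R]_n -> R) (D : 'rV[R]_n -> 'rV[R]_n) : Prop :=
  forall x, differentiable (g : 'rV[R]_n -> R^o) x /\ grad g x = D x.

Lemma has_grad_line n (g : 'rV[R]_n -> R) D (a v : 'rV[R]_n) (s : R) :
  has_grad g D ->
  is_derive (s : R^o) 1 (fun t : R^o => g (a + (t : R) *: v) : R^o)
    (dotp (D (a + s *: v)) v).
Proof.
move=> gD; rewrite -(proj2 (gD _)) -(diff_grad _ (proj1 (gD _))).
exact: (is_derive_line (proj1 (gD _))).
Qed.

Lemma has_grad_mvt n (g : 'rV[R]_n -> R) D (a b : 'rV[R]_n) :
  has_grad g D ->
  exists2 s : R, 0 <= s <= 1 & g b - g a = dotp (D (a + s *: (b - a))) (b - a).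
Proof.
move=> gD; have [s s01 e] := mvt_diff a b (fun x => proj1 (gD x)).
by exists s => //; rewrite e (diff_grad _ (proj1 (gD _))) (proj2 (gD _)).
Qed.

Lemma near_dist (V : normedModType R) (x : V) (d : R) : 0 < d ->
  \forall a \near x, `|x - a| < d.
Proof. by move=> d0; have := nbhsx_ballx x d d0; rewrite -ball_normE. Qed.

Lemma near_dist_fst (V W : normedModType R) (x : V) (y : W) (d : R) : 0 < d ->
  \forall p \near (x, y), `|x - p.1| < d.
Proof. by move=> d0; exact: near_fst (near_dist x d0). Qed.

Lemma near_dist_snd (V W : normedModType R) (x : V) (y : W) (d : R) : 0 < d ->
  \forall p \near (x, y), `|y - p.2| < d.
Proof. by move=> d0; exact: near_snd (near_dist y d0). Qed.

Lemma near_segment n (x : 'rV[R]_n) (P : 'rV[R]_n -> Prop) :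
  (\forall y \near x, P y) ->
  \forall p \near (x, x), forall s : R, 0 <= s <= 1 ->
    P (p.2 + s *: (p.1 - p.2)).
Proof.
move=> /nbhs_ballP[d /= d0 dP]; near=> p => s /andP[s0 s1]; apply: dP.
rewrite -ball_normE/=.
have -> : x - (p.2 + s *: (p.1 - p.2)) = s *: (x - p.1) + (1 - s) *: (x - p.2).
  by apply/rowP => i; rewrite !mxE; ring.
have p1 : `|x - p.1| < d by near: p; exact: near_dist_fst.
have p2 : `|x - p.2| < d by near: p; exact: near_dist_snd.
apply: le_lt_trans (ler_normD _ _) _.
rewrite !normrZ (ger0_norm s0) ger0_norm ?subr_ge0//.
set A := `|_|; set B := `|_|; set M := Num.max A B.
have Md : M < d by rewrite gt_max p1 p2.
apply: le_lt_trans Md.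
have AM : A <= M by rewrite le_max lexx.
have BM : B <= M by rewrite le_max lexx orbT.
have := mulr_ge0 s0 (ltac:(by rewrite subr_ge0) : 0 <= M - A).
have := mulr_ge0 (ltac:(by rewrite subr_ge0) : 0 <= 1 - s)
  (ltac:(by rewrite subr_ge0) : 0 <= M - B).
lra.
Unshelve. all: by end_near. Qed.

(** The mean value theorem writes the increment with [D] at a point of the segment. Near the
    diagonal the whole segment is close to [x], so continuity of [D] at [x] alone gives the
    two-point estimate. *)
Lemma sdiff_scalar n (g : 'rV[R]_n -> R) D (x : 'rV[R]_n) :
  has_grad g D -> D @ x --> D x ->
  forall e : R, 0 < e -> \forall p \near (x, x),
    `|g p.1 - g p.2 - dotp (D x) (p.1 - p.2)| <= e * `|p.1 - p.2|.
Proof.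
move=> gD cD e e0.
have en0 : 0 < e / n.+1%:R by rewrite divr_gt0.
have H : \forall y \near x, `|D x - D y| <= e / n.+1%:R.
  exact: cvgr_dist_le cD _ en0.
have := near_segment H; apply: filterS => -[a b]/= {}H.
have [s s01 ->] := has_grad_mvt b a gD.
rewrite -dotpBl (le_trans (dotp_le _ _))// ler_wpM2r//.
have := H _ s01; rewrite distrC => {}H.
apply: le_trans (ler_wpM2l _ H) _ => //.
rewrite mulrCA ger_pMr// ler_pdivrMr ?ltr0n// mul1r ler_nat//.
Qed.

(** Strict differentiability at [x]: both points of the increment move. As for Jacobians, the matrix
    acts on the right. *)
Definition sdiff n q (f : 'rV[R]_n -> 'rV[R]_q) (x : 'rV[R]_n)
    (J : 'M[R]_(n, q)) : Prop :=
  forall e : R, 0 < e -> \forall p \near (x, x),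
    `|f p.1 - f p.2 - (p.1 - p.2) *m J| <= e * `|p.1 - p.2|.

(** The mean value theorem is scalar, so vector-valued estimates are assembled from their
    coordinates. *)
Lemma sdiff_coord n q (f : 'rV[R]_n -> 'rV[R]_q) (x : 'rV[R]_n) J :
  (forall j, forall e : R, 0 < e -> \forall p \near (x, x),
    `|f p.1 ord0 j - f p.2 ord0 j - dotp (col j J)^T (p.1 - p.2)|
      <= e * `|p.1 - p.2|) ->
  sdiff f x J.
Proof.
move=> H e e0.
have := @filter_forall _ _ (fun j p => `|f p.1 ord0 j - f p.2 ord0 j
  - dotp (col j J)^T (p.1 - p.2)| <= e * `|p.1 - p.2|) (nbhs (x, x)) _.
move=> /(_ _ (fun j => H j e e0)); apply: filterS => -[a b]/= {}H.
apply: norm_le_coord => [|i j]; first by rewrite mulr_ge0// ltW.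
rewrite (ord1 i) !mxE; apply: le_trans (H j).
rewrite le_eqVlt; apply/orP; left; apply/eqP; congr (`|_ - _|).
by apply: eq_bigr => k _; rewrite !mxE mulrC.
Qed.

End StrictDiff.

(** * Gradients and Hessians of twice differentiable functions *)

Section C2.
Variable R : realType.

Lemma near_diag_right (T : topologicalType) (x : T) (P : T * T -> Prop) :
  (\forall p \near (x, x), P p) -> \forall y \near x, P (x, y).
Proof.
move=> [[A B] /= [xA xB] AB]; apply: filterS xB => y By.
by apply: AB; split => //=; exact: nbhs_singleton.
Qed.

Lemma near_diag_left (T : topologicalType) (x : T) (P : T * T -> Prop) :
  (\forall p \near (x, x), P p) -> \forall y \near x, P (y, x).
Proof.
move=> [[A B] /= [xA xB] AB]; apply: filterS xA => y Ay.
by apply: AB; split => //=; exact: nbhs_singleton.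
Qed.

Lemma near_continuous (V W : normedModType R) (f : V -> W) (x : V) :
  {for x, continuous f} ->
  forall e : R, 0 < e -> \forall y \near x, `|f x - f y| <= e.
Proof. by move=> cf e e0; exact: (cvgr_dist_le (F := nbhs x) f (f x) cf). Qed.

Lemma cvg_of_near T (F : set_system T) {FF : Filter F} (V : normedModType R)
    (f : T -> V) (y : V) :
  (forall e : R, 0 < e -> \forall t \near F, `|y - f t| <= e) -> f @ F --> y.
Proof. by move=> H; apply/cvgrPdist_le. Qed.

Lemma cvg_mx_coord T (F : set_system T) {FF : Filter F} m n (f : T -> 'M[R]_(m, n))
    (M : 'M[R]_(m, n)) :
  (forall i j (e : R), 0 < e -> \forall t \near F, `|M i j - f t i j| <= e) -> f @ F --> M.
Proof.
move=> H; apply/cvgrPdist_le => e e0.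
have H' : \forall t \near F, forall ij : 'I_m * 'I_n,
    `|M ij.1 ij.2 - f t ij.1 ij.2| <= e.
  by apply: (@filter_forall _ _ _ F FF) => -[i j]; exact: H.
move: H'; apply: filterS => t H'; apply: norm_le_coord => [|i j]; first exact: ltW.
by have := H' (i, j); rewrite !mxE.
Qed.

Lemma dotp_linear n (l : 'rV[R]_n) : linear (dotp l : 'rV[R]_n -> R^o).
Proof. by move=> k u v; rewrite dotpDr dotpZr. Qed.

HB.instance Definition _ n (l : 'rV[R]_n) :=
  GRing.isLinear.Build R 'rV[R]_n R^o _ (dotp l : _ -> R^o) (@dotp_linear n l).

Lemma cvg_dotpl T (F : set_system T) {FF : Filter F} n (l : 'rV[R]_n)
  (f : T -> 'rV[R]_n) u : f @ F --> u -> (fun t => dotp l (f t)) @ F --> dotp l u.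
Proof.
move=> fu; apply/cvgrPdist_le => e e0.
pose c := n%:R * `|l| + 1.
have c0 : 0 < c by rewrite ltr_wpDl// mulr_ge0.
have : \forall t \near F, `|u - f t| <= e / c.
  by apply: cvgr_dist_le fu _ _; exact: divr_gt0.
apply: filterS => t H.
rewrite -dotpBr (le_trans (dotp_le _ _))//.
apply: le_trans (ler_wpM2l _ H) _; first by rewrite mulr_ge0.
by rewrite mulrCA ger_pMr// ler_pdivrMr// mul1r lerDl.
Qed.

Lemma dotp_continuous n (l : 'rV[R]_n) : continuous (dotp l : _ -> R^o).
Proof. by move=> u; exact: (@cvg_dotpl _ _ (nbhs_filter u) _ l (fun t => t) u). Qed.

Lemma diff_dotpl n q (F : 'rV[R]_n -> 'rV[R]_q) (l : 'rV[R]_q) x :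
  differentiable F x ->
  differentiable (fun y => dotp l (F y) : R^o) x /\
  forall v, 'd (fun y => dotp l (F y) : R^o) x v = dotp l ('d F x v).
Proof.
move=> dF.
have dl : differentiable (dotp l : _ -> R^o) (F x).
  exact: (linear_differentiable (F x) (@dotp_continuous _ l)).
split; first exact: (differentiable_comp dF dl).
move=> v; have := diff_comp dF dl; rewrite /comp => ->.
by rewrite (diff_lin _ (@dotp_continuous _ l)).
Qed.

Lemma Cp_dotpl n q p (F : 'rV[R]_n -> 'rV[R]_q) (l : 'rV[R]_q) :
  Cp p F -> Cp p (fun y => dotp l (F y) : R^o).
Proof.
elim: p F => [F cF x|p IH F [dF cF]].
  have := @cvg_dotpl _ _ (nbhs_filter x) _ l F (F x) (cF x); exact.
split=> [x|v]; first by case: (diff_dotpl l (dF x)).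
have -> : (fun x => 'd (fun y => dotp l (F y) : R^o) x v) =
   (fun x => dotp l ('d F x v)).
  by apply/funext => x; case: (diff_dotpl l (dF x)).
exact: (IH _ (cF v)).
Qed.

Lemma gradE n (g : 'rV[R]_n -> R^o) x i j :
  grad g x i j = 'd g x (delta_mx ord0 j).
Proof. by rewrite /grad mxE. Qed.

(** [Cp] asks for continuity of the derivative in each fixed direction; the basis directions are
    finitely many and give continuity of the whole gradient. *)
Lemma Cp1_grad n (g : 'rV[R]_n -> R^o) : Cp 1 g ->
  has_grad g (grad g) /\ forall x : 'rV[R]_n, grad g @ x --> grad g x.
Proof.
move=> [dg cg]; split=> // x.
apply: (@cvg_mx_coord _ _ (nbhs_filter x)) => i j e e0.
have E : (fun y => 'd g y (delta_mx ord0 j) : R^o) = (fun y => grad g y i j : R^o).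
  by apply/funext => y; rewrite gradE.
have := cg (delta_mx ord0 j) x.
rewrite E => cgx.
exact: (@near_continuous 'rV[R]_n R^o _ x cgx e e0).
Qed.

(** Row [i] differentiates along coordinate [i], so that increments of the gradient are approximated
    by right multiplication. *)
Definition hess n (g : 'rV[R]_n -> R^o) (x : 'rV[R]_n) : 'M[R]_n :=
  \matrix_(i, j) grad (fun y => grad g y ord0 j : R^o) x ord0 i.

(** First-order data are required everywhere, second-order data only as a strict derivative of the
    gradient at [x]. This suffices for the Taylor formula and for symmetry. *)
Definition C2at n (g : 'rV[R]_n -> R) (x : 'rV[R]_n) D (H : 'M[R]_n) : Prop :=
  has_grad g D /\ sdiff D x H.

Lemma Cp2_C2at n (g : 'rV[R]_n -> R^o) x : Cp 2 g ->
  C2at g x (grad g) (hess g x).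
Proof.
move=> [dg cg]; split=> //; apply: sdiff_coord => j e e0.
have E : (fun y => 'd g y (delta_mx ord0 j) : R^o) = (fun y => grad g y ord0 j : R^o).
  by apply/funext => y; rewrite gradE.
have := cg (delta_mx ord0 j); rewrite E => /Cp1_grad[gj cj].
have -> : (col j (hess g x))^T = grad (fun y => grad g y ord0 j : R^o) x.
  by apply/rowP => i; rewrite /hess 3!mxE.
exact: (sdiff_scalar gj (cj x) e0).
Qed.

Lemma grad_dotpl n q (F : 'rV[R]_n -> 'rV[R]_q) (l : 'rV[R]_q) x :
  differentiable F x ->
  grad (fun y => dotp l (F y) : R^o) x = l *m ('J F x)^T.
Proof.
move=> dF; apply/rowP => i; rewrite mxE (proj2 (diff_dotpl l dF)).
by rewrite mxE; apply: eq_bigr => k _; rewrite !mxE.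
Qed.

Lemma Cp1_sdiff n q (F : 'rV[R]_n -> 'rV[R]_q) x : Cp 1 F -> sdiff F x ('J F x).
Proof.
move=> cF; have [dF _] := cF; apply: sdiff_coord => j e e0.
have [gj cj] := Cp1_grad (Cp_dotpl (delta_mx ord0 j) cF).
have := sdiff_scalar gj (cj x) e0; apply: filterS => -[a b]/=.
rewrite !dotp_delta grad_dotpl//.
apply: le_trans; rewrite le_eqVlt; apply/orP; left; apply/eqP.
by congr (`|_ - dotp _ _|); rewrite -rowE; apply/rowP => i; rewrite !mxE.
Qed.

Lemma Cp2_C2at_dotpl n q (F : 'rV[R]_n -> 'rV[R]_q) (l : 'rV[R]_q) x : Cp 2 F ->
  C2at (fun y => dotp l (F y)) x (fun y => l *m ('J F y)^T)
    (hess (fun y => dotp l (F y) : R^o) x).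
Proof.
move=> cF; have [dF _] := cF; have := Cp2_C2at x (Cp_dotpl l cF).
have -> : grad (fun y => dotp l (F y) : R^o) = (fun y => l *m ('J F y)^T).
  by apply/funext => y; exact: grad_dotpl.
by [].
Qed.

Lemma sdiffD n q (f g : 'rV[R]_n -> 'rV[R]_q) x J K :
  sdiff f x J -> sdiff g x K -> sdiff (fun y => f y + g y) x (J + K).
Proof.
move=> fJ gK e e0; have e20 : 0 < e / 2 by rewrite divr_gt0.
move: (fJ _ e20) (gK _ e20); apply: filterS2 => -[a b]/= h1 h2.
have -> : f a + g a - (f b + g b) - (a - b) *m (J + K) =
  (f a - f b - (a - b) *m J) + (g a - g b - (a - b) *m K).
  by rewrite mulmxDr; apply/rowP => i; rewrite !mxE; ring.
apply: le_trans (ler_normD _ _) _; lra.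
Qed.

Lemma C2atD n (f g : 'rV[R]_n -> R) x D E H K :
  C2at f x D H -> C2at g x E K ->
  C2at (fun y => f y + g y) x (fun y => D y + E y) (H + K).
Proof.
move=> [fD DH] [gE EK]; split; last exact: sdiffD.
move=> y; have [df <-] := fD y; have [dg <-] := gE y.
split; first exact: (differentiableD df dg).
apply/rowP => i; rewrite !mxE.
by have := diffD df dg => /(congr1 (fun h => h (delta_mx ord0 i))).
Qed.

Lemma sdiff_lipschitz n q (f : 'rV[R]_n -> 'rV[R]_q) x J : sdiff f x J ->
  exists2 L : R, 0 < L &
    \forall p \near (x, x), `|f p.1 - f p.2| <= L * `|p.1 - p.2|.
Proof.
move=> fJ; exists (1 + n%:R * `|J|); first by rewrite ltr_wpDr ?mulr_ge0.
have := fJ _ ltr01; apply: filterS => -[a b]/= H.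
rewrite -[f a - f b](subrK ((a - b) *m J)) (le_trans (ler_normD _ _))//.
by rewrite mulrDl lerD// mulrAC (mulmx_norm_le (a - b) J).
Qed.

Lemma sdiff_cvg n q (f : 'rV[R]_n -> 'rV[R]_q) x J : sdiff f x J ->
  f @ x --> f x.
Proof.
move=> /sdiff_lipschitz[L L0 H]; apply: (cvg_of_near (F := nbhs x)) => e e0.
have : \forall y \near x, `|f x - f y| <= L * `|x - y|.
  exact: (near_diag_right H).
move=> h2; have := near_dist x (divr_gt0 e0 L0); move: h2.
apply: filterS2 => y.
rewrite ltr_pdivlMr// => h1 h2; apply: le_trans h1 _; rewrite mulrC; exact: ltW.
Qed.

End C2.

(** * Second-order expansion and symmetry of the Hessian *)

Section Taylor.
Variable R : realType.

Lemma is_derive_quad (f : R -> R) (df c1 c2 s : R) :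
  is_derive (s : R^o) 1 (f : R^o -> R^o) df ->
  is_derive (s : R^o) 1 (fun t : R^o => f t - t * c1 - t ^+ 2 * (c2 / 2) : R^o)
    (df - c1 - s * c2).
Proof.
move=> h.
have h1 : is_derive (s : R^o) 1 (c1 *: (id : R^o -> R^o)) (c1 *: 1) by exact: is_deriveZ.
have h2 : is_derive (s : R^o) 1 ((c2 / 2) *: ((id : R^o -> R^o) ^+ 2)) ((c2 / 2) *: (2%:R * s ^+ 1 *: 1)).
  by apply: is_deriveZ.
have := is_deriveB (is_deriveB h h1) h2.
have -> : (f : R^o -> R^o) - c1 *: (id : R^o -> R^o) - (c2 / 2) *: ((id : R^o -> R^o) ^+ 2)
  = (fun t : R^o => f t - t * c1 - t ^+ 2 * (c2 / 2) : R^o).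
  by apply/funext => t; rewrite !fctE /= /GRing.scale/= mulrC [c2 / 2 * _]mulrC.
move=> hh; apply: is_derive_eq hh _.
by rewrite /GRing.scale/= expr1; field.
Qed.

(** The quadratic model is subtracted along the segment before the mean value theorem is applied;
    what remains is the linearization error of the gradient at one point, so no second derivative
    away from [x] occurs. *)
Lemma taylor2 n (g : 'rV[R]_n -> R) x D (H : 'M[R]_n) : C2at g x D H ->
  forall e : R, 0 < e -> \forall y \near x,
    `|g y - g x - dotp (D x) (y - x) - dotp ((y - x) *m H) (y - x) / 2|
      <= e * `|y - x| ^+ 2.
Proof.
move=> [gD DH] e e0.
have en0 : 0 < e / n.+1%:R by rewrite divr_gt0.
have [d /= d0 dP] := (nbhs_ballP _ _).1 (near_diag_left (DH _ en0)).
have xd : \forall y \near x, `|x - y| < d by exact: near_dist.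
near=> y; set v := y - x.
have vd : `|v| < d by rewrite /v distrC; near: y; exact: xd.
pose c1 := dotp (D x) v; pose c2 := dotp (v *m H) v.
pose f (s : R) := g (x + s *: v) - s * c1 - s ^+ 2 * (c2 / 2).
have [s /andP[s0 s1]] := mvt01 (fun s => is_derive_quad c1 c2 (has_grad_line x v s gD)).
rewrite expr1n !mul1r expr0n/= !mul0r !subr0 scale1r scale0r addr0.
have -> : x + v = y by rewrite /v addrC subrK.
have -> : g y - c1 - c2 / 2 - g x = g y - g x - c1 - c2 / 2 by ring.
move=> ->.
have -> : dotp (D (x + s *: v)) v - c1 - s * c2 =
   dotp (D (x + s *: v) - D x - (x + s *: v - x) *m H) v.
  have -> : x + s *: v - x = s *: v by rewrite addrAC subrr add0r.
  by rewrite -scalemxAl !dotpBl dotpZl.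
apply: le_trans (dotp_le _ _) _.
have sv : `|s *: v| <= `|v| by rewrite normrZ ger0_norm// ler_piMl.
have /dP/= : ball x d (x + s *: v).
  by rewrite -ball_normE/= opprD addrA subrr add0r normrN (le_lt_trans sv).
have E : x + s *: v - x = s *: v by rewrite addrAC subrr add0r.
rewrite E => h.
have {}h := le_trans h (ler_wpM2l (ltW en0) sv).
rewrite expr2 mulrA ler_wpM2r//.
apply: le_trans (ler_wpM2l _ h) _ => //.
rewrite mulrA ler_wpM2r// mulrCA ger_pMr// ler_pdivrMr ?ltr0n// mul1r ler_nat//.
Unshelve. all: by end_near. Qed.

Lemma near_right_scale (c d : R) : 0 <= c -> 0 < d ->
  \forall t \near (0 : R)^'+, t * c < d.
Proof.
move=> c0 d0; have c1 : 0 < c + 1 by rewrite ltr_wpDl.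
near=> t; have t0 : 0 < t by [].
apply: (@le_lt_trans _ _ (t * (c + 1))); first by rewrite ler_pM2l// lerDl.
rewrite -ltr_pdivlMr//; near: t; apply: nbhs_right_lt; exact: divr_gt0.
Unshelve. all: by end_near. Qed.

(** The mean value theorem in the direction [b] is applied to a difference of two shifted copies of
    [g]. It leaves a difference of gradients at two moving points [p] and [q] with [p - q = t a],
    which is exactly what strict differentiability controls. *)
Lemma C2at_mixed n (g : 'rV[R]_n -> R) x D (H : 'M[R]_n) (a b : 'rV[R]_n) :
  C2at g x D H -> forall e : R, 0 < e -> \forall t \near (0 : R)^'+,
    `|g (x + t *: a + t *: b) - g (x + t *: b) - g (x + t *: a) + g x
      - t ^+ 2 * dotp (a *m H) b| <= e * t ^+ 2.
Proof.
move=> [gD DH] e e0.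
pose c := n%:R * `|a| * `|b| + 1.
have c0 : 0 < c by rewrite ltr_wpDl// !mulr_ge0.
have ec0 : 0 < e / c by rewrite divr_gt0.
have [[A B] /= [xA xB] AB] := DH _ ec0.
have [d1 /= d10 d1A] := (nbhs_ballP _ _).1 xA.
have [d2 /= d20 d2B] := (nbhs_ballP _ _).1 xB.
near=> t.
have t0 : 0 < t by [].
have ta : t * (`|a| + `|b|) < d1.
  by near: t; apply: near_right_scale => //; rewrite addr_ge0.
have tb : t * (`|b|) < d2.
  by near: t; apply: near_right_scale.
pose f s := g (x + t *: a + s *: (t *: b)) - g (x + s *: (t *: b)).
have df s : is_derive (s : R^o) 1 (f : R^o -> R^o)
   (dotp (D (x + t *: a + s *: (t *: b))) (t *: b) - dotp (D (x + s *: (t *: b))) (t *: b)).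
  exact: (is_deriveB (has_grad_line (x + t *: a) (t *: b) s gD) (has_grad_line x (t *: b) s gD)).
have [s /andP[s0 s1]] := mvt01 df.
rewrite /f !scale1r !scale0r !addr0 -dotpBl.
have -> : forall A B C E : R, A - B - (C - E) = A - B - C + E by move=> *; ring.
move=> ->.
set p := x + t *: a + s *: (t *: b); set q := x + s *: (t *: b).
have pq : p - q = t *: a by rewrite /p /q; apply/rowP => i; rewrite !mxE; ring.
have -> : dotp (D p - D q) (t *: b) - t ^+ 2 * dotp (a *m H) b =
   t * dotp (D p - D q - (p - q) *m H) b.
  by rewrite pq -scalemxAl dotpZr [in RHS]dotpBl dotpZl; ring.
have stb : `|s *: (t *: b)| <= t * `|b|.
  by rewrite !normrZ (ger0_norm s0) (gtr0_norm t0) ler_piMl// mulr_ge0// ltW.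
have /AB/= : (A `*` B) (p, q).
  split => /=.
    apply: d1A; rewrite -ball_normE/= /p -addrA opprD addrA subrr add0r normrN.
    apply: le_lt_trans ta; apply: le_trans (ler_normD _ _) _.
    by rewrite mulrDr lerD// normrZ gtr0_norm.
  apply: d2B; rewrite -ball_normE/= /q opprD addrA subrr add0r normrN.
  exact: le_lt_trans tb.
rewrite pq normrZ (gtr0_norm t0) => h.
have -> : e * t ^+ 2 = t * (e * t) by ring.
rewrite normrM (gtr0_norm t0) ler_pM2l//.
apply: le_trans (dotp_le _ _) _.
apply: le_trans (ler_wpM2r (normr_ge0 b) (ler_wpM2l (ler0n R n) h)) _.
have -> : n%:R * (e / c * (t * `|a|)) * `|b| = (e * t) * ((n%:R * `|a| * `|b|) / c).
  by ring.
by rewrite ger_pMr ?mulr_gt0// ler_pdivrMr// mul1r lerDl.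
Unshelve. all: by end_near. Qed.

(** The mixed second difference is symmetric in [a] and [b], and it determines [<a H, b>] up to [e]
    after division by [t ^+ 2]. *)
Lemma C2at_sym n (g : 'rV[R]_n -> R) x D (H : 'M[R]_n) : C2at g x D H -> H^T = H.
Proof.
move=> gC.
suff dH a b : dotp (a *m H) b = dotp (b *m H) a.
  apply/matrixP => i j; rewrite mxE.
  have := dH (delta_mx ord0 i) (delta_mx ord0 j).
  by rewrite 2![dotp (_ *m _) _]dotpC !dotp_delta -!rowE !mxE.
apply/eqP; rewrite -subr_eq0 -normr_le0; apply/ler_addgt0Pl => e e0.
rewrite addr0.
have e20 : 0 < e / 2 by rewrite divr_gt0.
near (0 : R)^'+ => t.
have t20 : 0 < t ^+ 2 by rewrite exprn_gt0.
have h1 : `|g (x + t *: a + t *: b) - g (x + t *: b) - g (x + t *: a) + g x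
      - t ^+ 2 * dotp (a *m H) b| <= e / 2 * t ^+ 2.
  near: t; exact: (C2at_mixed a b gC e20).
have h2 : `|g (x + t *: b + t *: a) - g (x + t *: a) - g (x + t *: b) + g x
      - t ^+ 2 * dotp (b *m H) a| <= e / 2 * t ^+ 2.
  near: t; exact: (C2at_mixed b a gC e20).
rewrite -(ler_pM2l t20) -{1}(gtr0_norm t20) -normrM mulrBr.
rewrite [x + t *: b + t *: a]addrAC in h2.
rewrite ler_norml; move: h1 h2; rewrite !ler_norml => /andP[h1 h2] /andP[h3 h4].
apply/andP; split; lra.
Unshelve. all: by end_near. Qed.

End Taylor.

(** * Metric regularity, tangent and normal vectors *)

Section MetricRegularity.
Variable R : realType.

Lemma compact_cball n (x : 'rV[R]_n) (d : R) : 0 < d ->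
  compact [set y : 'rV[R]_n | `|x - y| <= d].
Proof.
move=> d0.
have -> : [set y : 'rV[R]_n | `|x - y| <= d] = closed_ball x d.
  by rewrite closed_ballE.
apply: bounded_closed_compact; last exact: closed_ball_closed.
exists (`|x| + d); split; first exact: num_real.
move=> M Md y; rewrite closed_ballE// => xy.
apply: le_trans (ltW Md).
rewrite -[y](subrK x) addrC (le_trans (ler_normD _ _))// lerD2l.
by rewrite distrC.
Qed.

(* Ekeland's argument: a minimizer of [|P y| + e |y - y0|] near x is a zero of
   P, since otherwise a Newton step decreases the first term faster than it
   increases the second. *)
Lemma metric_regularity n q (P : 'rV[R]_n -> 'rV[R]_q) x (J : 'M[R]_(n, q))
    (Ji : 'M[R]_(q, n)) :
  continuous P -> sdiff P x J -> Ji *m J = 1%:M -> P x = 0 ->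
  exists2 C : R, 0 < C & \forall y0 \near x,
    exists2 y1, P y1 = 0 & `|y1 - y0| <= C * `|P y0|.
Proof.
move=> cP PJ JiJ Px.
pose K := q%:R * `|Ji| + 1.
have K0 : 0 < K by rewrite ltr_wpDl// mulr_ge0.
have KP (g : 'rV_q) : `|g *m Ji| <= K * `|g|.
  apply: le_trans (mulmx_norm_le _ _) _.
  by rewrite mulrDl mul1r mulrAC lerDl.
have eta0 : 0 < (2 * K)^-1 by rewrite invr_gt0 mulr_gt0.
have [[A B] /= [xA xB] AB] := PJ _ eta0.
have [d1 /= d10 d1A] := (nbhs_ballP _ _).1 (filterI xA xB).
(* In units of [t * |g|], the Newton step below gains 1, loses at most 1/2 to the linearization
   error and at most 1/4 to the penalty. *)
pose e := (4 * K)^-1; have e0 : 0 < e by rewrite invr_gt0 mulr_gt0.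
pose d := d1 / 2; have d0 : 0 < d by rewrite divr_gt0.
exists (4 * K); first by rewrite mulr_gt0.
have Pd a b : `|x - a| <= d -> `|x - b| <= d ->
    `|P a - P b - (a - b) *m J| <= (2 * K)^-1 * `|a - b|.
  have dd1 : d < d1 by rewrite /d ltr_pdivrMr// ltr_pMr// ltr1n.
  move=> xa xb; apply: (AB (a, b)); split => /=.
    by have /d1A[] : ball x d1 a by rewrite -ball_normE/=; exact: le_lt_trans dd1.
  by have /d1A[] : ball x d1 b by rewrite -ball_normE/=; exact: le_lt_trans dd1.
have Pnear : \forall y \near x, `|P x - P y| <= e * (d / 4).
  by apply: near_continuous; [exact: cP|rewrite mulr_gt0// divr_gt0].
have xnear : \forall y \near x, `|x - y| < d / 4 by apply: near_dist; rewrite divr_gt0.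
near=> y0.
have Py0 : `|P y0| <= e * (d / 4).
  by rewrite -[P y0]opprK normrN -[- P y0]add0r -Px; near: y0; exact: Pnear.
have xy0 : `|x - y0| < d / 4 by near: y0; exact: xnear.
pose Psi y := `|P y| + e * `|y - y0|.
have cPsi : continuous Psi.
  move=> y; apply: (cvg_of_near (F := nbhs y)) => a a0.
  have a20 : 0 < a / 2 by rewrite divr_gt0.
  have := near_dist y (divr_gt0 a20 e0); move: (near_continuous (cP y) a20).
  apply: filterS2 => z h1; rewrite ltr_pdivlMr// => h2; rewrite /Psi.
  have -> : `|P y| + e * `|y - y0| - (`|P z| + e * `|z - y0|) =
    (`|P y| - `|P z|) + (`|y - y0| - `|z - y0|) * e by ring.
  apply: le_trans (ler_normD _ _) _; rewrite normrM (gtr0_norm e0).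
  have h3 := le_trans (ler_dist_dist _ _) h1.
  have : `|(`|y - y0| - `|z - y0|)| * e <= `|y - z| * e.
    rewrite ler_wpM2r ?(ltW e0)//; apply: le_trans (ler_dist_dist _ _) _.
    by rewrite opprB addrA subrK.
  lra.
have [||y1 + ymin] := EVT_min_rV (f := Psi) _ (@compact_cball _ x _ d0).
- by exists x; rewrite /= subrr normr0 ltW.
- exact: continuous_subspaceT.
rewrite inE/= => y1d.
have y0d : `|x - y0| <= d by apply: le_trans (ltW xy0) _; rewrite ler_pdivrMr// ler_pMr// ler1n.
have := ymin y0 (mem_set y0d); rewrite /Psi subrr normr0 mulr0 addr0 => m0.
have ey1 : e * `|y1 - y0| <= `|P y0| by apply: le_trans m0; rewrite lerDr.
have y1C : `|y1 - y0| <= 4 * K * `|P y0|.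
  by rewrite -ler_pdivrMl ?mulr_gt0.
exists y1 => //.
have y1d4 : `|y1 - y0| <= d / 4.
  by rewrite -(ler_pM2l e0); exact: le_trans ey1 Py0.
have xy1 : `|x - y1| <= d / 2.
  have -> : x - y1 = (x - y0) - (y1 - y0) by rewrite opprB addrA subrK.
  apply: le_trans (ler_normB _ _) _; lra.
apply/eqP; apply: contraT => g0; set g := P y1 in g0 *.
have gn0 : 0 < `|g| by rewrite normr_gt0.
(* The Newton step is shortened so as to fit in the distance [d / 2] that separates the minimizer
   from the boundary of the ball. *)
pose t := Num.min 1 (d / 2 / (K * `|g|)).
have Kg0 : 0 < K * `|g| by rewrite mulr_gt0.
have t0 : 0 < t by rewrite lt_min ltr01/= !divr_gt0.
have t1 : t <= 1 by rewrite ge_min lexx.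
have td : t * (K * `|g|) <= d / 2 by rewrite -ler_pdivlMr// ge_min lexx orbT.
pose v := - (t *: (g *m Ji)).
have nv : `|v| <= t * (K * `|g|).
  by rewrite normrN normrZ gtr0_norm// ler_pM2l.
have y2d : `|x - (y1 + v)| <= d.
  rewrite opprD addrA (le_trans (ler_normB _ _))//; lra.
have := ymin _ (mem_set y2d); rewrite /Psi -/g.
have := Pd _ _ y2d y1d; rewrite -/g.
have -> : y1 + v - y1 = v by rewrite addrAC subrr add0r.
have -> : v *m J = - (t *: g).
  by rewrite mulNmx -scalemxAl -mulmxA JiJ mulmx1.
rewrite opprK => h1 h2.
have h3 : `|P (y1 + v)| <= (1 - t) * `|g| + (2 * K)^-1 * `|v|.
  have -> : P (y1 + v) = (1 - t) *: g + (P (y1 + v) - g + t *: g).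
    by rewrite scalerBl scale1r; apply/rowP => i; rewrite !mxE; ring.
  apply: le_trans (ler_normD _ _) _.
  by rewrite normrZ ger0_norm ?subr_ge0// lerD2l.
have h4 : `|y1 + v - y0| <= `|y1 - y0| + `|v|.
  by rewrite addrAC ler_normD.
have h5 : (2 * K)^-1 * `|v| <= t * `|g| / 2.
  rewrite ler_pdivrMl ?mulr_gt0//; apply: le_trans nv _.
  by rewrite le_eqVlt; apply/orP; left; apply/eqP; field.
have h6 : e * `|v| <= t * `|g| / 4.
  rewrite ler_pdivrMl ?mulr_gt0//; apply: le_trans nv _.
  by rewrite le_eqVlt; apply/orP; left; apply/eqP; field.
have h7 : e * `|y1 + v - y0| <= e * `|y1 - y0| + e * `|v|.
  by rewrite -mulrDr ler_wpM2l// ltW.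
have tg : 0 < t * `|g| by rewrite mulr_gt0.
clear g0 PJ JiJ Px.
lra.
Unshelve. all: by end_near. Qed.

End MetricRegularity.

Section TangentNormal.
Variable R : realType.

Lemma orthogonal_kernel n q (J : 'M[R]_(n, q)) (b : 'rV[R]_n) :
  (forall u, u *m J = 0 -> dotp b u = 0) -> exists l, b = l *m J^T.
Proof.
move=> H; apply/submxP; rewrite submxE.
have kJ : (cokermx J^T)^T *m J = 0.
  by rewrite -{2}[J]trmxK -trmx_mul mulmx_coker trmx0.
apply/eqP/rowP => j; rewrite [RHS]mxE.
have := H (row j (cokermx J^T)^T); rewrite -row_mul kJ row0 => /(_ erefl).
by rewrite dotpE -tr_col trmxK => <-; rewrite !mxE; apply: eq_bigr => k _; rewrite !mxE.
Qed.

Lemma le0_of_small (s K : R) : 0 <= K ->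
  (forall e, 0 < e -> e <= 1 -> s <= e * K) -> s <= 0.
Proof.
move=> K0 H; rewrite leNgt; apply/negP => s0.
have K1 : 0 < 2 * (K + s) by rewrite mulr_gt0// ltr_wpDl.
pose e := s / (2 * (K + s)).
have e0 : 0 < e by rewrite divr_gt0.
have e1 : e <= 1 by rewrite ler_pdivrMr// mul1r; lra.
have := H e e0 e1; rewrite /e mulrAC ler_pdivlMr//; nra.
Qed.

(** The point [y + t u] is moved to a zero of [P] by metric regularity, at a distance of order
    [|P (y + t u)| = o(t)]. Regularity at [x] holds on a whole neighbourhood, which yields the
    statement for all zeros [y] near [x] at once. *)
Lemma tangent_curve n q (P : 'rV[R]_n -> 'rV[R]_q) x (Ji : 'M[R]_(q, n)) :
  Cp 1 P -> Ji *m 'J P x = 1%:M -> P x = 0 ->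
  \forall y \near x, P y = 0 -> forall u, u *m 'J P y = 0 ->
    forall e : R, 0 < e -> \forall t \near (0 : R)^'+,
      exists2 y1, P y1 = 0 & `|y1 - (y + t *: u)| <= e * t.
Proof.
move=> cP JiJ Px; have [dP _] := cP.
have contP : continuous P by move=> y; exact: differentiable_continuous.
have [C C0 MR] := metric_regularity contP (Cp1_sdiff x cP) JiJ Px.
have MR' := nbhs_interior MR.
near=> y; have : \forall z \near y, exists2 y1, P y1 = 0 & `|y1 - z| <= C * `|P z|.
  by near: y; exact: MR'.
move=> /nbhs_ballP[d /= d0 dC] Py u uJ e e0.
pose c := C * (`|u| + 1).
have c0 : 0 < c by rewrite mulr_gt0// ltr_wpDl.
have [d1 /= d10 d1P] := (nbhs_ballP _ _).1 (near_diag_left (Cp1_sdiff y cP (divr_gt0 e0 c0))).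
near=> t.
have t0 : 0 < t by [].
have tud : t * `|u| < d by near: t; exact: near_right_scale.
have tud1 : t * `|u| < d1 by near: t; exact: near_right_scale.
have tu : `|t *: u| = t * `|u| by rewrite normrZ gtr0_norm.
have /dC[y1 Py1 y1d] : ball y d (y + t *: u).
  by rewrite -ball_normE/= opprD addrA subrr add0r normrN tu.
exists y1 => //; apply: le_trans y1d _.
have /d1P/= : ball y d1 (y + t *: u).
  by rewrite -ball_normE/= opprD addrA subrr add0r normrN tu.
have -> : y + t *: u - y = t *: u by rewrite addrAC subrr add0r.
rewrite Py subr0 -scalemxAl uJ scaler0 subr0 tu => h.
apply: le_trans (ler_wpM2l (ltW C0) h) _.
have -> : C * (e / c * (t * `|u|)) = (e * t) * ((C * `|u|) / c) by ring.
rewrite ger_pMr ?mulr_gt0// ler_pdivrMr// mul1r ler_pM2l// lerDl//.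
Unshelve. all: by end_near. Qed.

(** Testing the inequality along the curve tangent to [u] gives [<v - D y, u> <= 0]; with [- u] this
    becomes an equality. So [v - D y] is orthogonal to the kernel of the Jacobian, that is, a
    combination of the gradients of the equations. *)
Lemma normal_multiplier n q (P : 'rV[R]_n -> 'rV[R]_q) x (Ji : 'M[R]_(q, n))
    (g : 'rV[R]_n -> R) D :
  Cp 1 P -> Ji *m 'J P x = 1%:M -> P x = 0 ->
  has_grad g D -> continuous D ->
  \forall y \near x, P y = 0 -> forall (v : 'rV[R]_n) (c : R), 0 <= c ->
    (\forall z \near y, P z = 0 ->
       g y + dotp v (z - y) - c * `|z - y| ^+ 2 <= g z) ->
    exists l, v - D y = l *m ('J P y)^T.
Proof.
move=> cP JiJ Px gD cD; near=> y => Py v c c0 vg.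
have TC : forall u, u *m 'J P y = 0 ->
    forall e : R, 0 < e -> \forall t \near (0 : R)^'+,
      exists2 y1, P y1 = 0 & `|y1 - (y + t *: u)| <= e * t.
  by move: (Py); near: y; exact: tangent_curve cP JiJ Px.
apply: orthogonal_kernel.
have H u : u *m 'J P y = 0 -> dotp (v - D y) u <= 0.
  move=> uJ; set b := v - D y.
  pose K := n%:R * `|b| + (`|u| + 1) + c * (`|u| + 1) ^+ 2.
  have u1 : 0 <= `|u| + 1 by rewrite addr_ge0.
  have K0 : 0 <= K by rewrite !addr_ge0// ?mulr_ge0// ?exprn_ge0.
  apply: (le0_of_small K0) => e e0 e1.
  have := sdiff_scalar gD (cD y) e0 => /near_diag_left gy.
  have [d /= d0 dP] := (nbhs_ballP _ _).1 (filterI vg gy).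
  near (0 : R)^'+ => t.
  have t0 : 0 < t by [].
  have te : t < e by near: t; exact: nbhs_right_lt.
  have td : t * (`|u| + 1) < d by near: t; exact: near_right_scale.
  have [z Pz zt] : exists2 y1, P y1 = 0 & `|y1 - (y + t *: u)| <= e * t.
    by near: t; exact: TC.
  set rr := z - (y + t *: u) in zt.
  have zE : z - y = t *: u + rr by rewrite /rr opprD !addrA addrAC [t *: u + z]addrC addrK.
  have rt : `|rr| <= t by apply: le_trans zt _; rewrite ger_pMl.
  have zy : `|z - y| <= t * (`|u| + 1).
    rewrite zE (le_trans (ler_normD _ _))// normrZ gtr0_norm//; lra.
  have /dP[/= /(_ Pz) h1 h2] : ball y d z.
    by rewrite -ball_normE/= distrC (le_lt_trans zy).
  have h3 : dotp b (z - y) <= e * `|z - y| + c * `|z - y| ^+ 2.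
    rewrite dotpBl; move: h2; rewrite ler_norml => /andP[_ h2]; lra.
  have h4 : t * dotp b u <= dotp b (z - y) + n%:R * `|b| * (e * t).
    rewrite zE dotpDr dotpZr -addrA lerDl.
    have := le_trans (dotp_le b rr) (ler_wpM2l (mulr_ge0 (ler0n R n) (normr_ge0 b)) zt).
    by rewrite ler_norml => /andP[h _]; lra.
  have h5 : e * `|z - y| <= t * (e * (`|u| + 1)).
    by rewrite mulrCA ler_wpM2l// ltW.
  have h6 : c * `|z - y| ^+ 2 <= t * (e * (c * (`|u| + 1) ^+ 2)).
    have : `|z - y| ^+ 2 <= t * (e * (`|u| + 1) ^+ 2).
      apply: (@le_trans _ _ ((t * (`|u| + 1)) ^+ 2)).
        by rewrite ler_pXn2r// nnegrE ?mulr_ge0// ltW.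
      have -> : (t * (`|u| + 1)) ^+ 2 = t * (t * (`|u| + 1) ^+ 2) by ring.
      rewrite ler_pM2l//; apply: ler_wpM2r; first exact: exprn_ge0.
      exact: ltW.
    move=> h; apply: le_trans (ler_wpM2l c0 h) _.
    by rewrite le_eqVlt; apply/orP; left; apply/eqP; ring.
  rewrite -(ler_pM2l t0); apply: le_trans h4 _.
  rewrite /K; lra.
move=> u uJ; apply/eqP; rewrite eq_le H//= -oppr_le0 -dotpNr H//.
by rewrite mulNmx uJ oppr0.
Unshelve. all: by end_near. Qed.

End TangentNormal.

(** * Global subgradients of weakly convex functions *)

Section Convex.
Variable R : realType.

(** A global inequality with an explicit quadratic error: unlike the local [o]-definition, it can be
    tested at any point and passes to limits. *)
Definition gsub (rho : R) n (phi : 'rV[R]_n -> \bar R) (x v : 'rV[R]_n) : Prop :=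
  phi x \is a fin_num /\ forall y,
    (phi x + (dotp v (y - x) - rho / 2 * dotp (y - x) (y - x))%:E <= phi y)%E.

Lemma dotp_conv n (x y : 'rV[R]_n) t :
  t * dotp y y + (1 - t) * dotp x x - dotp (t *: y + (1 - t) *: x) (t *: y + (1 - t) *: x)
  = t * (1 - t) * dotp (y - x) (y - x).
Proof.
rewrite !(dotpDl, dotpDr, dotpZl, dotpZr, dotpNl, dotpNr) (dotpC x y).
by ring.
Qed.

(** Convexity bounds [phi] from above at [z = x + t (y - x)], the local subgradient inequality from
    below. Dividing by [t] and letting [t] tend to 0 transports the inequality to [y]. *)
Lemma subdiff_gsub rho n (phi : 'rV[R]_n -> \bar R) x v : 0 <= rho ->
  avoids_ninfty phi -> weakly_convex rho phi -> subdiff phi x v -> gsub rho phi x v.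
Proof.
move=> rho0 nphi cphi [fx sx]; split=> // y.
have [a ax] : exists a, phi x = a%:E by exists (fine (phi x)); rewrite fineK.
rewrite ax; case Ey: (phi y) => [b||]; last 2 first.
- by rewrite leey.
- by have := nphi y; rewrite Ey.
rewrite -EFinD lee_fin; set d := y - x.
suff : forall e, 0 < e -> a + (dotp v d - rho / 2 * dotp d d) <= b + e * (enorm d + 1).
  move=> H; apply/ler_addgt0Pl => e e0.
  have ed : 0 < enorm d + 1 by rewrite ltr_wpDl// enorm_ge0.
  have := H (e / (enorm d + 1)) (divr_gt0 e0 ed).
  by rewrite divfK ?gt_eqF// addrC [e + b]addrC.
move=> e e0; have [r /= r0 rP] := (nbhs_ballP _ _).1 (sx e e0).
near (0 : R)^'+ => t.
have t0 : 0 < t by [].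
have t1 : t < 1 by near: t; exact: nbhs_right_lt.
have td : t * `|d| < r by near: t; exact: near_right_scale.
pose z := t *: y + (1 - t) *: x.
have zx : z - x = t *: d by rewrite /z /d; apply/rowP => i; rewrite !mxE; ring.
have /rP/= : ball x r z by rewrite -ball_normE/= distrC zx normrZ gtr0_norm.
rewrite ax zx dotpZr.
have -> : enorm (t *: d) = t * enorm d.
  rewrite /enorm dotpZl dotpZr mulrA -expr2 sqrtrM ?sqr_ge0//.
  by rewrite sqrtr_sqr gtr0_norm.
have := cphi y x t; rewrite t0 t1 => /(_ isT) /=.
rewrite -/z Ey ax !enorm_sqr -!EFinD.
have : phi z != -oo%E by exact: nphi.
case: (phi z) => [c||] // _; rewrite -?EFinD ?lee_fin// => h1 h2.
have := dotp_conv x y t; rewrite -/z -/d => h3.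
have d0 : 0 <= dotp d d := dotp_ge0 d.
have h4 : t * (a + (dotp v d - rho / 2 * dotp d d)) <= t * (b + e * enorm d).
  have : 0 <= t * t * (rho / 2 * dotp d d) by rewrite !mulr_ge0// ltW.
  have h5 := congr1 (fun u => rho / 2 * u) h3.
  move: h1 h2 h5; clear; lra.
rewrite ler_pM2l// in h4; apply: le_trans h4 _.
by rewrite lerD2l ler_wpM2l ?(ltW e0)// lerDl.
Unshelve. all: by end_near. Qed.

Lemma gsub_subdiff c n (phi : 'rV[R]_n -> \bar R) x v : 0 <= c ->
  gsub c phi x v -> subdiff phi x v.
Proof.
move=> c0 [fx sx]; split=> // e e0.
have cn0 : 0 < c * n%:R + 1 by rewrite ltr_wpDl// mulr_ge0.
have := near_dist x (divr_gt0 e0 cn0); apply: filterS => y xy.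
apply: le_trans (sx y); rewrite leeD2l// lee_fin lerD2l lerN2.
rewrite -enorm_sqr expr2 mulrA ler_wpM2r ?enorm_ge0//.
rewrite distrC ltr_pdivlMr// in xy.
have h := enorm_le (y - x).
have h2 : c * enorm (y - x) <= c * (n%:R * `|y - x|) by exact: ler_wpM2l.
have h3 : 0 <= c * enorm (y - x) by rewrite mulr_ge0// enorm_ge0.
have := normr_ge0 (y - x); move: xy h2 h3; clear; lra.
Qed.

Lemma gsub_tilt c n (phi : 'rV[R]_n -> \bar R) x v u :
  gsub c phi x v -> gsub c (fun y => phi y - (dotp u y)%:E)%E x (v - u).
Proof.
move=> [fx sx]; split; first by rewrite fin_numB// fx.
move=> y; have := sx y.
have [a ->] : exists a, phi x = a%:E by exists (fine (phi x)); rewrite fineK.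
case: (phi y) => [b||]//=; rewrite -?EFinN -?EFinD ?lee_fin ?leey//.
by rewrite dotpBl !dotpBr => h; lra.
Qed.

Definition hsub n (h : 'rV[R]_n -> R) (x v : 'rV[R]_n) : Prop :=
  forall y, h x + dotp v (y - x) <= h y.

Lemma gsub_hsub n (h : 'rV[R]_n -> R) x v :
  gsub 0 (EFin \o h) x v <-> hsub h x v.
Proof.
split=> [[_ H] y|H]; last split => // y.
  by have := H y; rewrite /= mul0r mul0r subr0 -EFinD lee_fin.
by rewrite /= mul0r mul0r subr0 -EFinD lee_fin.
Qed.

Definition rconvex n (h : 'rV[R]_n -> R) : Prop :=
  forall x y t, 0 < t < 1 -> h (t *: x + (1 - t) *: y) <= t * h x + (1 - t) * h y.

Lemma convex_function_rconvex n (h : 'rV[R]_n -> R) :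
  convex_function setT h -> rconvex h.
Proof.
move=> ch x y t /andP[t0 t1].
have := ch (Itv01 (ltW t0) (ltW t1)) x y; rewrite !inE => /(_ Logic.I Logic.I).
by [].
Qed.

Lemma rconvex01 n (h : 'rV[R]_n -> R) x y t : rconvex h -> 0 <= t <= 1 ->
  h (t *: x + (1 - t) *: y) <= t * h x + (1 - t) * h y.
Proof.
move=> ch /andP[]; rewrite le_eqVlt => /predU1P[<- _|t0].
  by rewrite !scale0r subr0 !scale1r !add0r mul0r mul1r add0r.
rewrite le_eqVlt => /predU1P[->|t1]; last by apply: ch; rewrite t0.
by rewrite subrr !scale0r !scale1r !addr0 mul0r mul1r addr0.
Qed.

Lemma rconvex_weakly_convex n (h : 'rV[R]_n -> R) : rconvex h ->
  weakly_convex 0 (EFin \o h).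
Proof.
move=> ch x y t t01; rewrite /= !mul0r !adde0 -!EFinM -EFinD lee_fin; exact: ch.
Qed.

(** Induction on the number [k] of free coordinates. A point whose last free coordinate is [c] is
    the average, with weight [(1 + c) / 2], of the two points where that coordinate is 1 and -1;
    these are handled by the induction hypothesis at the shifted centers. *)
Lemma rconvex_bounded n (h : 'rV[R]_n -> R) z0 : rconvex h ->
  exists M, forall z, `|z| <= 1 -> h (z0 + z) <= M.
Proof.
move=> ch.
suff H k : forall z0, exists M, forall z : 'rV[R]_n, (forall i, `|z ord0 i| <= 1) ->
    (forall i : 'I_n, (k <= i)%N -> z ord0 i = 0) -> h (z0 + z) <= M.
  have [M HM] := H n z0; exists M => z z1; apply: HM.
    by move=> i; exact: le_trans (coord_le_norm _ _ _) z1.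
  by move=> i; rewrite leqNgt ltn_ord.
elim: k {z0} => [|k IH] z0.
  exists (h z0) => z _ zz; have -> : z = 0 by apply/rowP => i; rewrite zz// mxE.
  by rewrite addr0.
have [nk|kn] := leqP n k.
  have [M HM] := IH z0; exists M => z z1 zk; apply: HM => // i ki.
  by have := leq_trans (ltn_ord i) nk; rewrite ltnNge ki.
pose i0 := Ordinal kn; pose e : 'rV[R]_n := delta_mx ord0 i0.
have [M1 HM1] := IH (z0 + e); have [M2 HM2] := IH (z0 - e).
exists (Num.max M1 M2) => z z1 zk.
pose c := z ord0 i0; pose z' := z - c *: e; pose t := (1 + c) / 2.
have := z1 i0; rewrite ler_norml -/c => /andP[c1 c2].
have t01 : 0 <= t <= 1 by rewrite /t; apply/andP; split; lra.
have -> : z0 + z = t *: (z0 + e + z') + (1 - t) *: (z0 - e + z').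
  by rewrite /z' /t; apply/rowP => i; rewrite !mxE; field.
apply: le_trans (rconvex01 _ _ ch t01) _.
have z'i i : i != i0 -> z' ord0 i = z ord0 i.
  by move=> ii0; rewrite !mxE eqxx/= (negPf ii0) mulr0 subr0.
have z'0 : z' ord0 i0 = 0 by rewrite !mxE !eqxx/= mulr1 subrr.
have z'1 i : `|z' ord0 i| <= 1.
  by have [->|/z'i ->//] := eqVneq i i0; rewrite z'0 normr0.
have z'k (i : 'I_n) : (k <= i)%N -> z' ord0 i = 0.
  have [->//|ii0 ki] := eqVneq i i0; rewrite z'i// zk// ltn_neqAle ki andbT.
  by apply: contra ii0 => /eqP ki0; apply/eqP/val_inj.
have h1 := HM1 z' z'1 z'k; have h2 := HM2 z' z'1 z'k.
have m1 : M1 <= Num.max M1 M2 by rewrite le_max lexx.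
have m2 : M2 <= Num.max M1 M2 by rewrite le_max lexx orbT.
case/andP: t01 => t0 t1.
have a1 := ler_wpM2l t0 (le_trans h1 m1).
have a2 : (1 - t) * h (z0 - e + z') <= (1 - t) * Num.max M1 M2.
  by rewrite ler_wpM2l ?subr_ge0//; exact: le_trans m2.
move: a1 a2; clear; lra.
Qed.

(** With [u] the unit vector from [z0] towards [y], convexity on the segment from [z0] to [z0 + u]
    bounds [h y] from above, and convexity on the segment from [z0 - u] to [y] bounds it from
    below. *)
Lemma rconvex_local_lip n (h : 'rV[R]_n -> R) z0 : rconvex h ->
  exists2 M, 0 <= M & forall y, `|y - z0| <= 1 -> `|h y - h z0| <= `|y - z0| * M.
Proof.
move=> ch; have [M HM] := rconvex_bounded z0 ch.
have M0 : h z0 <= M by have := HM 0; rewrite normr0 addr0; apply.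
exists (M - h z0); first by rewrite subr_ge0.
move=> y y1; set t := `|y - z0|; have t0 : 0 <= t := normr_ge0 _.
have [e|yz] := eqVneq y z0; first by rewrite e subrr normr0 mulr_ge0 ?subr_ge0.
have tp : 0 < t by rewrite normr_gt0 subr_eq0.
pose u := t^-1 *: (y - z0).
have u1 : `|u| <= 1 by rewrite normrZ ger0_norm ?invr_ge0// mulVf// gt_eqF.
have ytu : y = z0 + t *: u.
  by rewrite scalerA mulfV ?gt_eqF// scale1r addrC subrK.
have h1 := HM u u1; have h2 := HM (- u); rewrite normrN in h2; have {}h2 := h2 u1.
have h3 : h y <= t * h (z0 + u) + (1 - t) * h z0.
  have -> : y = t *: (z0 + u) + (1 - t) *: z0.
    by rewrite ytu; apply/rowP => i; rewrite !mxE; ring.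
  by apply: rconvex01 => //; rewrite t0.
have t1p : 0 < 1 + t by rewrite ltr_pwDl.
have h4 : h z0 <= (1 + t)^-1 * h y + (1 - (1 + t)^-1) * h (z0 - u).
  have {1}-> : z0 = (1 + t)^-1 *: y + (1 - (1 + t)^-1) *: (z0 - u).
    rewrite ytu; apply/rowP => i; rewrite !mxE; field.
    by rewrite !gt_eqF.
  apply: rconvex01 => //; rewrite invr_ge0 ltW//= invf_le1//; lra.
have h5 : (1 + t) * h z0 <= h y + t * h (z0 - u).
  have := ler_wpM2l (ltW t1p) h4.
  have -> : (1 + t) * ((1 + t)^-1 * h y + (1 - (1 + t)^-1) * h (z0 - u)) =
     h y + t * h (z0 - u) by field; rewrite gt_eqF.
  by [].
have h6 := ler_wpM2l t0 h1; have h7 := ler_wpM2l t0 h2.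
rewrite ler_norml; apply/andP; move: h3 h5 h6 h7; clear; split; lra.
Qed.

Lemma rconvex_continuous n (h : 'rV[R]_n -> R) : rconvex h -> continuous h.
Proof.
move=> ch z0; apply: (cvg_of_near (F := nbhs z0)) => e e0.
have [M M0 HM] := rconvex_local_lip z0 ch.
have M1 : 0 < M + 1 by rewrite ltr_wpDl.
have d0 : 0 < Num.min 1 (e / (M + 1)) by rewrite lt_min ltr01 divr_gt0.
have := near_dist z0 d0; apply: filterS => y; rewrite lt_min distrC => /andP[y1 y2].
rewrite distrC; apply: le_trans (HM y (ltW y1)) _.
rewrite ltr_pdivlMr// in y2; apply: le_trans (ltW y2).
by rewrite ler_wpM2l// lerDl.
Qed.

(** The subgradient inequality is tested at [z] moved by 1/2 in either direction along an axis;
    these points stay within distance 1 of [z0], where [h] is under control. *)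
Lemma hsub_bounded n (h : 'rV[R]_n -> R) z0 : rconvex h ->
  exists M, forall z w, `|z - z0| <= 2^-1 -> hsub h z w -> `|w| <= M.
Proof.
move=> ch; have [M M0 HM] := rconvex_local_lip z0 ch.
exists (4 * M) => z w zz0 hw.
apply: norm_le_coord => [|i j]; first by rewrite mulr_ge0.
rewrite (ord1 i).
have H (s : R) : `|s| <= 2^-1 -> s * w ord0 j <= 3 / 2 * M.
  move=> s2; pose y := z + s *: delta_mx ord0 j.
  have := hw y.
  have -> : y - z = s *: delta_mx ord0 j by rewrite /y addrAC subrr add0r.
  rewrite dotpZr dotpC dotp_delta => h1.
  have yz : `|y - z0| <= 1.
    have -> : y - z0 = (z - z0) + s *: delta_mx ord0 j by rewrite /y addrAC.
    apply: le_trans (ler_normD _ _) _; rewrite normrZ.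
    have : `|delta_mx ord0 j : 'rV[R]_n| <= 1.
      apply: norm_le_coord => // a b; rewrite mxE.
      by case: (_ && _); rewrite ?normr1 ?normr0.
    move=> d1; have := ler_pM (normr_ge0 s) (normr_ge0 _) s2 d1.
    rewrite mulr1; lra.
  have := HM y yz; have := HM z (le_trans zz0 (ltac:(lra) : 2^-1 <= 1)).
  rewrite !ler_norml => /andP[h2 h3] /andP[h4 h5].
  have h6 := ler_wpM2r M0 yz; have h7 := ler_wpM2r M0 zz0.
  move: h1 h2 h3 h4 h5 h6 h7; clear; lra.
have h0 : `|2^-1 : R| <= 2^-1 by rewrite ger0_norm.
have h1 := H _ h0.
have := H (- (2^-1)); rewrite normrN => /(_ h0) h2.
rewrite ler_norml; apply/andP; move: h1 h2 M0; clear; split; lra.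
Qed.

Definition lsc (T : topologicalType) (f : T -> \bar R) : Prop :=
  forall x (a : R), (a%:E < f x)%E -> \forall y \near x, (a%:E < f y)%E.

Lemma closed_fun_lsc n (phi : 'rV[R]_n -> \bar R) : closed_fun phi -> lsc phi.
Proof.
move=> cphi x a ax.
have : open (~` [set z : 'rV[R]_n * R | (phi z.1 <= (z.2)%:E)%E]) by exact: closed_openC.
rewrite openE => /(_ (x, a)) H.
have [|[A B] /= [xA aB] AB] := H; first by rewrite /= leNgt ax.
apply: filterS xA => y Ay; rewrite ltNge; apply/negP.
by apply: (AB (y, a)); split => //=; exact: nbhs_singleton.
Qed.

Lemma lsc_EFin n (g : 'rV[R]_n -> R) : continuous g -> lsc (EFin \o g).
Proof.
move=> cg x a; rewrite /= lte_fin -subr_gt0 => ag.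
have a2 : 0 < (g x - a) / 2 by rewrite divr_gt0.
have := near_continuous (cg x : {for x, continuous (g : _ -> R^o)}) a2.
apply: filterS => y; rewrite /= lte_fin ler_norml => /andP[_]; lra.
Qed.

Lemma lsc_addr (T : topologicalType) (f : T -> \bar R) (g : T -> R) :
  lsc f -> continuous g -> lsc (fun x => (g x)%:E + f x)%E.
Proof.
move=> lf cg x a ax.
have [b gb bf] : exists2 b, a - g x < b & (b%:E < f x)%E.
  move: ax; case: (f x) => [r||]//=.
    rewrite -EFinD lte_fin => ar; exists ((a - g x + r) / 2); rewrite ?lte_fin; lra.
  by move=> _; exists (a - g x + 1); rewrite ?ltry// ltrDl.
have e0 : 0 < (b - (a - g x)) / 2 by rewrite divr_gt0// subr_gt0.
move: (lf x b bf).
have : \forall y \near x, `|g x - g y| <= (b - (a - g x)) / 2.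
  by apply: (cvgr_dist_le (F := nbhs x) g (g x)); [exact: cg|].
apply: filterS2 => y h1 h2.
have h3 : a - g y < b by move: h1; rewrite ler_norml => /andP[h1 h3]; lra.
move: h2; case: (f y) => [r||]//=.
  by rewrite -EFinD !lte_fin => h2; move: h3 h2; clear; lra.
by rewrite addey// !ltry.
Qed.

Lemma ereal_between (x y : \bar R) : (x < y)%E ->
  exists a : R, (x <= a%:E)%E /\ (a%:E < y)%E.
Proof.
case: x => [x||]; case: y => [y||]//=.
- by rewrite lte_fin => xy; exists x.
- by exists x; rewrite ltry.
- by exists (y - 1); rewrite leNye lte_fin ltrBlDr ltrDl.
- by exists 0; rewrite leNye ltry.
Qed.

(** The sets [f < b], for [b] above the infimum, generate a proper filter on [K]; at a cluster
    point, lower semicontinuity excludes a value above the infimum. The infimum [+oo] is treated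
    apart because there would be no such [b]. *)
Lemma lsc_min (T : topologicalType) (f : T -> \bar R) (K : set T) :
  K !=set0 -> compact K -> lsc f ->
  exists2 c, K c & forall t, K t -> (f c <= f t)%E.
Proof.
move=> [x0 Kx0] cK lf; set m := ereal_inf (f @` K).
have mle t : K t -> (m <= f t)%E by move=> Kt; apply: ereal_inf_lbound; exists t.
have [my|my] := eqVneq m +oo%E.
  exists x0 => // t Kt; have := mle t Kt; rewrite my leye_eq => /eqP ->.
  exact: leey.
pose B (b : \bar R) := K `&` [set t | (f t < b)%E].
pose F := filter_from [set b : \bar R | (m < b)%E] B.
have my' : (m < +oo)%E by rewrite ltey.
have FF : Filter F.
  apply: filter_from_filter; first by exists +oo%E.
  move=> i j /= mi mj; exists (Order.min i j); first by rewrite /= lt_min mi.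
  by move=> t [Kt]; rewrite /= lt_min => /andP[].
have PF : ProperFilter F.
  apply: filter_from_proper => b /= mb.
  by have [_ [t Kt <-] tb] := ereal_inf_lt mb; exists t.
have FK : F K by exists +oo%E => // t [].
have [c [Kc clc]] := cK F PF FK.
exists c => // t Kt; apply: le_trans (mle t Kt).
rewrite leNgt; apply/negP => mc.
have [b [mb bc]] : exists b : R, (m < b%:E)%E /\ (b%:E < f c)%E.
  have [a [ma ac]] := ereal_between mc.
  move: ac; case: (f c) => [r||]//=.
    rewrite lte_fin => ar; exists ((a + r) / 2); rewrite lte_fin; split; last lra.
    by apply: le_lt_trans ma _; rewrite lte_fin; lra.
  move=> _; exists (a + 1); rewrite ltry; split => //.
  by apply: le_lt_trans ma _; rewrite lte_fin ltrDl.
have [t' [[_ /= h1] h2]] := clc (B b%:E) _ (ltac:(by exists b%:E)) (lf c b bc).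
by have := lt_trans h1 h2; rewrite ltxx.
Qed.

Lemma cvg_near T (F : set_system T) {FF : Filter F} (V : normedModType R)
    (f : T -> V) (y : V) (e : R) :
  f @ F --> y -> 0 < e -> \forall t \near F, `|y - f t| <= e.
Proof. by move=> fy e0; exact: cvgr_dist_le fy _ e0. Qed.

Lemma cvg_dotp T (F : set_system T) {FF : Filter F} n (f g : T -> 'rV[R]_n) u w :
  f @ F --> u -> g @ F --> w -> (fun t => dotp (f t) (g t)) @ F --> dotp u w.
Proof.
move=> fu gw; apply: cvg_of_near => e e0.
pose c := n%:R * (`|u| + `|w| + 1) + 1.
have s0 : 0 <= `|u| + `|w| + 1 by rewrite !addr_ge0.
have c0 : 0 < c by rewrite ltr_wpDl// mulr_ge0.
have ec : 0 < Num.min 1 (e / (2 * c)) by rewrite lt_min ltr01 divr_gt0// mulr_gt0.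
have fn : \forall t \near F, `|u - f t| <= Num.min 1 (e / (2 * c)) by exact: cvg_near.
have gn : \forall t \near F, `|w - g t| <= Num.min 1 (e / (2 * c)) by exact: cvg_near.
move: fn gn.
apply: filterS2 => t f1 g0.
have f2 : `|u - f t| <= e / (2 * c) by apply: le_trans f1 _; rewrite ge_min lexx orbT.
have g2 : `|w - g t| <= e / (2 * c) by apply: le_trans g0 _; rewrite ge_min lexx orbT.
have g1 : `|w - g t| <= 1 by apply: le_trans g0 _; rewrite ge_min lexx.
have -> : dotp u w - dotp (f t) (g t) = dotp (u - f t) (g t) + dotp u (w - g t).
  by rewrite dotpBl dotpBr; ring.
have gt1 : `|g t| <= `|w| + 1.
  by rewrite -[g t](subrK w) addrC (le_trans (ler_normD _ _))// lerD2l distrC.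
apply: le_trans (ler_normD _ _) _.
have h1 := dotp_le (u - f t) (g t); have h2 := dotp_le u (w - g t).
have h3 : n%:R * `|u - f t| * `|g t| <= n%:R * (e / (2 * c)) * (`|w| + 1).
  by apply: ler_pM => //; rewrite ?mulr_ge0// ler_wpM2l.
have h4 : n%:R * `|u| * `|w - g t| <= n%:R * `|u| * (e / (2 * c)).
  by apply: ler_wpM2l => //; exact: mulr_ge0.
have h5 : n%:R * (e / (2 * c)) * (`|w| + 1) + n%:R * `|u| * (e / (2 * c)) <= e.
  have -> : n%:R * (e / (2 * c)) * (`|w| + 1) + n%:R * `|u| * (e / (2 * c)) =
     e * ((n%:R * (`|u| + `|w| + 1)) / (2 * c)) by ring.
  rewrite ger_pMr// ler_pdivrMr ?mulr_gt0// mul1r /c.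
  have : 0 <= n%:R * (`|u| + `|w| + 1) by rewrite mulr_ge0.
  lra.
move: h1 h2 h3 h4 h5; clear; lra.
Qed.

(** Lower semicontinuity bounds the moving value [phi (y t)] from below, while the other terms
    converge. The point [x1] serves to show that [phi y0] is finite: the limiting inequality tested
    there bounds it. *)
Lemma gsub_closed T (F : set_system T) {FF : ProperFilter F} rho n
    (phi : 'rV[R]_n -> \bar R) (y v : T -> 'rV[R]_n) y0 v0 x1 :
  avoids_ninfty phi -> lsc phi -> phi x1 \is a fin_num ->
  y @ F --> y0 -> v @ F --> v0 -> (\forall t \near F, gsub rho phi (y t) (v t)) ->
  gsub rho phi y0 v0.
Proof.
move=> nphi lphi fx1 yF vF H.
have main z b : phi z = b%:E ->
   (phi y0 <= (b - (dotp v0 (z - y0) - rho / 2 * dotp (z - y0) (z - y0)))%:E)%E.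
  move=> zb; rewrite leNgt; apply/negP; set L := b - _ => Ly.
  have [a [La ay]] : exists a : R, L < a /\ (a%:E < phi y0)%E.
    move: Ly; case: (phi y0) => [r||]//=.
      rewrite lte_fin => ar; exists ((L + r) / 2); rewrite lte_fin; lra.
    by move=> _; exists (L + 1); rewrite ltry ltrDl.
  have zyF : (fun t => z - y t) @ F --> z - y0 by apply: cvgB => //; exact: cvg_cst.
  have LF : (fun t => b - (dotp (v t) (z - y t) - rho / 2 * dotp (z - y t) (z - y t)))
      @ F --> L.
    apply: cvgB; first exact: cvg_cst.
    apply: cvgB; first exact: cvg_dotp.
    by apply: cvgMl_tmp; exact: cvg_dotp.
  have aL : 0 < a - L by rewrite subr_gt0.
  have aL2 : 0 < (a - L) / 2 by rewrite divr_gt0.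
  have [t [h1 [h2 h3]]] : exists t, gsub rho phi (y t) (v t) /\
     (a%:E < phi (y t))%E /\
     `|L - (b - (dotp (v t) (z - y t) - rho / 2 * dotp (z - y t) (z - y t)))| <= (a - L) / 2.
    apply: (@filter_ex _ F).
    have Ln : \forall t \near F, `|L - (b - (dotp (v t) (z - y t) -
        rho / 2 * dotp (z - y t) (z - y t)))| <= (a - L) / 2 by exact: cvg_near.
    have yn : \forall t \near F, (a%:E < phi (y t))%E by exact: (yF _ (lphi _ _ ay)).
    move: H yn Ln; apply: filterS3 => t h1 h2 h3.
    by split.
  have [_ /(_ z)] := h1; rewrite zb.
  move: h2; case: (phi (y t)) => [r||]//=.
  rewrite lte_fin -EFinD lee_fin => h2 h4; move: h3; rewrite ler_norml => /andP[h3 h5].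
  move: aL h2 h4 h3 h5; clear; lra.
have fy0 : phi y0 \is a fin_num.
  rewrite fin_numE nphi/=; apply/eqP => y0y.
  by have := main x1 (fine (phi x1)); rewrite fineK// y0y => /(_ erefl).
split=> // z; case Ez: (phi z) => [b||]; last 2 first.
- by rewrite leey.
- by have := nphi z; rewrite Ez.
have := main z b Ez; have -> : phi y0 = (fine (phi y0))%:E by rewrite fineK.
by rewrite -EFinD !lee_fin; lra.
Qed.

End Convex.

(** * The penalized prox-linear subproblem *)

Section KKT.
Variable R : realType.

(** Compactness without subsequences: a cluster point of an ultrafilter is a limit. *)
Lemma ultra_cvg T (U : set_system T) {UU : UltraFilter U} n (f : T -> 'rV[R]_n) (M : R) :
  (\forall t \near U, `|f t| <= M) -> exists l : 'rV[R]_n, f @ U --> l.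
Proof.
move=> H.
have M1 : 0 < `|M| + 1 by rewrite ltr_wpDl.
have cK : compact [set y : 'rV[R]_n | `|0 - y| <= `|M| + 1] by exact: compact_cball.
have [|l [_ cl]] := cK (fmap f U) _.
  apply: filterS H => t ft.
  by rewrite /= sub0r normrN (le_trans ft)// (le_trans (ler_norm _))// lerDl.
exists l => A lA; have [//|UA] := in_ultra_setVsetC (f @^-1` A) UU.
have [|t [tA At]] := cl (~` A) A _ lA; first exact: UA.
by have := tA At.
Qed.

Lemma dotp_sqrD n (u v : 'rV[R]_n) :
  dotp (u + v) (u + v) = dotp u u + 2 * dotp v u + dotp v v.
Proof. by rewrite dotpDl !dotpDr (dotpC u v); ring. Qed.

Lemma dotp_sqrB n (u v : 'rV[R]_n) :
  dotp (u - v) (u - v) = dotp u u - 2 * dotp u v + dotp v v.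
Proof. by rewrite dotpBl !dotpBr (dotpC v u); ring. Qed.

Lemma near_quad_subdiff c n (phi : 'rV[R]_n -> \bar R) x v :
  phi x \is a fin_num ->
  (\forall y \near x, (phi x + (dotp v (y - x) - c * dotp (y - x) (y - x))%:E <= phi y)%E) ->
  subdiff phi x v.
Proof.
move=> fx H; split => // e e0.
have cn0 : 0 < `|c| * n%:R + 1 by rewrite ltr_wpDl// mulr_ge0.
move: H (near_dist x (divr_gt0 e0 cn0)); apply: filterS2 => y H xy.
apply: le_trans H; rewrite leeD2l// lee_fin lerD2l lerN2.
rewrite -enorm_sqr expr2 mulrA ler_wpM2r ?enorm_ge0//.
rewrite distrC ltr_pdivlMr// in xy.
have h := enorm_le (y - x).
have h2 : `|c| * enorm (y - x) <= `|c| * (n%:R * `|y - x|) by exact: ler_wpM2l.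
have h3 : c * enorm (y - x) <= `|c| * enorm (y - x).
  by rewrite ler_wpM2r ?enorm_ge0// ler_norm.
have := normr_ge0 (y - x); move: xy h2 h3; clear; lra.
Qed.

(* The penalized model splits the composition h(a + y B) into separate
   variables, so that the optimality conditions in y and in z are elementary. *)
Definition pen d m (h : 'rV[R]_m -> R) (r : 'rV[R]_d -> \bar R) (mu k : R)
    (a : 'rV[R]_m) (B : 'M[R]_(d, m)) (x : 'rV[R]_d) (p : 'rV[R]_d * 'rV[R]_m) : \bar R :=
  ((h p.2 + ((2 * mu)^-1 * dotp (p.1 - x) (p.1 - x)
    + k / 2 * dotp (p.2 - (a + p.1 *m B)) (p.2 - (a + p.1 *m B))))%:E + r p.1)%E.

(** Each variable is varied with the other frozen. The multiplier [w] is the force exerted by the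
    penalty; the second-order parts of the squares are absorbed in the quadratic error allowed for a
    subgradient. *)
Lemma pen_stationary d m (h : 'rV[R]_m -> R) (r : 'rV[R]_d -> \bar R) (rho mu k : R)
    (a : 'rV[R]_m) (B : 'M[R]_(d, m)) (x : 'rV[R]_d) y z :
  rconvex h -> 0 <= rho -> avoids_ninfty r -> weakly_convex rho r -> r y \is a fin_num ->
  (\forall p \near (y, z), (pen h r mu k a B x (y, z) <= pen h r mu k a B x p)%E) ->
  let w := k *: (a + y *m B - z) in
  hsub h z w /\ gsub rho r y (- (w *m B^T) - mu^-1 *: (y - x)).
Proof.
move=> ch rho0 nr cr fy H w.
have [b yb] : exists b, r y = b%:E by exists (fine (r y)); rewrite fineK.
have nB : 0 <= d%:R * m%:R * `|B| ^+ 2 by rewrite !mulr_ge0// exprn_ge0.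
split.
- apply/gsub_hsub; apply: subdiff_gsub => //; first exact: rconvex_weakly_convex.
  apply: (@near_quad_subdiff (k / 2)) => //.
  have [[A1 A2] /= [yA zA] A12] := H.
  apply: filterS zA => z' Az'.
  have /A12/= : (A1 `*` A2) (y, z') by split => //=; exact: nbhs_singleton.
  rewrite /pen/= yb -!EFinD !lee_fin => {}H.
  set c := a + y *m B in H w *.
  have E : z' - c = (z' - z) + (z - c) by rewrite addrA subrK.
  rewrite E in H; rewrite /w dotpZl.
  have -> : dotp (c - z) (z' - z) = - dotp (z - c) (z' - z) by rewrite -dotpNl opprB.
  rewrite (dotp_sqrD (z' - z)) in H.
  by move: H; clear; lra.
- apply: subdiff_gsub => //.
  apply: (@near_quad_subdiff ((2 * mu)^-1 + `|k| / 2 * (m%:R * (d%:R * `|B|) ^+ 2))) => //.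
  have [[A1 A2] /= [yA zA] A12] := H.
  apply: filterS yA => y' Ay'.
  have /A12/= : (A1 `*` A2) (y', z) by split => //=; exact: nbhs_singleton.
  have := nr y'; rewrite /pen/= yb; case: (r y') => [b'||] // _; rewrite -!EFinD ?lee_fin ?leey//.
  set c := a + y *m B in H w *; pose D := y' - y.
  have -> : z - (a + y' *m B) = (z - c) - D *m B.
    by rewrite /D /c mulmxBl; apply/rowP => i; rewrite !mxE; ring.
  have -> : y' - x = D + (y - x) by rewrite /D addrA subrK.
  have E1 : dotp (- (w *m B^T) - mu^-1 *: (y - x)) D =
      k * dotp (z - c) (D *m B) - mu^-1 * dotp (y - x) D.
    have -> : dotp (z - c) (D *m B) = - dotp (c - z) (D *m B).
      by rewrite -dotpNl opprB.
    rewrite (dotpBl (- (w *m B^T)) (mu^-1 *: (y - x)) D) (dotpNl (w *m B^T) D).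
    by rewrite dotp_mulmx trmxK /w !dotpZl; ring.
  have h1 : dotp (D *m B) (D *m B) <= m%:R * (d%:R * `|B|) ^+ 2 * dotp D D.
    apply: le_trans (dotp_le_sqr_norm _) _; rewrite -mulrA ler_wpM2l//.
    apply: (@le_trans _ _ ((d%:R * `|B|) ^+ 2 * `|D| ^+ 2)).
      rewrite -exprMn ler_pXn2r ?nnegrE ?mulr_ge0//.
      by rewrite mulrAC; exact: mulmx_norm_le.
    by rewrite ler_wpM2l ?exprn_ge0 ?mulr_ge0// sqr_norm_le_dotp.
  have h2 : k / 2 * dotp (D *m B) (D *m B) <=
      `|k| / 2 * (m%:R * (d%:R * `|B|) ^+ 2 * dotp D D).
    apply: (@le_trans _ _ (`|k| / 2 * dotp (D *m B) (D *m B))).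
      by rewrite ler_wpM2r ?dotp_ge0// ler_wpM2r// ler_norm.
    by rewrite ler_wpM2l// divr_ge0.
  have E2 : dotp (D + (y - x)) (D + (y - x)) =
      dotp D D + 2 * dotp (y - x) D + dotp (y - x) (y - x).
    exact: dotp_sqrD.
  have E3 : dotp (z - c - D *m B) (z - c - D *m B) =
      dotp (z - c) (z - c) - 2 * dotp (z - c) (D *m B) + dotp (D *m B) (D *m B).
    exact: dotp_sqrB.
  rewrite E1 E2 E3 !invfM; move: h2; clear => h2 H.
  move: (mu^-1) (dotp (D *m B) (D *m B)) (dotp (z - c) (D *m B)) (dotp (z - c) (z - c))
    (dotp D D) (dotp (y - x) D) (dotp (y - x) (y - x)) (m%:R * _) h2 H => *.
  lra.
Qed.

Lemma cvg_mulmxr T (F : set_system T) {FF : Filter F} m n p (f : T -> 'M[R]_(m, n)) (u : 'M[R]_(m, n))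
    (B : 'M[R]_(n, p)) : f @ F --> u -> (fun t => f t *m B) @ F --> u *m B.
Proof.
move=> fu; apply: cvg_of_near => e e0.
pose c := n%:R * `|B| + 1.
have c0 : 0 < c by rewrite ltr_wpDl// mulr_ge0.
have fn : \forall t \near F, `|u - f t| <= e / c by apply: cvg_near => //; exact: divr_gt0.
apply: filterS fn => t ft; rewrite -mulmxBl (le_trans (mulmx_norm_le _ _))//.
rewrite mulrAC (le_trans (ler_wpM2l _ ft)) ?mulr_ge0//.
by rewrite mulrCA ger_pMr// ler_pdivrMr// mul1r lerDl.
Qed.

Lemma pen_lsc d m (h : 'rV[R]_m -> R) (r : 'rV[R]_d -> \bar R) (mu k : R)
    (a : 'rV[R]_m) (B : 'M[R]_(d, m)) (x : 'rV[R]_d) :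
  continuous h -> lsc r -> lsc (pen h r mu k a B x).
Proof.
move=> ch lr.
have lr1 : lsc (fun p : 'rV[R]_d * 'rV[R]_m => r p.1).
  by move=> p c /lr; move=> H; case: p H => y z /= H; exact: near_fst H.
apply: lsc_addr lr1 _ => p.
have c1 : (fun q : 'rV[R]_d * 'rV[R]_m => q.1) @ p --> p.1 by exact: cvg_fst.
have c2 : (fun q : 'rV[R]_d * 'rV[R]_m => q.2) @ p --> p.2 by exact: cvg_snd.
apply: cvgD; first by apply: (cvg_comp _ _ c2); exact: ch.
have c1x : (fun q : 'rV[R]_d * 'rV[R]_m => q.1 - x) @ p --> p.1 - x.
  by apply: cvgB => //; exact: cvg_cst.
have c2x : (fun q : 'rV[R]_d * 'rV[R]_m => q.2 - (a + q.1 *m B)) @ p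
    --> p.2 - (a + p.1 *m B).
  apply: cvgB => //; apply: cvgD; first exact: cvg_cst.
  exact: cvg_mulmxr.
by apply: cvgD; apply: cvgMl_tmp; exact: cvg_dotp.
Qed.

(** Coercivity of the penalized model, by comparison with the point [(x0, a + x0 *m B)]. The
    subgradient inequalities of [h] at [z0] and of [r] at [x0] are added; their linear terms cancel
    by [w0 *m B0^T + v0 = 0], up to the discrepancy [B - B0]. *)
Lemma pen_lower d m (h : 'rV[R]_m -> R) (r : 'rV[R]_d -> \bar R) (rho mu k : R)
    (a : 'rV[R]_m) (B B0 : 'M[R]_(d, m)) (x x0 y : 'rV[R]_d) z z0 w0 v0 :
  avoids_ninfty r -> 0 < k ->
  hsub h z0 w0 -> gsub rho r x0 v0 -> w0 *m B0^T + v0 = 0 ->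
  (pen h r mu k a B x (y, z) <= pen h r mu k a B x (x0, a + x0 *m B)%R)%E ->
  r y \is a fin_num /\
  ((2 * mu)^-1 - rho / 2) * dotp (y - x0) (y - x0)
    + k / 4 * dotp (z - (a + y *m B)) (z - (a + y *m B)) <=
  h (a + x0 *m B) - h z0 + mu^-1 * dotp (y - x0) (x - x0)
    - dotp w0 (a + x0 *m B - z0) - dotp w0 ((y - x0) *m (B - B0)) + dotp w0 w0 / k.
Proof.
move=> nr k0 hw [fx0 rv] wv.
have [b rb] : exists b, r x0 = b%:E by exists (fine (r x0)); rewrite fineK.
have := rv y; have := nr y; rewrite /pen /= rb subrr dotp0l mulr0 addr0.
case: (r y) => [b'||] // _; rewrite -!EFinD !lee_fin => {}rv H; split => //.
have hz := hw z.
set c0 := a + x0 *m B in H *; set s := z - (a + y *m B) in H *; set D := y - x0 in rv *.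
have zE : z - z0 = s + (c0 - z0) + (D *m (B - B0) + D *m B0).
  rewrite -mulmxDr subrK /s /c0 /D mulmxBl.
  by apply/rowP => i; rewrite !mxE; ring.
have wB : dotp w0 (D *m B0) = - dotp v0 D.
  have -> : v0 = - (w0 *m B0^T) by apply/eqP; rewrite -addr_eq0 addrC wv.
  by rewrite dotpNl opprK dotp_mulmx trmxK.
rewrite zE (dotpDr (s + (c0 - z0)) (D *m (B - B0) + D *m B0) w0) in hz.
rewrite (dotpDr s (c0 - z0) w0) (dotpDr (D *m (B - B0)) (D *m B0) w0) wB in hz.
have yx : y - x = D - (x - x0) by rewrite /D opprB addrA subrK.
have xx : x0 - x = - (x - x0) by rewrite opprB.
rewrite yx xx dotp_sqrB dotpNl dotpNr opprK in H.
(* Completing the square absorbs the term in [<w0, s>]: half of the penalty survives, at the price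
   [|w0|^2 / k], which vanishes as [k] grows. *)
have sq : 0 <= k^-1 * dotp (w0 + (k / 2) *: s) (w0 + (k / 2) *: s).
  by rewrite mulr_ge0 ?dotp_ge0// invr_ge0 ltW.
rewrite dotp_sqrD !dotpZl !dotpZr (dotpC s w0) in sq.
have {}sq : 0 <= dotp w0 w0 / k + dotp w0 s + k / 4 * dotp s s.
  apply: le_trans sq _; rewrite le_eqVlt; apply/orP; left; apply/eqP.
  by field; rewrite gt_eqF.
rewrite invfM in H *; rewrite -/D.
move: hz rv H sq; clear.
move: (mu^-1) (dotp w0 w0 / k) (dotp D D) (dotp s s) (dotp D (x - x0)) (dotp (x - x0) (x - x0))
  (dotp w0 s) (dotp w0 (c0 - z0)) (dotp w0 (D *m _)) (dotp v0 D) (h z) (h z0) (h c0) => *.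
lra.
Qed.

End KKT.

(** * Existence of multipliers for the prox-linear step *)

Section KKTexists.
Variable R : realType.

Lemma near_in_cball (V : normedModType R) (x y : V) (d : R) : `|x - y| < d ->
  \forall z \near y, `|x - z| <= d.
Proof.
move=> xy; have d0 : 0 < d - `|x - y| by rewrite subr_gt0.
have := near_dist y d0; apply: filterS => z yz.
have -> : x - z = (x - y) + (y - z) by rewrite addrA subrK.
apply: le_trans (ler_normD _ _) _; lra.
Qed.

Section Fixed.
Variables (d m : nat) (h : 'rV[R]_m -> R) (r : 'rV[R]_d -> \bar R) (rho mu : R).
Variables (a : 'rV[R]_m) (B B0 : 'M[R]_(d, m)) (x x0 : 'rV[R]_d).
Variables (z0 w0 : 'rV[R]_m) (v0 : 'rV[R]_d) (del kap : R).
Hypothesis (ch : rconvex h) (rho0 : 0 <= rho) (nr : avoids_ninfty r) (lr : lsc r)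
  (cr : weakly_convex rho r) (hw : hsub h z0 w0) (rv : gsub rho r x0 v0)
  (wv : w0 *m B0^T + v0 = 0) (del0 : 0 < del) (kap0 : 0 < kap)
  (kapE : kap = (2 * mu)^-1 - rho / 2)
  (Hx1 : `|z0 - (a + x0 *m B)| <= 8^-1)
  (Hx2 : forall y, `|x0 - y| <= del -> `|(y - x0) *m B| <= 8^-1)
  (Hx3 : forall y, `|x0 - y| <= del ->
     h (a + x0 *m B) - h z0 + mu^-1 * dotp (y - x0) (x - x0)
       - dotp w0 (a + x0 *m B - z0) - dotp w0 ((y - x0) *m (B - B0))
     <= kap * del ^+ 2 / 4).

(** A minimizer over a product of closed balls turns out to be interior, hence stationary. The two
    error terms add up to at most half of [kap * del ^+ 2], which keeps [y] inside; [z] stays within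
    [1/4 + 1/8 + 1/8] of [z0]. *)
Lemma pen_solution (k : R) : 0 < k -> dotp w0 w0 / k <= kap * del ^+ 2 / 4 ->
  (kap * del ^+ 2 / 2) * 4 / k <= 4^-1 ^+ 2 ->
  exists y z, [/\ `|x0 - y| <= del, `|z - z0| <= 2^-1,
    hsub h z (k *: (a + y *m B - z)) &
    gsub rho r y (- ((k *: (a + y *m B - z)) *m B^T) - mu^-1 *: (y - x))].
Proof.
move=> k0 Wk kk.
pose K := [set y : 'rV[R]_d | `|x0 - y| <= del] `*` [set z : 'rV[R]_m | `|z0 - z| <= 1].
have cK : compact K by apply: compact_setX; exact: compact_cball.
have K0 : K (x0, a + x0 *m B).
  by split => /=; [rewrite subrr normr0 ltW|apply: le_trans Hx1 _; rewrite invf_le1//; lra].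
have [[y z] [/= Ky Kz] ymin] := lsc_min (ltac:(by eexists; exact: K0) : K !=set0) cK
  (@pen_lsc _ _ _ h r mu k a B x (rconvex_continuous ch) lr).
have [fy est] := pen_lower nr k0 hw rv wv (ymin _ K0).
have /= h3 := Hx3 Ky.
set D := y - x0 in est h3 *; set s := z - (a + y *m B) in est.
rewrite -kapE in est.
have DD := sqr_norm_le_dotp D; have ss := sqr_norm_le_dotp s.
have kD : kap * `|D| ^+ 2 <= kap * dotp D D by rewrite ler_wpM2l// ltW.
have ks : k / 4 * `|s| ^+ 2 <= k / 4 * dotp s s by rewrite ler_wpM2l// divr_ge0// ltW.
have p1 : 0 <= kap * dotp D D by rewrite mulr_ge0 ?dotp_ge0// ltW.
have p2 : 0 <= k / 4 * dotp s s by rewrite mulr_ge0 ?dotp_ge0// divr_ge0// ltW.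
have yd : `|x0 - y| < del.
  rewrite distrC -/D -(@ltr_pXn2r _ 2)// ?nnegrE// ?(ltW del0)//.
  rewrite -(ltr_pM2l kap0).
  have : 0 < kap * del ^+ 2 by rewrite mulr_gt0// exprn_gt0.
  move: est h3 kD p2 Wk; lra.
have s4 : `|s| <= 4^-1.
  rewrite -(@ler_pXn2r _ 2)// ?nnegrE//; apply: le_trans kk.
  rewrite ler_pdivlMr//; move: est h3 ks p1 Wk; lra.
have z2 : `|z - z0| <= 2^-1.
  have -> : z - z0 = s + (D *m B - (z0 - (a + x0 *m B))).
    by rewrite /s /D mulmxBl; apply/rowP => i; rewrite !mxE; ring.
  have := Hx2 Ky; rewrite -/D => h2.
  apply: le_trans (ler_normD _ _) _.
  have := ler_normB (D *m B) (z0 - (a + x0 *m B)).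
  move: s4 h2 Hx1; lra.
have pnear : \forall p \near (y, z), (pen h r mu k a B x (y, z) <= pen h r mu k a B x p)%E.
  have z1 : `|z0 - z| < 1 by rewrite distrC (le_lt_trans z2)// invf_lt1//; lra.
  have n1 : \forall p \near (y, z), `|x0 - p.1| <= del.
    exact: near_fst (near_in_cball yd).
  have n2 : \forall p \near (y, z), `|z0 - p.2| <= 1.
    exact: near_snd (near_in_cball z1).
  move: n1 n2; apply: filterS2 => p p1' p2'.
  by apply: ymin; split.
have [hz ry] := pen_stationary ch rho0 nr cr fy pnear.
by exists y, z; split.
Qed.

(** The penalty parameter tends to infinity. The multipliers stay bounded because [z] stays within
    1/2 of [z0], so the defect [a + y *m B - z = w / k] vanishes and the subgradient relations pass
    to the limit. *)
Lemma kkt_fixed : exists y w, [/\ `|x0 - y| <= del, hsub h (a + y *m B) w &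
  gsub rho r y (- (w *m B^T) - mu^-1 *: (y - x))].
Proof.
pose W := dotp w0 w0; have W0 : 0 <= W := dotp_ge0 w0.
pose A := kap * del ^+ 2.
have A0 : 0 < A by rewrite mulr_gt0// exprn_gt0.
(* Each of the first two summands secures one of the two thresholds on [k] in [pen_solution]; the
   last one makes [k0] positive. *)
pose k0 := W / (A / 4) + (A / 2 * 4) / (4^-1 ^+ 2) + 1.
have Q0 : 0 < 4^-1 ^+ 2 :> R by rewrite exprn_gt0.
have A40 : 0 < A / 4 by rewrite divr_gt0.
have k00 : 0 < k0.
  by rewrite ltr_wpDl// addr_ge0// divr_ge0// ltW// mulr_gt0// divr_gt0.
have ex (n : nat) : exists p : 'rV[R]_d * 'rV[R]_m,
    let k := k0 + n%:R in
    [/\ `|x0 - p.1| <= del, `|p.2 - z0| <= 2^-1,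
    hsub h p.2 (k *: (a + p.1 *m B - p.2)) &
    gsub rho r p.1 (- ((k *: (a + p.1 *m B - p.2)) *m B^T) - mu^-1 *: (p.1 - x))].
  have kn : 0 < k0 + n%:R by rewrite ltr_wpDr.
  have kk : k0 <= k0 + n%:R by rewrite lerDl.
  have [||y [z [? ? ? ?]]] := @pen_solution (k0 + n%:R) kn.
  - rewrite ler_pdivrMr// -ler_pdivrMl// mulrC; apply: le_trans kk.
    by rewrite /k0 -addrA lerDl addr_ge0// divr_ge0// ltW// mulr_gt0// divr_gt0.
  - rewrite ler_pdivrMr// -ler_pdivrMl// mulrC; apply: le_trans kk.
    by rewrite /k0 -addrA addrCA lerDl addr_ge0// divr_ge0// ltW.
  by exists (y, z).
have [f Hf] := choice ex.
have [U [UU sU]] := ultraFilterLemma (eventually_filter).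
pose k n := k0 + n%:R : R.
pose w n := k n *: (a + (f n).1 *m B - (f n).2).
have [M HM] := hsub_bounded z0 ch.
have wM n : `|w n| <= M by have [_ h2 h3 _] := Hf n; exact: HM h2 h3.
have UF : ProperFilter U by exact: ultra_proper.
have all (P : nat -> Prop) : (forall n, P n) -> \forall n \near U, P n.
  by move=> HP; exact: filterS filterT.
have [w1 wU] := ultra_cvg (all _ wM).
have yM n : `|(f n).1| <= del + `|x0|.
  have [h1 _ _ _] := Hf n.
  rewrite -[(f n).1](subrK x0) (le_trans (ler_normD _ _))// lerD2r distrC//.
have [y1 yU] := ultra_cvg (all _ yM).
have cU : (fun n => a + (f n).1 *m B) @ U --> a + y1 *m B.
  by apply: cvgD; [exact: cvg_cst|exact: cvg_mulmxr].
have zU : (fun n => (f n).2) @ U --> a + y1 *m B.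
  have -> : (fun n => (f n).2) = (fun n => a + (f n).1 *m B - (k n)^-1 *: w n).
    apply/funext => n; rewrite /w scalerA mulVf ?scale1r ?opprB 1?addrC ?subrK//.
    by rewrite gt_eqF// /k ltr_wpDr.
  rewrite -[X in _ --> X]subr0; apply: cvgB => //.
  apply: cvg_of_near => e e0.
  have : \forall n \near U, M / e <= n%:R.
    apply: sU; exact: nbhs_infty_ger.
  apply: filterS => n nM; rewrite sub0r normrN normrZ.
  have kn : 0 < k n by rewrite /k ltr_wpDr.
  rewrite gtr0_norm ?invr_gt0// mulrC ler_pdivrMr//.
  apply: le_trans (wM n) _; rewrite mulrC -ler_pdivrMr//.
  by apply: le_trans nM _; rewrite /k lerDr ltW.
exists y1, w1; split.
- have xyU : (fun n => x0 - (f n).1) @ U --> x0 - y1 by apply: cvgB => //; exact: cvg_cst.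
  have cl : closed [set u : 'rV[R]_d | `|u| <= del].
    have -> : [set u : 'rV[R]_d | `|u| <= del] = closed_ball 0 del.
      by rewrite closed_ballE//; apply/seteqP; split => u; rewrite /closed_ball_/= sub0r normrN.
    exact: closed_ball_closed.
  apply: (@closed_cvg _ _ U UF (fun n => x0 - (f n).1) (fun u : 'rV[R]_d => is_true (`|u| <= del)) cl _ _ xyU).
  by apply: all => // n; have [] := Hf n.
- apply/gsub_hsub.
  apply: (@gsub_closed _ _ U UF 0 _ (EFin \o h) (fun n => (f n).2) w _ _ z0) => //.
    move=> u c /=; rewrite lte_fin => cu.
    have e0 : 0 < (h u - c) / 2 by rewrite divr_gt0// subr_gt0.
    have := near_continuous (W := R^o) (rconvex_continuous ch (x := u)) e0.
    apply: filterS => v; rewrite ler_norml lte_fin => /andP[_]; lra.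
  by apply: all => // n; have [_ _ ? _] := Hf n; apply/gsub_hsub.
- apply: (@gsub_closed _ _ U UF rho _ r (fun n => (f n).1)
    (fun n => - (w n *m B^T) - mu^-1 *: ((f n).1 - x)) _ _ x0) => //.
  + by case: rv.
  + apply: cvgB; first by apply: cvgN; exact: cvg_mulmxr.
    apply: cvgZl_tmp; apply: cvgB => //; exact: cvg_cst.
  + by apply: all => // n; have [] := Hf n.
Qed.

End Fixed.
End KKTexists.

(** * Stationarity characterizes the prox-linear step *)

Section Prox.
Variable R : realType.

(** If [f] were frequently far from [l0], some ultrafilter would live on that bad set; by
    boundedness [f] converges along it, and by hypothesis to [l0]. *)
Lemma ultra_unique_cvg T (F : set_system T) {FF : ProperFilter F} n
    (f : T -> 'rV[R]_n) (l0 : 'rV[R]_n) (M : R) :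
  (\forall t \near F, `|f t| <= M) ->
  (forall (U : set_system T) (l : 'rV[R]_n), UltraFilter U -> F `<=` U -> f @ U --> l -> l = l0) ->
  f @ F --> l0.
Proof.
move=> fM H; apply: cvg_of_near => e e0; apply: contrapT => nF.
pose A := [set t | ~ (`|l0 - f t| <= e)].
have PA : ProperFilter (within A F).
  split; last exact: within_filter.
  by rewrite /within/= => FA; apply: nF; apply: filterS FA => t At; apply: contrapT.
have [U [UU sU]] := ultraFilterLemma PA.
have FU : F `<=` U by move=> B FB; apply: sU; exact: filterS FB.
have UF : ProperFilter U by exact: ultra_proper.
have [l fl] := ultra_cvg (FU _ fM).
have ll := H U l UU FU fl; rewrite ll in fl.
have h1 : \forall t \near U, `|l0 - f t| <= e by exact: cvg_near.
have h2 : \forall t \near U, A t by apply: sU; exact: withinT.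
by have [t []] := filter_ex (filterI h1 h2).
Qed.

Lemma diffJ n q (F : 'rV[R]_n -> 'rV[R]_q) x u : 'd F x u = u *m 'J F x.
Proof. by rewrite /jacobian mul_rV_lin1. Qed.

Variables (d m : nat) (F : 'rV[R]_d -> 'rV[R]_m) (h : 'rV[R]_m -> R).
Variables (r : 'rV[R]_d -> \bar R) (rho mu : R).
Hypothesis (ch : rconvex h) (rho0 : 0 <= rho) (nr : avoids_ninfty r) (lr : lsc r)
  (cr : weakly_convex rho r) (mu0 : 0 < mu) (murho : mu * rho < 1).

Definition model (x y : 'rV[R]_d) : 'rV[R]_m := F x + (y - x) *m 'J F x.

Definition stationary (x y : 'rV[R]_d) (w : 'rV[R]_m) : Prop :=
  hsub h (model x y) w /\ gsub rho r y (- (w *m ('J F x)^T) - mu^-1 *: (y - x)).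

Lemma kappa_gt0 : 0 < (2 * mu)^-1 - rho / 2.
Proof.
rewrite invfM -mulrC -mulrBl divr_gt0// subr_gt0.
by rewrite -(ltr_pM2l mu0) mulfV ?gt_eqF.
Qed.

(** The subproblem grows quadratically away from a stationary point, with the positive constant
    [(2 * mu)^-1 - rho / 2]. Such a point is therefore the only minimizer, and [xget] has no
    choice. *)
Lemma stationary_prox x y w : stationary x y w -> prox_linear F h r mu x = y.
Proof.
move=> [hw [fy rv]].
have [b rb] : exists b, r y = b%:E by exists (fine (r y)); rewrite fineK.
pose phi y' : \bar R := ((h (F x + 'd F x (y' - x)))%:E + r y'
      + ((2 * mu)^-1 * enorm (y' - x) ^+ 2)%:E)%E.
have grow z : (phi y + (((2 * mu)^-1 - rho / 2) * dotp (z - y) (z - y))%:E <= phi z)%E.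
  have := rv z; have := nr z; rewrite /phi rb; case: (r z) => [c||] //= _.
    rewrite -!EFinD !lee_fin !enorm_sqr !diffJ => {}rv.
    have := hw (model x z); rewrite /model.
    have -> : F x + (z - x) *m 'J F x - (F x + (y - x) *m 'J F x) = (z - y) *m 'J F x.
      by rewrite !mulmxBl; apply/rowP => i; rewrite !mxE; ring.
    rewrite dotpBl dotpNl dotpZl dotp_mulmx trmxK in rv.
    have -> : z - x = (z - y) + (y - x) by rewrite addrA subrK.
    rewrite (dotp_sqrD (z - y)) invfM => hz.
    move: rv hz; move: (mu^-1) (dotp (z - y) (z - y)) (dotp (y - x) (z - y))
      (dotp (y - x) (y - x)) (h _) (dotp w _) (h _) => *.
    lra.
  by move=> _; rewrite addey// addye// leey.
have argy z : argmin phi z -> z = y.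
  move=> /(_ y) zy; have := le_trans (grow z) zy.
  rewrite /phi rb -!EFinD lee_fin gerDl => H.
  have /dotp_eq0/eqP : dotp (z - y) (z - y) = 0.
    apply/eqP; rewrite eq_le dotp_ge0 andbT.
    by rewrite -(pmulr_rle0 _ kappa_gt0).
  by rewrite subr_eq0 => /eqP.
rewrite /prox_linear -/phi; apply: xget_unique => // z.
apply: le_trans (grow z); rewrite leeDl// lee_fin mulr_ge0 ?dotp_ge0// ltW//.
exact: kappa_gt0.
Qed.

Variables (x0 : 'rV[R]_d) (w0 : 'rV[R]_m).
Hypothesis (Fx0 : F @ x0 --> F x0) (JFx0 : jacobian F @ x0 --> 'J F x0)
  (hw : hsub h (F x0) w0) (rv : gsub rho r x0 (- (w0 *m ('J F x0)^T))).

Lemma model_cvg : (fun x => model x x0) @ x0 --> F x0.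
Proof.
have C : (fun x => (x0 - x) *m 'J F x) @ x0 --> (0 : 'rV[R]_m); last first.
  by have CC := cvgD Fx0 C; rewrite addr0 in CC; exact: CC.
apply: (cvg_of_near (F := nbhs x0)) => e e0.
pose c := d%:R * (`|'J F x0| + 1) + 1.
have c0 : 0 < c by rewrite ltr_wpDl// mulr_ge0// addr_ge0.
have n1 : \forall x \near x0, `|'J F x0 - 'J F x| <= 1.
  exact: (cvg_near JFx0 ltr01).
have n2 := near_dist x0 (divr_gt0 e0 c0).
move: n1 n2; apply: filterS2 => x h1 h2.
rewrite sub0r normrN (le_trans (mulmx_norm_le _ _))//.
have h3 : `|'J F x| <= `|'J F x0| + 1.
  by rewrite -['J F x](subrK ('J F x0)) addrC (le_trans (ler_normD _ _))// lerD2l distrC.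
have h4 : d%:R * `|'J F x| <= c.
  by apply: (@le_trans _ _ (d%:R * (`|'J F x0| + 1))); rewrite ?ler_wpM2l// /c lerDl.
rewrite ltr_pdivlMr// in h2.
rewrite mulrAC mulrC; apply: le_trans (ltW h2).
by rewrite ler_wpM2l.
Qed.

(** At [x0] the step [x0] with multiplier [w0] is stationary. The data of the model at [x] tend to
    those at [x0], so the smallness conditions of [kkt_fixed] hold for [x] near [x0]. *)
Lemma kkt_near (del : R) : 0 < del ->
  \forall x \near x0, exists y w, `|x0 - y| <= del /\ stationary x y w.
Proof.
move=> del0; set B0 := 'J F x0; set z0 := F x0.
pose c := d%:R * (`|B0| + 1).
have c0 : 0 <= c by rewrite mulr_ge0// addr_ge0.
have c1 : 0 < 8 * (c + 1) by rewrite mulr_gt0// ltr_wpDl.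
(* The bound 1 drops [D] from the products below; the last bound forces
   [|(y - x0) *m 'J F x| <= 1/8]. *)
pose D := Num.min del (Num.min 1 (8 * (c + 1))^-1).
have D0 : 0 < D by rewrite !lt_min del0 ltr01 invr_gt0.
have D1 : D <= 1 by rewrite !ge_min lexx orbT.
have Ddel : D <= del by rewrite ge_min lexx.
have Dc : D * c <= 8^-1.
  have h1 : D <= (8 * (c + 1))^-1 by rewrite !ge_min lexx !orbT.
  apply: le_trans (ler_wpM2r c0 h1) _.
  by rewrite invfM -mulrA ger_pMr ?invr_gt0// ler_pdivrMl ?ltr_wpDl// mulr1 lerDl.
pose kap := (2 * mu)^-1 - rho / 2; have kap0 : 0 < kap := kappa_gt0.
(* The allowance [kap * D ^+ 2 / 4] is shared equally among four perturbation terms. *)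
pose tau := kap * D ^+ 2 / 16.
have tau0 : 0 < tau by rewrite divr_gt0// mulr_gt0// exprn_gt0.
have mud : 0 <= mu^-1 * d%:R by rewrite mulr_ge0// invr_ge0 ltW.
have mw : 0 <= m%:R * `|w0| by rewrite mulr_ge0.
have mwd : 0 <= m%:R * `|w0| * d%:R by rewrite mulr_ge0.
have p1 : 0 < mu^-1 * d%:R + 1 by rewrite ltr_wpDl.
have p2 : 0 < m%:R * `|w0| + 1 by rewrite ltr_wpDl.
have p3 : 0 < m%:R * `|w0| * d%:R + 1 by rewrite ltr_wpDl.
have n1 : \forall x \near x0, `|z0 - model x x0| <= 8^-1.
  by apply: (cvg_near model_cvg); rewrite invr_gt0.
have n2 : \forall x \near x0, `|z0 - model x x0| <= tau / (m%:R * `|w0| + 1).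
  by apply: (cvg_near model_cvg); exact: divr_gt0.
have n3 : \forall x \near x0, `|B0 - 'J F x| <= 1.
  exact: (cvg_near JFx0 ltr01).
have n4 : \forall x \near x0, `|B0 - 'J F x| <= tau / (m%:R * `|w0| * d%:R + 1).
  by apply: (cvg_near JFx0); exact: divr_gt0.
have n5 : \forall x \near x0, `|x0 - x| < tau / (mu^-1 * d%:R + 1).
  by apply: near_dist; exact: divr_gt0.
have n6 : \forall x \near x0, `|h z0 - h (model x x0)| <= tau.
  have hc : (fun x => h (model x x0)) @ x0 --> h z0.
    by apply: (cvg_comp _ _ model_cvg); exact: rconvex_continuous.
  exact: (cvg_near (V := R^o) hc tau0).
near=> x.
have nn1 : `|z0 - model x x0| <= 8^-1 by near: x; exact: n1.
have nn2 : `|z0 - model x x0| <= tau / (m%:R * `|w0| + 1) by near: x; exact: n2.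
have nn3 : `|B0 - 'J F x| <= 1 by near: x; exact: n3.
have nn4 : `|B0 - 'J F x| <= tau / (m%:R * `|w0| * d%:R + 1) by near: x; exact: n4.
have nn5 : `|x0 - x| < tau / (mu^-1 * d%:R + 1) by near: x; exact: n5.
have nn6 : `|h z0 - h (model x x0)| <= tau by near: x; exact: n6.
pose a := F x - x *m 'J F x.
have aE y : a + y *m 'J F x = model x y.
  by rewrite /a /model mulmxBl; apply/rowP => i; rewrite !mxE; ring.
have wv0 : w0 *m B0^T + - (w0 *m B0^T) = 0 by rewrite subrr.
have [||y|y [w [y1 y2 y3]]] := @kkt_fixed R d m h r rho mu a ('J F x) B0 x x0 z0 w0
    _ D kap ch rho0 nr lr cr hw rv wv0 D0 kap0 erefl.
- by rewrite aE.
- move=> y yD; rewrite distrC in yD; apply: le_trans (mulmx_norm_le _ _) _.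
  apply: le_trans Dc; rewrite mulrAC mulrC.
  have h3 : `|'J F x| <= `|B0| + 1.
    by rewrite -['J F x](subrK B0) addrC (le_trans (ler_normD _ _))// lerD2l distrC.
  by apply: ler_pM => //; rewrite ?mulr_ge0// /c ler_wpM2l.
- move=> yD; rewrite distrC in yD; rewrite aE.
  have q1 : mu^-1 * dotp (y - x0) (x - x0) <= tau.
    apply: (@le_trans _ _ (mu^-1 * (d%:R * (tau / (mu^-1 * d%:R + 1))))).
      rewrite ler_wpM2l ?invr_ge0 ?(ltW mu0)//.
      apply: le_trans (ler_norm _) _; apply: le_trans (dotp_le _ _) _.
      rewrite -mulrA ler_wpM2l//; rewrite distrC in nn5.
      apply: le_trans (ltW nn5); rewrite ler_piMl//; exact: le_trans D1.
    by rewrite mulrA mulrCA ger_pMr// ler_pdivrMr// mul1r lerDl.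
  have q2 : `|dotp w0 (model x x0 - z0)| <= tau.
    apply: le_trans (dotp_le _ _) _; rewrite distrC in nn2.
    apply: le_trans (ler_wpM2l mw nn2) _.
    by rewrite mulrCA ger_pMr// ler_pdivrMr// mul1r lerDl.
  have q3 : `|dotp w0 ((y - x0) *m ('J F x - B0))| <= tau.
    apply: le_trans (dotp_le _ _) _; rewrite distrC in nn4.
    have : `|(y - x0) *m ('J F x - B0)| <= d%:R * (tau / (m%:R * `|w0| * d%:R + 1)).
      apply: le_trans (mulmx_norm_le _ _) _; rewrite -mulrA ler_wpM2l//.
      apply: le_trans nn4; rewrite ler_piMl//; exact: le_trans D1.
    move=> q; apply: le_trans (ler_wpM2l mw q) _.
    have -> : m%:R * `|w0| * (d%:R * (tau / (m%:R * `|w0| * d%:R + 1))) =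
      tau * (m%:R * `|w0| * d%:R / (m%:R * `|w0| * d%:R + 1)) by ring.
    by rewrite ger_pMr// ler_pdivrMr// mul1r lerDl.
  have -> : kap * D ^+ 2 / 4 = tau + tau + tau + tau by rewrite /tau; field.
  move: nn6 q1 q2 q3; rewrite !ler_norml => /andP[a1 a2] a3 /andP[a4 a5] /andP[a6 a7].
  move: (dotp w0 (model x x0 - z0)) (dotp w0 ((y - x0) *m _)) (mu^-1 * _) (h z0)
    (h (model x x0)) a1 a2 a3 a4 a5 a6 a7 => *; lra.
exists y, w; split; first exact: le_trans y1 Ddel.
by split; rewrite -?aE.
Unshelve. all: by end_near. Qed.

End Prox.

(** * Active manifolds and their Lagrangians *)

Section Active.
Variable R : realType.

Lemma Cp2_Cp1 (V W : normedModType R) (f : V -> W) : Cp 2 f -> Cp 1 f.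
Proof.
move=> [df cf]; split=> // v x; apply: differentiable_continuous.
by have [H _] := cf v; exact: H.
Qed.

Lemma delta_mul_tr n q (A : 'M[R]_(n, q)) i j :
  ((delta_mx ord0 j : 'rV[R]_q) *m A^T) ord0 i = A i j.
Proof. by rewrite -rowE !mxE. Qed.

Lemma norm_sub_rows n q (A B : 'M[R]_(n, q)) c : 0 <= c ->
  (forall j, `|(delta_mx ord0 j : 'rV[R]_q) *m A^T - (delta_mx ord0 j : 'rV[R]_q) *m B^T| <= c) ->
  `|A - B| <= c.
Proof.
move=> c0 H; apply: norm_le_coord => // i j; apply: le_trans (H j).
have := coord_le_norm ((delta_mx ord0 j : 'rV[R]_q) *m (A - B)^T) ord0 i.
by rewrite delta_mul_tr linearB/= mulmxBr.
Qed.

(** Each row of the transposed Jacobian is the gradient of a coordinate function, hence strictly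
    differentiable and so Lipschitz near [x]. *)
Lemma Cp2_jacobian_lip n q (P : 'rV[R]_n -> 'rV[R]_q) (x : 'rV[R]_n) : Cp 2 P ->
  exists2 L : R, 0 < L &
    \forall p \near (x, x), `|'J P p.1 - 'J P p.2| <= L * `|p.1 - p.2|.
Proof.
move=> cP.
have H (j : 'I_q) : exists L : R, 0 < L /\ \forall p \near (x, x),
    `|(delta_mx ord0 j : 'rV[R]_q) *m ('J P p.1)^T
      - (delta_mx ord0 j : 'rV[R]_q) *m ('J P p.2)^T| <= L * `|p.1 - p.2|.
  have [_ /sdiff_lipschitz[L L0 HL]] := Cp2_C2at_dotpl (delta_mx ord0 j) x cP.
  by exists L; split.
have [L HL] := choice H.
exists (1 + \sum_j L j).
  by rewrite ltr_wpDr// sumr_ge0// => j _; case: (HL j) => /ltW.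
have : \forall p \near (x, x), forall j, `|(delta_mx ord0 j : 'rV[R]_q) *m ('J P p.1)^T
    - (delta_mx ord0 j : 'rV[R]_q) *m ('J P p.2)^T| <= L j * `|p.1 - p.2|.
  by apply: (@filter_forall _ _ _ (nbhs (x, x)) _) => j; case: (HL j).
apply: filterS => p Hp; apply: norm_sub_rows => [|j].
  by apply: mulr_ge0 => //; rewrite addr_ge0// sumr_ge0// => j _; case: (HL j) => /ltW.
apply: le_trans (Hp j) _.
rewrite ler_wpM2r// (bigD1 j)//= addrCA lerDl addr_ge0// sumr_ge0// => k _.
by case: (HL k) => /ltW.
Qed.

Lemma near_lip_cvg n (V : normedModType R) (f : 'rV[R]_n -> V) (x : 'rV[R]_n) (L : R) : 0 < L ->
  (\forall p \near (x, x), `|f p.1 - f p.2| <= L * `|p.1 - p.2|) -> f @ x --> f x.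
Proof.
move=> L0 /near_diag_right H; apply: (cvg_of_near (F := nbhs x)) => e e0.
move: H (near_dist x (divr_gt0 e0 L0)); apply: filterS2 => y /= h1.
rewrite ltr_pdivlMr// => h2; apply: le_trans h1 _; rewrite mulrC; exact: ltW.
Qed.

Lemma Cp2_jacobian_cvg n q (P : 'rV[R]_n -> 'rV[R]_q) (x : 'rV[R]_n) : Cp 2 P ->
  jacobian P @ x --> 'J P x.
Proof. by move=> /(Cp2_jacobian_lip x)[L L0]; exact: near_lip_cvg. Qed.

(* P = 0 is an equation, with right-invertible Jacobian, of the active manifold
   of phi at p0 for u0, and g a smooth representative of phi - <u0, .> on it. *)
Definition active_data (rho : R) n q (phi : 'rV[R]_n -> \bar R) (p0 u0 : 'rV[R]_n)
    (P : 'rV[R]_n -> 'rV[R]_q) (Pi : 'M[R]_(q, n)) (g : 'rV[R]_n -> R^o) : Prop :=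
  [/\ Cp 2 P /\ Cp 2 g, P p0 = 0, Pi *m 'J P p0 = 1%:M,
   \forall y \near p0, P y = 0 -> phi y = (g y + dotp u0 y)%:E &
   exists2 e : R, 0 < e & \forall y \near p0, forall v, `|v - u0| < e ->
     gsub rho phi y v -> P y = 0].

Variables (rho : R) (n q : nat) (phi : 'rV[R]_n -> \bar R) (p0 u0 : 'rV[R]_n).
Variables (P : 'rV[R]_n -> 'rV[R]_q) (Pi : 'M[R]_(q, n)) (g : 'rV[R]_n -> R^o).
Hypotheses (rho0 : 0 <= rho) (act : active_data rho phi p0 u0 P Pi g)
  (sub0 : gsub rho phi p0 u0).

(** On [P = 0] the function [g] represents [phi] tilted by [u0], so [v - u0] is a proximal
    subgradient of [g] along that set; passing from the Euclidean error to the sup norm costs the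
    factor [n%:R]. *)
Lemma active_multiplier : \forall y \near p0, P y = 0 -> forall v, gsub rho phi y v ->
  exists l, v - u0 = grad g y + l *m ('J P y)^T.
Proof.
have [[cP cg] P0 PiJ phig _] := act.
have [gg _] := Cp2_C2at p0 cg.
have cgg : continuous (grad g) by move=> y; have [_ /sdiff_cvg] := Cp2_C2at y cg.
have NM := normal_multiplier (Cp2_Cp1 cP) PiJ P0 gg cgg.
move: NM (nbhs_interior phig); apply: filterS2 => y NM phiy Py v [fy sv].
have c0 : 0 <= rho / 2 * n%:R by rewrite mulr_ge0// divr_ge0.
have [|l E] := NM Py (v - u0) (rho / 2 * n%:R) c0; last first.
  by exists l; rewrite -E addrCA subrr addr0.
have phy := nbhs_singleton phiy Py.
move: phiy; apply: filterS => z phiz Pz.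
have := sv z; rewrite phy phiz// -!EFinD lee_fin => H.
have h := dotp_le_sqr_norm (z - y).
have h2 : rho / 2 * dotp (z - y) (z - y) <= rho / 2 * n%:R * `|z - y| ^+ 2.
  by rewrite -[leRHS]mulrA ler_wpM2l// divr_ge0.
rewrite dotpBl (dotpBr z y u0); lra.
Qed.

(** [lam] is the multiplier of [u0] at [p0], which makes the gradient of the Lagrangian vanish
    there. Multipliers of nearby subgradients are counted from [lam] and are small because the
    Jacobian at [p0] has the left inverse [Pi]. *)
Lemma active_lagrangian : exists (lam : 'rV[R]_q) (H : 'M[R]_n),
  let L y := g y + dotp lam (P y) in let DL y := grad g y + lam *m ('J P y)^T in
  [/\ C2at L p0 DL H, DL p0 = 0,
    (\forall y \near p0, P y = 0 -> forall v, gsub rho phi y v ->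
       exists l, v - u0 = DL y + l *m ('J P y)^T) &
    (forall e, 0 < e -> exists2 del, 0 < del & \forall y \near p0, forall (v : 'rV[R]_n) (l : 'rV[R]_q),
       `|v - u0| <= del -> v - u0 = DL y + l *m ('J P y)^T -> `|l| <= e)].
Proof.
have [[cP cg] P0 PiJ _ _] := act.
have [mu Emu] := nbhs_singleton active_multiplier P0 u0 sub0.
rewrite subrr in Emu.
pose H := hess g p0 + hess (fun y => dotp mu (P y) : R^o) p0.
exists mu, H => L DL.
have DL0 : DL p0 = 0 by rewrite /DL -Emu.
have C2L : C2at L p0 DL H by apply: C2atD; [exact: Cp2_C2at|exact: Cp2_C2at_dotpl].
split => //.
  move: active_multiplier; apply: filterS => y Hy Py v sv.
  have [l El] := Hy Py v sv; exists (l - mu).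
  by rewrite El /DL mulmxBl -addrA; congr (_ + _); rewrite addrC subrK.
move=> e e0.
pose c := n%:R * `|Pi| + 1; have c0 : 0 < c by rewrite ltr_wpDl// mulr_ge0.
pose del := e / (4 * c); have del0 : 0 < del by rewrite divr_gt0// mulr_gt0.
exists del => //.
have [_ sDL] := C2L.
have n1 : \forall y \near p0, `|DL p0 - DL y| <= del by exact: cvg_near (sdiff_cvg sDL) del0.
(* Chosen so that the occurrence of [|l|] on the right-hand side is at most [|l| / 2] and can be
   absorbed. *)
pose eta := (2 * c * (q%:R + 1))^-1.
have eta0 : 0 < eta by rewrite invr_gt0 !mulr_gt0// ltr_wpDl.
have n2 : \forall y \near p0, `|'J P p0 - 'J P y| <= eta.
  exact: cvg_near (Cp2_jacobian_cvg cP) eta0.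
move: n1 n2; apply: filterS2 => y h1 h2 v l h3 E.
(* Solving for [l] with the Jacobian frozen at [p0]; [l] reappears only multiplied by the change of
   the Jacobian. *)
have lE : l = (v - u0 - DL y + l *m ('J P p0 - 'J P y)^T) *m Pi^T.
  rewrite E [DL y + _]addrC addrK -mulmxDr linearB/= addrC subrK -mulmxA.
  by rewrite -trmx_mul PiJ trmx1 mulmx1.
rewrite DL0 sub0r normrN in h1.
have h4 : `|l *m ('J P p0 - 'J P y)^T| <= q%:R * `|l| * eta.
  apply: le_trans (mulmx_norm_le _ _) _; rewrite norm_tr ler_wpM2l// mulr_ge0//.
have h5 : `|l| <= c * (del + del + q%:R * `|l| * eta).
  rewrite {1}lE; apply: le_trans (mulmx_norm_le _ _) _; rewrite norm_tr.
  rewrite mulrAC; apply: ler_pM => //; rewrite ?mulr_ge0 ?lerDl//.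
  apply: le_trans (ler_normD _ _) _; rewrite lerD//.
  by apply: le_trans (ler_normB _ _) _; rewrite lerD.
have h6 : c * (q%:R * `|l| * eta) <= `|l| / 2.
  rewrite /eta !invfM.
  have -> : c * (q%:R * `|l| * (2^-1 / c / (q%:R + 1))) = `|l| / 2 * (q%:R / (q%:R + 1)).
    by field; rewrite gt_eqF ?ltr_wpDl// gt_eqF.
  by rewrite ler_piMr ?divr_ge0// ler_pdivrMr ?ltr_wpDl// mul1r lerDl.
have h7 : c * (del + del) = e / 2 by rewrite /del; field; rewrite gt_eqF.
rewrite mulrDr h7 in h5; lra.
Qed.

(** Second-order necessary condition: the subgradient inequality for [u0] is tested on points
    [p0 + t u + o(t)] of the manifold and compared with the Taylor expansion of [L]. As the gradient
    of [L] vanishes, the correction [o(t)] costs only [o(t^2)]. *)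
Lemma active_curvature lam (H : 'M[R]_n) (u : 'rV[R]_n) :
  let L y := g y + dotp lam (P y) in let DL y := grad g y + lam *m ('J P y)^T in
  C2at L p0 DL H -> DL p0 = 0 -> u *m 'J P p0 = 0 ->
  - rho * dotp u u <= dotp (u *m H) u.
Proof.
move=> L DL C2L DL0 uJ.
have [[cP cg] P0 PiJ phig _] := act.
have TC := nbhs_singleton (tangent_curve (Cp2_Cp1 cP) PiJ P0) P0 u uJ.
pose H' := H + rho%:M.
have bE D : dotp (D *m H') D = dotp (D *m H) D + rho * dotp D D.
  by rewrite mulmxDr mul_mx_scalar dotpDl dotpZl.
pose K := 2 * (`|u| + 1) ^+ 2 + n%:R * (n%:R * `|H'|) * (2 * `|u| + 1).
have nH : 0 <= n%:R * (n%:R * `|H'|) by rewrite !mulr_ge0.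
have K0 : 0 <= K by rewrite !(mulr_ge0, addr_ge0, exprn_ge0).
have bl (a b : 'rV[R]_n) : `|dotp (a *m H') b| <= n%:R * (n%:R * `|H'|) * (`|a| * `|b|).
  apply: le_trans (dotp_le _ _) _.
  have := ler_wpM2l (ler0n R n) (mulmx_norm_le a H').
  move=> h; apply: le_trans (ler_wpM2r (normr_ge0 b) h) _.
  by rewrite le_eqVlt; apply/orP; left; apply/eqP; ring.
suff : - dotp (u *m H') u <= 0 by rewrite bE; lra.
apply: (le0_of_small K0) => e e0 e1.
have [d /= d0 dP] := (nbhs_ballP _ _).1 (filterI phig (taylor2 C2L e0)).
near (0 : R)^'+ => t.
have t0 : 0 < t by [].
have td : t * (`|u| + 1) < d by near: t; apply: near_right_scale => //; rewrite addr_ge0.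
have [z Pz zt] : exists2 z, P z = 0 & `|z - (p0 + t *: u)| <= e * t by near: t; exact: TC.
set rr := z - (p0 + t *: u) in zt; set D := z - p0.
have DE : D = t *: u + rr by rewrite /rr /D; apply/rowP => i; rewrite !mxE; ring.
have rt : `|rr| <= t by apply: le_trans zt _; rewrite ger_pMl.
have Dt : `|D| <= t * (`|u| + 1).
  rewrite DE (le_trans (ler_normD _ _))// normrZ gtr0_norm//.
  by rewrite mulrDr mulr1 lerD2l.
have /dP[phz] : ball p0 d z by rewrite -ball_normE/= distrC (le_lt_trans Dt).
rewrite DL0 dotp0l subr0 -/D => tay.
have [_ /(_ z)] := sub0.
rewrite (nbhs_singleton phig P0) (phz Pz) -EFinD lee_fin -/D => sg.
have L0E : L p0 = g p0 by rewrite /L P0 dotp0r addr0.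
have LzE : L z = g z by rewrite /L Pz dotp0r addr0.
rewrite LzE L0E in tay.
have uD : dotp u0 z - dotp u0 p0 = dotp u0 D by rewrite dotpBr.
have h1 : 0 <= dotp (D *m H') D + 2 * (e * `|D| ^+ 2).
  rewrite bE; move: tay sg uD; rewrite ler_norml => /andP[_]; lra.
have h2 : `|D| ^+ 2 <= t ^+ 2 * (`|u| + 1) ^+ 2.
  by rewrite -exprMn ler_pXn2r// nnegrE ?mulr_ge0 ?addr_ge0// ltW.
have h3 : dotp (D *m H') D = t ^+ 2 * dotp (u *m H') u +
    (t * dotp (u *m H') rr + (t * dotp (rr *m H') u + dotp (rr *m H') rr)).
  rewrite {1}DE mulmxDl -scalemxAl DE dotpDl !(dotpDr (t *: u) rr) !dotpZl !dotpZr; ring.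
have b1 := le_trans (ler_norm _) (bl u rr); have b2 := le_trans (ler_norm _) (bl rr u).
have b3 := le_trans (ler_norm _) (bl rr rr).
have ur : `|u| * `|rr| <= t * (e * `|u|).
  by rewrite mulrC mulrA ler_wpM2r// mulrC.
have rrr : `|rr| * `|rr| <= t * t * e.
  have := ler_pM (normr_ge0 _) (normr_ge0 _) zt rt; move=> h; apply: le_trans h _.
  by rewrite le_eqVlt; apply/orP; left; apply/eqP; ring.
have c1 := le_trans b1 (ler_wpM2l nH ur).
rewrite mulrC in ur.
have c2 := le_trans b2 (ler_wpM2l nH ur).
have c3 := le_trans b3 (ler_wpM2l nH rrr).
have d1 := ler_wpM2l (ltW t0) c1; have d2 := ler_wpM2l (ltW t0) c2.
have h4 := ler_wpM2l (ltW e0) h2.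
have t20 : 0 < t ^+ 2 by rewrite exprn_gt0.
rewrite -(ler_pM2l t20) /K.
move: h1 h3 d1 d2 c3 h4; rewrite !expr2.
move: (n%:R * _) (dotp (D *m H') D) (dotp (u *m H') u) (dotp (u *m H') rr)
 (dotp (rr *m H') u) (dotp (rr *m H') rr) (`|D| * `|D|) (`|u|) => *; lra.
Unshelve. all: by end_near. Qed.

End Active.

(** * Strict differentiability of the prox-linear map *)

Section SmallO.
Variables (R : realType) (T : Type) (F : set_system T) (s : T -> R).
Hypotheses (FF : Filter F) (s0 : forall t, 0 <= s t).

(** Small [o] of the scale [s] along [F]; [obig] is the matching big [O]. The scale is abstract
    because it will contain increments not yet bounded. *)
Definition osm (V : normedModType R) (f : T -> V) : Prop :=
  forall e : R, 0 < e -> \forall t \near F, `|f t| <= e * s t.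

Definition obig (V : normedModType R) (f : T -> V) : Prop :=
  exists2 C : R, 0 < C & \forall t \near F, `|f t| <= C * s t.

Lemma osm_eq (V : normedModType R) (f g : T -> V) :
  osm f -> (\forall t \near F, f t = g t) -> osm g.
Proof.
move=> fo fg e e0; move: (fo e e0) fg; apply: filterS2 => t h <-; exact: h.
Qed.

Lemma osmD (V : normedModType R) (f g : T -> V) : osm f -> osm g -> osm (fun t => f t + g t).
Proof.
move=> fo go e e0; have e20 : 0 < e / 2 by rewrite divr_gt0.
move: (fo _ e20) (go _ e20); apply: filterS2 => t h1 h2.
apply: le_trans (ler_normD _ _) _; lra.
Qed.

Lemma osmN (V : normedModType R) (f : T -> V) : osm f -> osm (fun t => - f t).
Proof. by move=> fo e e0; have := fo e e0; apply: filterS => t; rewrite normrN. Qed.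

Lemma osmB (V : normedModType R) (f g : T -> V) : osm f -> osm g -> osm (fun t => f t - g t).
Proof. by move=> fo go; apply: osmD => //; exact: osmN. Qed.

Lemma osm_mulmxr m n p (f : T -> 'M[R]_(m, n)) (A : 'M[R]_(n, p)) :
  osm f -> osm (fun t => f t *m A).
Proof.
move=> fo e e0; pose c := n%:R * `|A| + 1.
have c0 : 0 < c by rewrite ltr_wpDl// mulr_ge0.
have := fo _ (divr_gt0 e0 c0); apply: filterS => t ft.
apply: le_trans (mulmx_norm_le _ _) _; rewrite mulrAC.
apply: (@le_trans _ _ (c * (e / c * s t))).
  by apply: ler_pM => //; rewrite ?mulr_ge0// lerDl.
by rewrite mulrA mulrCA mulfV ?mulr1 ?gt_eqF.
Qed.

Lemma obigD (V : normedModType R) (f g : T -> V) : obig f -> obig g -> obig (fun t => f t + g t).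
Proof.
move=> [C C0 fC] [D D0 gD]; exists (C + D); first exact: addr_gt0.
move: fC gD; apply: filterS2 => t h1 h2; apply: le_trans (ler_normD _ _) _.
by rewrite mulrDl lerD.
Qed.

Lemma obigN (V : normedModType R) (f : T -> V) : obig f -> obig (fun t => - f t).
Proof. by move=> [C C0 fC]; exists C => //; apply: filterS fC => t; rewrite normrN. Qed.

Lemma obig_mulmxr m n p (f : T -> 'M[R]_(m, n)) (A : 'M[R]_(n, p)) :
  obig f -> obig (fun t => f t *m A).
Proof.
move=> [C C0 fC]; pose c := n%:R * `|A| + 1.
have c0 : 0 < c by rewrite ltr_wpDl// mulr_ge0.
exists (c * C); first exact: mulr_gt0.
apply: filterS fC => t ft; apply: le_trans (mulmx_norm_le _ _) _; rewrite mulrAC -[leRHS]mulrA.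
by apply: ler_pM => //; rewrite ?mulr_ge0// lerDl.
Qed.

Lemma obig_osm (V : normedModType R) (f g : T -> V) :
  osm (fun t => f t - g t) -> obig g -> obig f.
Proof.
move=> /(_ _ ltr01) fg [C C0 gC]; exists (1 + C); first by rewrite addr_gt0.
move: fg gC; apply: filterS2 => t h1 h2; rewrite -[f t](subrK (g t)).
apply: le_trans (ler_normD _ _) _; by rewrite mulrDl lerD.
Qed.

Lemma osm_mul_obig m n p (f : T -> 'M[R]_(m, n)) (g : T -> 'M[R]_(n, p)) :
  f @ F --> (0 : 'M[R]_(m, n)) -> obig g -> osm (fun t => f t *m g t).
Proof.
move=> f0 [C C0 gC] e e0; pose c := n%:R * C + 1.
have c0 : 0 < c by rewrite ltr_wpDl// mulr_ge0// ltW.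
have fn : \forall t \near F, `|0 - f t| <= e / c by exact: (cvg_near f0 (divr_gt0 e0 c0)).
move: fn gC; apply: filterS2 => t; rewrite sub0r normrN => h1 h2.
apply: le_trans (mulmx_norm_le _ _) _.
apply: (@le_trans _ _ (n%:R * (e / c) * (C * s t))).
  by apply: ler_pM => //; rewrite ?mulr_ge0// ler_wpM2l.
have -> : n%:R * (e / c) * (C * s t) = e * s t * (n%:R * C / c) by ring.
by rewrite ler_piMr ?mulr_ge0 ?(ltW e0)// ler_pdivrMr// mul1r lerDl.
Qed.

Lemma obig_mul_osm m n p (f : T -> 'M[R]_(m, n)) (g : T -> 'M[R]_(n, p)) :
  obig f -> g @ F --> (0 : 'M[R]_(n, p)) -> osm (fun t => f t *m g t).
Proof.
move=> [C C0 fC] g0 e e0; pose c := n%:R * C + 1.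
have c0 : 0 < c by rewrite ltr_wpDl// mulr_ge0// ltW.
have gn : \forall t \near F, `|0 - g t| <= e / c by exact: (cvg_near g0 (divr_gt0 e0 c0)).
move: gn fC; apply: filterS2 => t; rewrite sub0r normrN => h1 h2.
apply: le_trans (mulmx_norm_le _ _) _.
apply: (@le_trans _ _ (n%:R * (C * s t) * (e / c))).
  by apply: ler_pM => //; rewrite ?mulr_ge0// ler_wpM2l.
have -> : n%:R * (C * s t) * (e / c) = e * s t * (n%:R * C / c) by ring.
by rewrite ler_piMr ?mulr_ge0 ?(ltW e0)// ler_pdivrMr// mul1r lerDl.
Qed.

Lemma osm_sdiff n q (G : 'rV[R]_n -> 'rV[R]_q) y0 H (ya yb : T -> 'rV[R]_n) :
  sdiff G y0 H -> ya @ F --> y0 -> yb @ F --> y0 -> obig (fun t => ya t - yb t) ->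
  osm (fun t => G (ya t) - G (yb t) - (ya t - yb t) *m H).
Proof.
move=> GH a0 b0 [C C0 abC] e e0.
have pc : (fun t => (ya t, yb t)) @ F --> (y0, y0) by exact: (cvg_pair a0 b0).
have GF : \forall t \near F, `|G (ya t) - G (yb t) - (ya t - yb t) *m H|
   <= e / C * `|ya t - yb t| by exact: (pc _ (GH _ (divr_gt0 e0 C0))).
move: GF abC; apply: filterS2 => t h1 h2; apply: le_trans h1 _.
rewrite -mulrA ler_wpM2l ?(ltW e0)//.
by rewrite -(ler_pM2l C0) mulrA mulfV ?mul1r ?gt_eqF.
Qed.

(** Lipschitz continuity of [Mf] suffices because the multipliers are small: the remainder splits
    into the increment of [l] times a vanishing change of [Mf], and the vanishing [lb] times an
    increment of [Mf] of order [s]. *)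
Lemma osm_lag n q c (D : 'rV[R]_n -> 'rV[R]_c) (Mf : 'rV[R]_n -> 'M[R]_(q, c)) y0 H
    (ya yb : T -> 'rV[R]_n) (la lb : T -> 'rV[R]_q) (L : R) :
  sdiff D y0 H -> 0 < L ->
  (\forall p \near (y0, y0), `|Mf p.1 - Mf p.2| <= L * `|p.1 - p.2|) ->
  ya @ F --> y0 -> yb @ F --> y0 -> lb @ F --> (0 : 'rV[R]_q) ->
  obig (fun t => ya t - yb t) -> obig (fun t => la t - lb t) ->
  osm (fun t => (D (ya t) + la t *m Mf (ya t)) - (D (yb t) + lb t *m Mf (yb t))
    - ((ya t - yb t) *m H + (la t - lb t) *m Mf y0)).
Proof.
move=> DH L0 ML a0 b0 lb0 yO lO.
have o1 := osm_sdiff DH a0 b0 yO.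
have Ma : (fun t => Mf (ya t) - Mf y0) @ F --> (0 : 'M[R]_(q, c)).
  have Mc := near_lip_cvg L0 ML.
  have -> : (0 : 'M[R]_(q, c)) = Mf y0 - Mf y0 by rewrite subrr.
  by apply: cvgB; [exact: (cvg_comp _ _ a0 Mc)|exact: cvg_cst].
have o2 := obig_mul_osm lO Ma.
have MO : obig (fun t => Mf (ya t) - Mf (yb t)).
  have pc : (fun t => (ya t, yb t)) @ F --> (y0, y0) by exact: (cvg_pair a0 b0).
  have h1 : \forall t \near F, `|Mf (ya t) - Mf (yb t)| <= L * `|ya t - yb t|.
    exact: (pc _ ML).
  have [C C0 yC] := yO; exists (L * C); first exact: mulr_gt0.
  move: h1 yC; apply: filterS2 => t h1 h2; apply: le_trans h1 _.
  by rewrite -mulrA ler_wpM2l// ltW.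
have o3 := osm_mul_obig lb0 MO.
apply: osm_eq (osmD (osmD o1 o2) o3) _; near=> t.
rewrite !mulmxBl !mulmxBr.
by apply/rowP => i; rewrite !mxE; ring.
Unshelve. all: by end_near. Qed.

End SmallO.

Section MatrixLimits.
Variable R : realType.

(** The small [o] calculus with constant scale 1. *)
Lemma cvg_mulmx T (F : set_system T) (FF : Filter F) m n p (f : T -> 'M[R]_(m, n))
    (g : T -> 'M[R]_(n, p)) (A : 'M[R]_(m, n)) (B : 'M[R]_(n, p)) :
  f @ F --> A -> g @ F --> B -> (fun t => f t *m g t) @ F --> A *m B.
Proof.
move=> fA gB.
have O : obig F (fun=> 1) f.
  exists (`|A| + 1); first by rewrite ltr_wpDl.
  have : \forall x \near F, `|A - f x| <= 1 by exact: (cvg_near fA ltr01).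
  apply: filterS => x h.
  by rewrite mulr1 -[f x](subrK A) addrC (le_trans (ler_normD _ _))// lerD2l distrC.
have gB0 : (fun t => g t - B) @ F --> (0 : 'M[R]_(n, p)).
  by rewrite -(subrr B); apply: cvgB => //; exact: cvg_cst.
have C : (fun t => f t *m (g t - B)) @ F --> (0 : 'M[R]_(m, p)).
  apply: (cvg_of_near (F := F)) => e e0.
  have := obig_mul_osm FF (fun=> ler01) O gB0 e0.
  by apply: filterS => x; rewrite mulr1 sub0r normrN.
have fB : (fun t => f t *m B) @ F --> A *m B by exact: cvg_mulmxr.
have -> : (fun t => f t *m g t) = (fun t => f t *m B + f t *m (g t - B)).
  by apply/funext => t; rewrite mulmxBr addrC subrK.
by rewrite -[A *m B]addr0; exact: (cvgD fB C).
Qed.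

Lemma cvg_trmx T (F : set_system T) (FF : Filter F) m n (f : T -> 'M[R]_(m, n)) (A : 'M[R]_(m, n)) :
  f @ F --> A -> (fun t => (f t)^T) @ F --> A^T.
Proof.
move=> fA; apply: cvg_of_near => e e0.
have : \forall t \near F, `|A - f t| <= e by exact: (cvg_near fA e0).
by apply: filterS => t; rewrite -[_ - _]trmxK norm_tr linearB.
Qed.

End MatrixLimits.

Lemma osm_congr (R : realType) T (Fil : set_system T) (s : T -> R) {FF : Filter Fil}
    (V : normedModType R) (a1 a2 b c1 c2 : T -> V) :
  osm Fil s (fun t => a1 t - a2 t - b t) ->
  (\forall t \near Fil, c1 t = a1 t) -> (\forall t \near Fil, c2 t = a2 t) ->
  osm Fil s (fun t => c1 t - c2 t - b t).
Proof.
move=> h e1 e2; apply: (osm_eq FF h); move: e1 e2.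
by apply: filterS2 => t -> ->.
Qed.

(** Derivative in [y], at [x0], of the two constraints [P y = 0] and [Q (F x + F'(x)(y - x)) = 0];
    its left kernel is the space of tangent vectors of the composite manifold. *)
Definition kktC (R : realType) (d m p q : nat) (J0 : 'M[R]_(d, m)) (JP : 'M[R]_(d, p)) (JQ : 'M[R]_(m, q)) :
  'M[R]_(d, p + q) := row_mx JP (J0 *m JQ).

(** Hessian in [y] of the Lagrangian of the prox-linear subproblem. The curvature of [F] is absent
    because the model is affine in [y]. *)
Definition kkt_hess (R : realType) (d m : nat) (J0 : 'M[R]_(d, m)) (Hr : 'M[R]_d) (Hh : 'M[R]_m) (mu : R) : 'M[R]_d :=
  J0 *m Hh *m J0^T + Hr + mu^-1%:M.

Definition kkt_mx (R : realType) (d p q : nat) (M2 : 'M[R]_d) (C : 'M[R]_(d, p + q)) : 'M[R]_(d + (p + q)) :=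
  block_mx M2 C C^T 0.

Lemma eq3_identity (R : realType) (d m q : nat) (dS : 'rV[R]_d) (dz : 'rV[R]_m)
    (J0 : 'M[R]_(d, m)) (JQ : 'M[R]_(m, q)) :
  - (0 - 0 - dz *m JQ + (dz - dS *m J0) *m JQ) = dS *m (J0 *m JQ).
Proof. by rewrite mulmxBl mulmxA subrr sub0r addrA addNr sub0r opprK. Qed.

(** The left-hand side combines the errors of the linearized equations for the subgradient of [r],
    for [W *m ('J F x)^T], for [W] and for the model point; eliminating the increments of [W] and of
    the model point leaves the first block row of the KKT system. *)
Lemma kkt_identity (R : realType) (d m p q : nat) (mu : R) (dS dx : 'rV[R]_d)
    (dl : 'rV[R]_p) (dk : 'rV[R]_q) (dz dW : 'rV[R]_m) (A B : 'rV[R]_d)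
    (J0 : 'M[R]_(d, m)) (JP : 'M[R]_(d, p)) (JQ : 'M[R]_(m, q))
    (Hr K : 'M[R]_d) (Hh : 'M[R]_m) :
  - ((B - A - mu^-1 *: (dS - dx) - (dS *m Hr + dl *m JP^T))
      + (A - B - (dx *m K + dW *m J0^T)))
    - (dW - (dz *m Hh + dk *m JQ^T)) *m J0^T - (dz - dS *m J0) *m (Hh *m J0^T)
  = dS *m kkt_hess J0 Hr Hh mu + dl *m JP^T + dk *m (J0 *m JQ)^T - dx *m (mu^-1%:M - K).
Proof.
rewrite /kkt_hess trmx_mul !mulmxDr !mulmxN !mul_mx_scalar !mulmxBl !mulmxDl !mulmxA.
move: (dW *m J0^T) (dz *m Hh *m J0^T) (dk *m _ *m _) (dx *m K) (dl *m _) (dS *m Hr)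
  (dS *m J0 *m Hh *m J0^T) => *.
by apply/rowP => i; rewrite !mxE; ring.
Qed.

(** * Linearization of the KKT system between two points *)

Section KKTdiff.
Variable R : realType.
Variables (d m p q : nat) (F : 'rV[R]_d -> 'rV[R]_m) (mu : R) (x0 : 'rV[R]_d).
Variables (w0 : 'rV[R]_m) (S : 'rV[R]_d -> 'rV[R]_d) (W : 'rV[R]_d -> 'rV[R]_m).
Variables (l : 'rV[R]_d -> 'rV[R]_p) (k : 'rV[R]_d -> 'rV[R]_q).
Variables (P : 'rV[R]_d -> 'rV[R]_p) (Q : 'rV[R]_m -> 'rV[R]_q).
Variables (Dr : 'rV[R]_d -> 'rV[R]_d) (Dh : 'rV[R]_m -> 'rV[R]_m).
Variables (Hr : 'M[R]_d) (Hh : 'M[R]_m) (K : 'M[R]_d).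
Let J0 := 'J F x0.
Let JP := 'J P x0.
Let JQ := 'J Q (F x0).
Hypotheses (cF : Cp 2 F) (cP : Cp 2 P) (cQ : Cp 2 Q).
Hypotheses (Drs : sdiff Dr x0 Hr) (Dhs : sdiff Dh (F x0) Hh)
  (Ks : sdiff (fun x => w0 *m ('J F x)^T) x0 K).
Hypotheses (Sx0 : S @ x0 --> x0) (Wx0 : W @ x0 --> w0)
  (lx0 : l @ x0 --> (0 : 'rV[R]_p)) (kx0 : k @ x0 --> (0 : 'rV[R]_q)).
Hypothesis eqv : \forall x \near x0,
  - (W x *m ('J F x)^T) - mu^-1 *: (S x - x) + w0 *m J0^T
  = Dr (S x) + l x *m ('J P (S x))^T.
Hypothesis eqw : \forall x \near x0,
  W x - w0 = Dh (model F x (S x)) + k x *m ('J Q (model F x (S x)))^T.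
Hypothesis eqP : \forall x \near x0, P (S x) = 0.
Hypothesis eqQ : \forall x \near x0, Q (model F x (S x)) = 0.

Let Km := kkt_mx (kkt_hess J0 Hr Hh mu) (kktC J0 JP JQ).

Let T := ('rV[R]_d * 'rV[R]_d)%type.
Let Fil : set_system T := nbhs (x0, x0).
Let FF : Filter Fil := nbhs_filter (x0, x0).
Let dx (t : T) := t.1 - t.2.
Let dS (t : T) := S t.1 - S t.2.
Let dl (t : T) := l t.1 - l t.2.
Let dk (t : T) := k t.1 - k t.2.
(** The unknowns [S], [l] and [k] enter the scale together with [x]; the increment of [W] is bounded
    afterwards through [eqw]. *)
Let s (t : T) := `|dx t| + `|dS t| + `|dl t| + `|dk t|.
Let z x := model F x (S x).

Let s0 t : 0 <= s t. Proof. by rewrite /s !addr_ge0. Qed.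

Let xO : obig Fil s dx.
Proof. by exists 1 => //; apply: nearW => t; rewrite mul1r /s -!addrA lerDl !addr_ge0. Qed.
Let SO : obig Fil s dS.
Proof.
exists 1 => //; apply: nearW => t; rewrite mul1r /s [`|dx t| + _]addrC -!addrA lerDl.
by rewrite !addr_ge0.
Qed.
Let lO : obig Fil s dl.
Proof.
exists 1 => //; apply: nearW => t; rewrite mul1r /s addrAC addrC lerDl.
by rewrite !addr_ge0.
Qed.
Let kO : obig Fil s dk.
Proof. by exists 1 => //; apply: nearW => t; rewrite mul1r /s addrC lerDl !addr_ge0. Qed.

Let c1 : (fun t : T => t.1) @ Fil --> x0. Proof. exact: cvg_fst. Qed.
Let c2 : (fun t : T => t.2) @ Fil --> x0. Proof. exact: cvg_snd. Qed.
Let at1 (V : normedModType R) (f : 'rV[R]_d -> V) (v : V) : f @ x0 --> v ->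
  (fun t : T => f t.1) @ Fil --> v.
Proof. by move=> fv; exact: (cvg_comp _ _ c1 fv). Qed.
Let at2 (V : normedModType R) (f : 'rV[R]_d -> V) (v : V) : f @ x0 --> v ->
  (fun t : T => f t.2) @ Fil --> v.
Proof. by move=> fv; exact: (cvg_comp _ _ c2 fv). Qed.

Let jacT_lip n r (G : 'rV[R]_n -> 'rV[R]_r) (y : 'rV[R]_n) : Cp 2 G -> exists2 L : R, 0 < L &
  \forall t \near (y, y), `|('J G t.1)^T - ('J G t.2)^T| <= L * `|t.1 - t.2|.
Proof.
move=> cG; have [L L0 HL] := Cp2_jacobian_lip y cG; exists L => //.
apply: filterS HL => t h.
have -> : ('J G t.1)^T - ('J G t.2)^T = ('J G t.1 - 'J G t.2)^T by rewrite linearB.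
by rewrite norm_tr.
Qed.

Let zc : z @ x0 --> F x0.
Proof.
have Fc := sdiff_cvg (Cp1_sdiff x0 (Cp2_Cp1 cF)).
have Jc := Cp2_jacobian_cvg cF (x := x0).
have S0 : (fun x => S x - x) @ x0 --> (0 : 'rV[R]_d).
  by rewrite -(subrr x0); exact: (cvgB Sx0 (@cvg_id _ (nbhs x0))).
have := cvgD Fc (cvg_mulmx (nbhs_filter x0) S0 Jc); rewrite mul0mx addr0; exact.
Qed.

(** In [F x + F'(x)(S x - x)] the increment of [F] and that of [- x] cancel to first order, so only
    the increment of [S] survives. Here [S x - x] plays the role of the vanishing multiplier in
    [osm_lag]. *)
Let dz_o : osm Fil s (fun t => (z t.1 - z t.2) - dS t *m J0).
Proof.
have [L L0 HL] := Cp2_jacobian_lip x0 cF.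
have lb0 : (fun t : T => S t.2 - t.2) @ Fil --> (0 : 'rV[R]_d).
  by rewrite -(subrr x0); apply: cvgB => //; exact: at2.
have lO' : obig Fil s (fun t => (S t.1 - t.1) - (S t.2 - t.2)).
  have : obig Fil s (fun t => dS t - dx t) by apply: obigD => //; exact: obigN.
  move=> [C C0 HC]; exists C => //; apply: filterS HC => t.
  suff -> : (S t.1 - t.1) - (S t.2 - t.2) = dS t - dx t by [].
  by rewrite /dS /dx; apply/rowP => i; rewrite !mxE; ring.
have := osm_lag FF s0 (Cp1_sdiff x0 (Cp2_Cp1 cF)) L0 HL c1 c2 lb0 xO lO'.
move=> h; apply: (osm_eq FF h); apply: nearW => t.
rewrite /z /model /dS /J0.
move: ('J F t.1) ('J F t.2) ('J F x0) => A B C; rewrite !mulmxBl.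
by apply/rowP => i; rewrite !mxE; ring.
Qed.

Let zO : obig Fil s (fun t => z t.1 - z t.2).
Proof. by apply: (obig_osm FF dz_o); exact: obig_mulmxr. Qed.

Let dW_o : osm Fil s (fun t => (W t.1 - W t.2) -
  ((z t.1 - z t.2) *m Hh + dk t *m JQ^T)).
Proof.
have [L L0 HL] := jacT_lip (F x0) cQ.
have := osm_lag (Mf := fun y => ('J Q y)^T) FF s0 Dhs L0 HL (at1 zc) (at2 zc) (at2 kx0) zO kO.
move=> h.
have e1 : \forall t \near Fil, W t.1 - w0 = Dh (z t.1) + k t.1 *m ('J Q (z t.1))^T.
  exact: near_fst eqw.
have e2 : \forall t \near Fil, W t.2 - w0 = Dh (z t.2) + k t.2 *m ('J Q (z t.2))^T.
  exact: near_snd eqw.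
have h2 := osm_congr (FF := FF) h e1 e2.
apply: (osm_eq FF h2); apply: nearW => t.
by congr (_ - _); rewrite opprB addrA subrK.
Qed.

Let WO : obig Fil s (fun t => (W t.1 - w0) - (W t.2 - w0)).
Proof.
have : obig Fil s (fun t => W t.1 - W t.2).
  by apply: (obig_osm FF dW_o); apply: obigD => //; exact: obig_mulmxr.
by move=> [C C0 HC]; exists C => //; apply: filterS HC => t; rewrite opprB addrA subrK.
Qed.

(** [W] is split as [w0 + (W - w0)]: the first part contributes the curvature [K] of [<w0, F>], and
    the second vanishes at [x0], as [osm_lag] requires. *)
Let dWJ_o : osm Fil s (fun t => W t.1 *m ('J F t.1)^T - W t.2 *m ('J F t.2)^T -
  (dx t *m K + (W t.1 - W t.2) *m J0^T)).
Proof.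
have [L L0 HL] := jacT_lip x0 cF.
have W0 : (fun t : T => W t.2 - w0) @ Fil --> (0 : 'rV[R]_m).
  by rewrite -(subrr w0); apply: cvgB; [exact: at2|exact: cvg_cst].
have := osm_lag (Mf := fun y => ('J F y)^T) FF s0 Ks L0 HL c1 c2 W0 xO WO.
move=> h; apply: (osm_eq FF h); apply: nearW => t.
rewrite /dx /J0.
move: ('J F t.1) ('J F t.2) ('J F x0) (W t.1) (W t.2) => A' B' C' W1 W2.
move: (A'^T) (B'^T) (C'^T) => A B C; rewrite !mulmxBl; move: (w0 *m A) (w0 *m B) (w0 *m C) (W1 *m A) (W2 *m B) (W1 *m C) (W2 *m C)
  (t.1 *m K) (t.2 *m K) => *.
by apply/rowP => i; rewrite !mxE; ring.
Qed.

Let dv_o : osm Fil s (fun t =>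
  (W t.2 *m ('J F t.2)^T - W t.1 *m ('J F t.1)^T) - mu^-1 *: (dS t - dx t)
  - (dS t *m Hr + dl t *m JP^T)).
Proof.
have [L L0 HL] := jacT_lip x0 cP.
have := osm_lag (Mf := fun y => ('J P y)^T) FF s0 Drs L0 HL (at1 Sx0) (at2 Sx0) (at2 lx0) SO lO.
move=> h.
have e1 : \forall t \near Fil, - (W t.1 *m ('J F t.1)^T) - mu^-1 *: (S t.1 - t.1) + w0 *m J0^T
  = Dr (S t.1) + l t.1 *m ('J P (S t.1))^T.
  exact: near_fst eqv.
have e2 : \forall t \near Fil, - (W t.2 *m ('J F t.2)^T) - mu^-1 *: (S t.2 - t.2) + w0 *m J0^T
  = Dr (S t.2) + l t.2 *m ('J P (S t.2))^T.
  exact: near_snd eqv.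
have h2 := osm_congr (FF := FF) h e1 e2.
apply: (osm_eq FF h2); apply: nearW => t.
congr (_ - _); rewrite /dS /dx.
move: (W t.1 *m _) (W t.2 *m _) (w0 *m _) => A B C.
by apply/rowP => i; rewrite !mxE; ring.
Qed.

Let N := mu^-1%:M - K.
Let M2 := kkt_hess J0 Hr Hh mu.

Let eq1 : osm Fil s (fun t => dS t *m M2 + dl t *m JP^T + dk t *m (J0 *m JQ)^T - dx t *m N).
Proof.
have h := osmB FF (osmB FF (osmN FF (osmD FF dv_o dWJ_o)) (osm_mulmxr FF J0^T dW_o))
  (osm_mulmxr FF (Hh *m J0^T) dz_o).
apply: (osm_eq FF h); apply: nearW => t.
exact: kkt_identity.
Qed.

Let eq2 : osm Fil s (fun t => dS t *m JP).
Proof.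
have h := osm_sdiff FF (Cp1_sdiff x0 (Cp2_Cp1 cP)) (at1 Sx0) (at2 Sx0) SO.
apply: (osm_eq FF (osmN FF h)).
have e1 : \forall t \near Fil, P (S t.1) = 0 by exact: near_fst eqP.
have e2 : \forall t \near Fil, P (S t.2) = 0 by exact: near_snd eqP.
by move: e1 e2; apply: filterS2 => t -> ->; rewrite subrr sub0r opprK.
Qed.

Let eq3 : osm Fil s (fun t => dS t *m (J0 *m JQ)).
Proof.
have h := osm_sdiff FF (Cp1_sdiff (F x0) (Cp2_Cp1 cQ)) (at1 zc) (at2 zc) zO.
have e0 : \forall x \near x0, 0 = Q (z x) by apply: filterS eqQ => x ->.
have e1 : \forall t \near Fil, 0 = Q (z t.1) by exact: near_fst e0.
have e2 : \forall t \near Fil, 0 = Q (z t.2) by exact: near_snd e0.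
have h2 := osm_congr (FF := FF) h e1 e2.
apply: (osm_eq FF (osmN FF (osmD FF h2 (osm_mulmxr FF JQ dz_o)))); apply: nearW => t.
exact: eq3_identity.
Qed.

Lemma norm_lsubmx a b c (A : 'M[R]_(a, b + c)) : `|lsubmx A| <= `|A|.
Proof. by apply: norm_le_coord => // i j; rewrite mxE coord_le_norm. Qed.

Lemma norm_rsubmx a b c (A : 'M[R]_(a, b + c)) : `|rsubmx A| <= `|A|.
Proof. by apply: norm_le_coord => // i j; rewrite mxE coord_le_norm. Qed.

Lemma norm_row_mx a b c (A : 'M[R]_(a, b)) (B : 'M[R]_(a, c)) : `|row_mx A B| <= `|A| + `|B|.
Proof.
apply: norm_le_coord => [|i j]; first exact: addr_ge0.
rewrite mxE; case: (fintype.split j) => j'; first by rewrite (le_trans (coord_le_norm _ _ _))// lerDl.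
by rewrite (le_trans (coord_le_norm _ _ _))// lerDr.
Qed.

Lemma osm_row_mx (s' : T -> R) a b c (f : T -> 'M[R]_(a, b)) (g : T -> 'M[R]_(a, c)) :
  osm Fil s' f -> osm Fil s' g -> osm Fil s' (fun t => row_mx (f t) (g t)).
Proof.
move=> fo go e e0; have e20 : 0 < e / 2 by rewrite divr_gt0.
move: (fo _ e20) (go _ e20); apply: filterS2 => t h1 h2.
apply: le_trans (norm_row_mx _ _) _; lra.
Qed.

(** The inverse matrix expresses the increments of all unknowns through [dx], up to an error small
    relative to a scale that contains those increments. The scale must be shown comparable to [dx]
    before the error counts as [o(dx)]. *)
Lemma kkt_sdiff : Km \in unitmx -> sdiff S x0 (N *m ulsubmx (invmx Km)).
Proof.
move=> Ku.
pose X t := row_mx (dS t) (row_mx (dl t) (dk t)).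
pose Y t := row_mx (dx t *m N) 0 *m invmx Km.
have XK : osm Fil s (fun t => X t - Y t).
  have h := osm_row_mx eq1 (osm_row_mx eq2 eq3).
  apply: (osm_eq FF (osm_mulmxr FF (invmx Km) h)); apply: nearW => t.
  rewrite /X /Y -[row_mx (dS t) _](mulmxK Ku) -mulmxBl; congr (_ *m _).
  rewrite /Km /kkt_mx mul_row_block mulmx0 addr0 /kktC tr_row_mx mul_row_col mul_mx_row.
  by rewrite opp_row_mx add_row_mx oppr0 addr0 addrA.
pose C := `|invmx Km| * (d%:R * `|N|) * (d + (p + q))%:R + 1.
have C0 : 0 < C by rewrite ltr_wpDl// !mulr_ge0.
have YC t : `|Y t| <= C * `|dx t|.
  apply: le_trans (mulmx_norm_le _ _) _.
  have h := norm_row_mx (dx t *m N) (0 : 'M[R]_(1, p + q)); rewrite normr0 addr0 in h.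
  have h2 := le_trans h (mulmx_norm_le _ _).
  rewrite mulrAC mulrC; apply: le_trans (ler_pM _ _ h2 (lexx _)) _ => //.
  have -> : d%:R * `|dx t| * `|N| * ((d + (p + q))%:R * `|invmx Km|) = (C - 1) * `|dx t|.
    by rewrite /C; ring.
  by rewrite ler_wpM2r// gerBl.
(* Three unknowns, each bounded by [|X|] with error [s / 6], give [s <= (1 + 3 C) |dx| + s / 2]. *)
pose D := 2 * (1 + 3 * C); have D0 : 0 < D by rewrite mulr_gt0// addr_gt0// mulr_gt0.
have sD : \forall t \near Fil, s t <= D * `|dx t|.
  have e6 : 0 < 6^-1 :> R by rewrite invr_gt0.
  have := XK _ e6; apply: filterS => t h.
  have hX : `|X t| <= C * `|dx t| + 6^-1 * s t.
    rewrite -[X t](subrK (Y t)) addrC; apply: le_trans (ler_normD _ _) _; exact: lerD.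
  have h1 : `|dS t| <= `|X t| by have := norm_lsubmx (X t); rewrite row_mxKl.
  have h0 : `|row_mx (dl t) (dk t)| <= `|X t| by have := norm_rsubmx (X t); rewrite row_mxKr.
  have h2 : `|dl t| <= `|X t|.
    by apply: le_trans h0; have := norm_lsubmx (row_mx (dl t) (dk t)); rewrite row_mxKl.
  have h3 : `|dk t| <= `|X t|.
    by apply: le_trans h0; have := norm_rsubmx (row_mx (dl t) (dk t)); rewrite row_mxKr.
  have sE : s t = `|dx t| + `|dS t| + `|dl t| + `|dk t| by [].
  rewrite /D; lra.
move=> e e0; have := XK _ (divr_gt0 e0 D0); move: sD; apply: filterS2 => t h1 h2.
have -> : S t.1 - S t.2 - (t.1 - t.2) *m (N *m ulsubmx (invmx Km)) = lsubmx (X t - Y t).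
  rewrite linearB/= row_mxKl; congr (_ - _).
  rewrite /Y -{2}[invmx Km]vsubmxK mul_row_col mul0mx addr0 mulmxA /ulsubmx.
  by apply/matrixP => i j; rewrite !mxE; apply: eq_bigr => a _; rewrite !mxE.
apply: le_trans (norm_lsubmx _) _; apply: le_trans h2 _.
by rewrite -mulrA ler_wpM2l ?(ltW e0)// ler_pdivrMl.
Qed.

End KKTdiff.

(** * Lipschitz graphs are null sets *)

Section NullSets.
Variable R : realType.

Lemma lebesgue_outer_ge0 n (A : set 'rV[R]_n) : (0 <= lebesgue_outer A)%E.
Proof.
apply: le_ereal_inf_tmp => _ [D [a [b [ab _ ->]]]].
apply: esum_ge0 => k _; rewrite lee_fin; apply: prodr_ge0 => i _.
by rewrite subr_ge0.
Qed.

Lemma lebesgue_outer_finite_cubes n (A : set 'rV[R]_n) (K : nat)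
    (c : nat -> 'rV[R]_n) (e : R) : 0 <= e ->
  (forall x, A x -> exists2 k, (k < K)%N & `|x - c k| <= e) ->
  (lebesgue_outer A <= (K%:R * (2 * e) ^+ n)%:E)%E.
Proof.
move=> e0 HA.
pose a k := c k - const_mx e : 'rV[R]_n; pose b k := c k + const_mx e : 'rV[R]_n.
have ba k i : b k ord0 i - a k ord0 i = 2 * e by rewrite !mxE; ring.
apply: ereal_inf_lbound; exists `I_K, a, b; split.
- by move=> k i; rewrite -subr_ge0 ba mulr_ge0.
- move=> x /HA[k kK xk]; exists k => // i.
  have := le_trans (coord_le_norm _ ord0 i) xk.
  rewrite !mxE ler_norml => /andP[h1 h2]; apply/andP; split; lra.
- have E k : \prod_(i < n) (b k ord0 i - a k ord0 i) = (2 * e) ^+ n.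
    rewrite (eq_bigr (fun=> 2 * e)) ?prodr_const ?card_ord//.
  rewrite esum_fset//; last first.
    by move=> k _; rewrite E lee_fin exprn_ge0// mulr_ge0.
  rewrite -fsbig_ord (eq_bigr (fun=> ((2 * e) ^+ n)%:E)); last by move=> k _; rewrite E.
  by rewrite sumEFin sumr_const card_ord mulr_natl.
Qed.

Lemma pigeonhole_cell (x L : R) (N K : nat) : 0 < L -> `|x| <= L -> (0 < N)%N ->
  2 * L * N%:R < K%:R -> exists i : 'I_K, i%:R <= (x + L) * N%:R < i%:R + 1.
Proof.
move=> L0; rewrite ler_norml => /andP[x1 x2] N0 K0.
have N0' : 0 < N%:R :> R by rewrite ltr0n.
have p : 0 <= (x + L) * N%:R by rewrite mulr_ge0//; lra.
have /andP[t1 t2] := truncn_itv p.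
have tK : (Num.truncn ((x + L) * N%:R) < K)%N.
  rewrite truncn_lt_nat//; apply: le_lt_trans K0; rewrite ler_wpM2r//; lra.
by exists (Ordinal tK); rewrite t1/= natr1.
Qed.

Lemma cell_volume_pow (a b k : R) n : b != 0 -> (0 < n)%N ->
  (a * b) ^+ n.-1 * (2 * (k / b)) ^+ n = a ^+ n.-1 * (2 * k) ^+ n / b.
Proof.
case: n => // n b0 _; rewrite [2 * (k / b)]mulrA exprMn [(2 * k / b) ^+ _]exprMn.
have bn : b ^+ n != 0 by rewrite expf_neq0.
rewrite exprVn [b ^+ n.+1]exprS /=; move: (a ^+ n) ((2 * k) ^+ n.+1) (b ^+ n) bn => x y z z0.
by field; rewrite b0.
Qed.

(* A set whose points are separated transversally to the direction u is a
   Lipschitz graph over the hyperplane x_i0 = 0, hence is covered by about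
   N^(n-1) cubes of side O(1/N). *)
Lemma lebesgue_outer_graph n (A : set 'rV[R]_n) (i0 : 'I_n) (u : 'rV[R]_n) (M tau : R) :
  u ord0 i0 = 1 -> 0 < tau -> (forall x, A x -> `|x| <= M) ->
  (forall x y, A x -> A y ->
     tau * `|x ord0 i0 - y ord0 i0| <= `|(x - y) - (x ord0 i0 - y ord0 i0) *: u|) ->
  lebesgue_outer A = 0%E.
Proof.
move=> ui0 tau0 AM Au.
apply/eqP; rewrite eq_le lebesgue_outer_ge0 andbT.
(* Projection along [u] onto the hyperplane [x_i0 = 0], as [u] has coordinate 1 there; the cells are
   cut in the other [n - 1] coordinates. *)
pose h (x : 'rV[R]_n) : 'rV[R]_n := x - x ord0 i0 *: u.
pose L : R := `|M| * (1 + `|u|) + 1.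
have L0 : 0 < L by rewrite ltr_wpDl// mulr_ge0// addr_ge0.
have hL x : A x -> forall j, `|h x ord0 j| <= L.
  move=> Ax j; apply: le_trans (coord_le_norm _ _ _) _.
  apply: le_trans (ler_normB _ _) _; rewrite normrZ.
  have xM := le_trans (AM x Ax) (ler_norm M).
  have := le_trans (coord_le_norm x ord0 i0) xM => xi.
  have := ler_wpM2r (normr_ge0 u) xi.
  rewrite /L; lra.
(* In one cell the projections differ by at most [1 / N], hence the [i0] coordinates by at most
   [1 / (N tau)], hence the points by at most [kap / N]. *)
pose kap : R := `|u| / tau + 1.
have kap0 : 0 < kap by rewrite ltr_wpDl// divr_ge0// ltW.
pose K0 := (Num.truncn (2 * L)).+1.
have K0L : 2 * L < K0%:R by apply: truncnS_gt.
have cover (N : nat) : (0 < N)%N ->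
    (lebesgue_outer A <= (((K0 * N) ^ n.-1)%:R * (2 * (kap / N%:R)) ^+ n)%:E)%E.
  move=> N0; have N0' : 0 < N%:R :> R by rewrite ltr0n.
  pose K := (K0 * N)%N.
  have KN : 2 * L * N%:R < K%:R by rewrite natrM ltr_pM2r.
  pose cellP x (g : {ffun 'I_n.-1 -> 'I_K}) :=
    forall j, (g j)%:R <= (h x ord0 (lift i0 j) + L) * N%:R < (g j)%:R + 1.
  have cell x : A x -> exists g, cellP x g.
    move=> Ax.
    have H j := pigeonhole_cell L0 (hL x Ax (lift i0 j)) N0 KN.
    have [f Hf] := choice H.
    by exists [ffun j => f j] => j; rewrite ffunE.
  pose G := #|{ffun 'I_n.-1 -> 'I_K}|.
  pose c (k : nat) : 'rV[R]_n := xget 0 [set x | A x /\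
     exists2 g : {ffun 'I_n.-1 -> 'I_K}, enum_rank g = k :> nat & cellP x g].
  have -> : ((K0 * N) ^ n.-1)%N = G by rewrite /G card_ffun !card_ord.
  apply: (@lebesgue_outer_finite_cubes _ _ _ c); first by rewrite divr_ge0 ?ltW.
  move=> x Ax; have [g xg] := cell x Ax.
  exists (enum_rank g); first exact: ltn_ord.
  set y := c _.
  have [Ay [g' gg' yg']] : A y /\ exists2 g' : {ffun 'I_n.-1 -> 'I_K},
      enum_rank g' = enum_rank g :> nat & cellP y g'.
    apply: (@xgetPex _ 0 [set x | A x /\ exists2 g' : {ffun 'I_n.-1 -> 'I_K},
      enum_rank g' = enum_rank g :> nat & cellP x g']).
    by exists x; split => //; exists g.
  have {gg'} : g' = g by apply: enum_rank_inj; exact: val_inj.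
  move=> gg'; rewrite {g'}gg' in yg'.
  have hxy : `|h x - h y| <= N%:R^-1.
    apply: norm_le_coord => [|i j]; first by rewrite invr_ge0 ltW.
    rewrite (ord1 i) mxE [(- h y) _ _]mxE.
    have [->|ji] := eqVneq j i0.
      by rewrite /h !mxE ui0 !mulr1 !subrr normr0 invr_ge0 ltW.
    have [j' ->] : exists j', j = lift i0 j'.
      by have := unlift_some; case: (unliftP i0 j) ji => [j' ->|->]; [exists j'|rewrite eqxx].
    have /andP[a1 a2] := xg j'; have /andP[b1 b2] := yg' j'.
    rewrite -(ler_pM2r N0') mulVf ?gt_eqF// -{1}(gtr0_norm N0') -normrM.
    rewrite ler_norml; apply/andP; split; lra.
  have ci : tau * `|x ord0 i0 - y ord0 i0| <= `|h x - h y|.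
    have -> : h x - h y = (x - y) - (x ord0 i0 - y ord0 i0) *: u; last exact: Au.
    by rewrite /h scalerBl; apply/rowP => j; rewrite !mxE; ring.
  have xy : x - y = (h x - h y) + (x ord0 i0 - y ord0 i0) *: u.
    by rewrite /h scalerBl; apply/rowP => j; rewrite !mxE; ring.
  rewrite xy; apply: le_trans (ler_normD _ _) _; rewrite normrZ.
  have ci' : `|x ord0 i0 - y ord0 i0| <= N%:R^-1 / tau.
    by rewrite ler_pdivlMr// mulrC; exact: le_trans hxy.
  have := ler_wpM2r (normr_ge0 u) ci'.
  have -> : kap / N%:R = N%:R^-1 / tau * `|u| + N%:R^-1 by rewrite /kap; ring.
  lra.
apply/lee_addgt0Pr => e e0; rewrite add0e.
have n0 : (0 < n)%N by exact: leq_ltn_trans (leq0n i0) (ltn_ord i0).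
pose C : R := K0%:R ^+ n.-1 * (2 * kap) ^+ n.
have C0 : 0 <= C by rewrite mulr_ge0// exprn_ge0// mulr_ge0// ltW.
(* The cover of mesh [1 / N] has total volume [C / N]. *)
pose N := (Num.truncn (C / e)).+1.
have CN : C / e < N%:R by exact: truncnS_gt.
apply: le_trans (cover N isT) _; rewrite lee_fin.
have NN : N%:R != 0 :> R by rewrite pnatr_eq0.
have -> : ((K0 * N) ^ n.-1)%:R * (2 * (kap / N%:R)) ^+ n = C / N%:R.
  by rewrite natrX natrM /C; exact: cell_volume_pow.
by rewrite ler_pdivrMr ?ltr0n// mulrC -ler_pdivrMr// ltW.
Qed.

End NullSets.

(** * Quadratic forms that grow along pairs of orbits *)

Section Escape.
Variable R : realType.

Lemma qform_bound n (V : 'M[R]_n) (a b : 'rV[R]_n) :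
  `|dotp (a *m V) b| <= (n%:R * (n%:R * `|V|) + 1) * (`|a| * `|b|).
Proof.
apply: le_trans (dotp_le _ _) _.
have h := ler_wpM2l (ler0n R n) (mulmx_norm_le a V).
apply: le_trans (ler_wpM2r (normr_ge0 b) h) _.
have -> : n%:R * (n%:R * `|a| * `|V|) * `|b| = n%:R * (n%:R * `|V|) * (`|a| * `|b|) by ring.
by rewrite ler_wpM2r ?mulr_ge0// lerDl.
Qed.

(** The constant is the minimum of the form on the unit sphere of the sup norm, which is compact. *)
Lemma posdef_bound n (B : 'M[R]_n) :
  (forall z : 'rV[R]_n, z != 0 -> 0 < dotp (z *m B) z) ->
  exists2 e : R, 0 < e & forall z : 'rV[R]_n, e * `|z| ^+ 2 <= dotp (z *m B) z.
Proof.
move=> B0.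
pose K := [set z : 'rV[R]_n | `|z| = 1].
have [K1|K0] := pselect (K !=set0); last first.
  exists 1 => // z; have [->|z0] := eqVneq z 0.
    by rewrite normr0 expr0n mulr0 mul0mx dotp0l.
  exfalso; apply: K0; exists (`|z|^-1 *: z).
  by rewrite /K /= normrZ gtr0_norm ?invr_gt0 ?normr_gt0// mulVf// normr_eq0.
have cK : compact K.
  apply: (@subclosed_compact _ K [set z : 'rV[R]_n | `|0 - z| <= 1]).
  - have -> : K = (fun z => `|z|) @^-1` [set 1] by [].
    apply: closed_comp; last exact: closed_eq.
    by move=> z _; exact: norm_continuous.
  - exact: compact_cball.
  - by move=> z; rewrite /K /= sub0r normrN => ->.
have cont : continuous (fun z : 'rV[R]_n => dotp (z *m B) z).
  move=> z; apply: (cvg_of_near (F := nbhs z)) => e e0.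
  pose c := (n%:R * (n%:R * `|B|) + 1) * (2 * `|z| + 1).
  have cB : 0 < n%:R * (n%:R * `|B|) + 1 by rewrite ltr_wpDl// !mulr_ge0.
  have c0 : 0 < c by rewrite mulr_gt0// ltr_wpDl// mulr_ge0.
  move: (near_dist z (ltr01 : 0 < 1 :> R)) (near_dist z (divr_gt0 e0 c0)).
  apply: filterS2 => y h1; rewrite ltr_pdivlMr// => h2.
  have E : dotp (z *m B) z - dotp (y *m B) y = dotp (z *m B) (z - y) + dotp ((z - y) *m B) y.
    by rewrite mulmxBl dotpBr dotpBl; ring.
  have y1 : `|y| <= `|z| + 1.
    by rewrite -[y](subrK z) addrC (le_trans (ler_normD _ _))// lerD2l distrC ltW.
  rewrite E; apply: le_trans (ler_normD _ _) _.
  have q1 := qform_bound B z (z - y); have q2 := qform_bound B (z - y) y.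
  have q3 : `|z - y| * `|y| <= `|z - y| * (`|z| + 1) by rewrite ler_wpM2l.
  have q4 := ler_wpM2l (ltW cB) q3.
  apply: le_trans (ltW h2); rewrite /c; lra.
have [z zK zmin] := EVT_min_rV K1 cK (continuous_subspaceT cont).
rewrite inE in zK.
have z0 : z != 0 by rewrite -normr_gt0 zK.
exists (dotp (z *m B) z); first exact: B0.
move=> y; have [->|y0] := eqVneq y 0.
  by rewrite normr0 expr0n mulr0 mul0mx dotp0l.
have y0' : 0 < `|y| by rewrite normr_gt0.
have := zmin (`|y|^-1 *: y); rewrite inE /K/= normrZ gtr0_norm ?invr_gt0// mulVf ?gt_eqF// => /(_ erefl).
rewrite -scalemxAl dotpZl dotpZr mulrA -invfM -expr2 => h.
by rewrite -ler_pdivlMr ?exprn_gt0// mulrC.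
Qed.

(** For a pair of orbits with difference [z] and [v z >= 0], one step increases [v] by at least
    [e / 2 * |z|^2]. Since [v z <= c * |z|^2], positivity of [v] keeps [z] away from 0, so [v] grows
    at least linearly, which a bounded neighbourhood excludes. *)
Lemma cone_escape n (T : 'rV[R]_n -> 'rV[R]_n) x0 (A V : 'M[R]_n) (gam : R) (u : 'rV[R]_n) :
  sdiff T x0 A -> 1 <= gam ->
  (forall z : 'rV[R]_n, z != 0 -> 0 < dotp (z *m (A *m V *m A^T - gam *: V)) z) ->
  0 < dotp (u *m V) u ->
  exists2 U : set 'rV[R]_n, nbhs x0 U &
    lebesgue_outer [set x | U x /\ forall k : nat, U (iter k T x)] = 0%E.
Proof.
move=> TA gam1 pd u0.
have [e e0 He] := posdef_bound pd.
pose v z := dotp (z *m V) z.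
pose c : R := n%:R * (n%:R * `|V|) + 1.
have c0 : 0 < c by rewrite ltr_wpDl// !mulr_ge0.
have vb a b : `|dotp (a *m V) b| <= c * (`|a| * `|b|) by exact: qform_bound.
have vD a b : v (a + b) = v a + dotp (a *m V) b + dotp (b *m V) a + v b.
  by rewrite /v mulmxDl dotpDl !dotpDr; ring.
pose a : R := n%:R * `|A| + 1.
have a0 : 0 < a by rewrite ltr_wpDl// mulr_ge0.
have aA (z : 'rV_n) : `|z *m A| <= a * `|z|.
  apply: le_trans (mulmx_norm_le _ _) _; rewrite mulrAC ler_wpM2r//.
  by rewrite lerDl.
have d0 : 0 < 2 * c * (2 * a + 1) by rewrite !mulr_gt0// addr_gt0// mulr_gt0.
(* The linearization error changes the form by at most [c (2 a + 1) eta |z|^2], using [eta <= 1] for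
   its square; this is to be half of the gap [e]. *)
pose eta := Num.min 1 (e / (2 * c * (2 * a + 1))).
have eta0 : 0 < eta by rewrite lt_min ltr01 divr_gt0.
have eta1 : eta <= 1 by rewrite ge_min lexx.
have etae : c * (2 * a + 1) * eta <= e / 2.
  have : eta <= e / (2 * c * (2 * a + 1)) by rewrite ge_min lexx orbT.
  rewrite ler_pdivlMr//; lra.
have step (z w : 'rV[R]_n) : `|w - z *m A| <= eta * `|z| -> 0 <= v z ->
    v z + e / 2 * `|z| ^+ 2 <= v w.
  move=> wz vz; set r := w - z *m A in wz.
  have wE : w = z *m A + r by rewrite /r addrC subrK.
  have h1 := He z.
  rewrite mulmxBr -scalemxAr dotpBl dotpZl !mulmxA dotp_mulmx trmxK in h1.
  rewrite wE vD.
  have b1 := vb (z *m A) r; have b2 := vb r (z *m A); have b3 := vb r r.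
  have zA := aA z; have z0 := normr_ge0 z; have r0 := normr_ge0 r.
  have k1 : `|z *m A| * `|r| <= a * eta * `|z| ^+ 2.
    have := ler_pM (normr_ge0 _) r0 zA wz; rewrite expr2; lra.
  have k2 : `|r| * `|r| <= eta * `|z| ^+ 2.
    have h := ler_pM r0 r0 wz wz; apply: le_trans h _.
    have -> : eta * `|z| * (eta * `|z|) = eta * (eta * `|z| ^+ 2) by ring.
    by rewrite ler_wpM2l ?(ltW eta0)// ler_piMl// exprn_ge0.
  have k1' := ler_wpM2l (ltW c0) k1; have k2' := ler_wpM2l (ltW c0) k2.
  rewrite [`|r| * `|z *m A|]mulrC in b2.
  have zz : 0 <= `|z| ^+ 2 by rewrite exprn_ge0.
  have k3 := ler_wpM2r zz etae.
  have gv : v z <= gam * v z by rewrite ler_peMl.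
  move: b1 b2 b3; rewrite !ler_norml => /andP[b1 _] /andP[b2 _] /andP[b3 _].
  rewrite -/(v (z *m A)) -/(v z) in h1; rewrite -/(v r) in b3.
  move: h1 b1 b2 b3 k1' k2' k3 gv; clear.
  move: (v (z *m A)) (v z) (v r) (dotp _ _) (dotp _ _) (`|z *m A| * `|r|) (`|r| * `|r|) (`|z| ^+ 2) => *.
  lra.
have [[B1 B2] /= [xB1 xB2] HB] := TA _ eta0.
have [d /= dpos dB] := (nbhs_ballP _ _).1 (filterI xB1 xB2).
pose U := ball x0 d; exists U; first exact: nbhsx_ballx.
set W := [set x | _].
have UT x y : U x -> U y -> `|T x - T y - (x - y) *m A| <= eta * `|x - y|.
  by move=> /dB[xx _] /dB[_ yy]; exact: (HB (x, y)).
have Ud x y : U x -> U y -> `|x - y| <= 2 * d.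
  rewrite /U -ball_normE/= => hx hy.
  have -> : x - y = (x0 - y) - (x0 - x) by apply/rowP => i; rewrite !mxE; ring.
  apply: le_trans (ler_normB _ _) _; lra.
have sep x y : W x -> W y -> x != y -> v (x - y) < 0.
  move=> [Ux Hx] [Uy Hy] xy; rewrite ltNge; apply/negP => vxy.
  pose z k := iter k T x - iter k T y.
  have zk k : 0 <= v (z k) -> v (z k) + e / 2 * `|z k| ^+ 2 <= v (z k.+1).
    by apply: step; exact: (UT _ _ (Hx k) (Hy k)).
  have nz : 0 < `|z 0%N| by rewrite /z /= normr_gt0 subr_eq0.
  (* [be] is the gain of the first step and [sg] a lower bound for the gain of each later one. *)
  pose be := e / 2 * `|z 0%N| ^+ 2.
  have be0 : 0 < be by rewrite mulr_gt0 ?divr_gt0// exprn_gt0.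
  pose sg := e / 2 * (be / c).
  have sg0 : 0 < sg by rewrite mulr_gt0 ?divr_gt0.
  have grow k : be + k%:R * sg <= v (z k.+1).
    elim: k => [|k IH].
      by rewrite mul0r addr0; apply: le_trans (zk 0%N vxy); rewrite lerDr.
    have bk : be <= v (z k.+1) by apply: le_trans IH; rewrite lerDl mulr_ge0// ltW.
    have vk : 0 <= v (z k.+1) by apply: le_trans bk; exact: ltW.
    apply: le_trans (zk _ vk).
    have : be / c <= `|z k.+1| ^+ 2.
      rewrite ler_pdivrMr// mulrC; apply: le_trans bk _.
      by apply: le_trans (ler_norm _) _; rewrite expr2; exact: vb.
    have e2 : 0 <= e / 2 by rewrite divr_ge0// ltW.
    move=> /(ler_wpM2l e2); rewrite -/sg -natr1; lra.
  have bound k : v (z k) <= c * (2 * d * (2 * d)).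
    apply: le_trans (ler_norm _) _; apply: le_trans (vb _ _) _.
    by rewrite ler_wpM2l ?(ltW c0)// ler_pM// Ud.
  pose k := (Num.truncn (c * (2 * d * (2 * d)) / sg)).+1.
  have kk : c * (2 * d * (2 * d)) / sg < k%:R by exact: truncnS_gt.
  rewrite ltr_pdivrMr// in kk.
  have := le_trans (grow k) (bound _); lra.
have [i0 ui0] : exists i0, u ord0 i0 != 0.
  apply: contrapT => H; have uz : u = 0.
    apply/rowP => i; rewrite mxE; apply/eqP; apply: contrapT => ui.
    by apply: H; exists i; apply/negP.
  by rewrite uz mul0mx dotp0l ltxx in u0.
pose u' := (u ord0 i0)^-1 *: u.
have vu' : 0 < v u'.
  rewrite /v -scalemxAl dotpZl dotpZr mulrA mulr_gt0// -expr2 exprn_even_gt0//=.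
  by rewrite invr_eq0.
have q0 : 0 < 2 * c * (2 * `|u'| + 1) by rewrite !mulr_gt0// ltr_wpDl// mulr_ge0.
(* A difference [s *: u' + r] with [|r| < tau * |s|] is so close to the line of [u'] that the form
   keeps at least half of [|s|^2 * v u'], contradicting [sep]. *)
pose tau := Num.min 1 (v u' / (2 * c * (2 * `|u'| + 1))).
have tau0 : 0 < tau by rewrite lt_min ltr01 divr_gt0.
have tau1 : tau <= 1 by rewrite ge_min lexx.
have tauv : c * (2 * `|u'| + 1) * tau <= v u' / 2.
  have : tau <= v u' / (2 * c * (2 * `|u'| + 1)) by rewrite ge_min lexx orbT.
  rewrite ler_pdivlMr//; lra.
apply: (@lebesgue_outer_graph _ _ _ i0 u' (`|x0| + d) tau) => //.
- by rewrite mxE mulVf.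
- move=> x [Ux _]; move: Ux; rewrite /U -ball_normE/= => Ux.
  by rewrite -[x](subrK x0) addrC (le_trans (ler_normD _ _))// lerD2l distrC ltW.
- move=> x y Wx Wy; rewrite leNgt; apply/negP.
  set s := x ord0 i0 - y ord0 i0; set r := (x - y) - s *: u' => rs.
  have s0 : 0 < `|s|.
    by have := le_lt_trans (normr_ge0 _) rs; rewrite pmulr_rgt0.
  have xy : x != y by apply: contraTneq s0 => xy; rewrite /s xy subrr normr0 ltxx.
  have := sep x y Wx Wy xy; apply/negP; rewrite -leNgt.
  have -> : x - y = s *: u' + r by rewrite /r [RHS]addrC subrK.
  rewrite vD.
  have -> : v (s *: u') = `|s| ^+ 2 * v u'.
    by rewrite /v -scalemxAl dotpZl dotpZr mulrA -expr2 real_normK ?num_real.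
  have b1 := vb (s *: u') r; have b2 := vb r (s *: u'); have b3 := vb r r.
  rewrite normrZ in b1 b2.
  have r0 := normr_ge0 r; have rs' := ltW rs.
  have k1 : `|s| * `|u'| * `|r| <= tau * `|u'| * `|s| ^+ 2.
    have h : 0 <= `|s| * `|u'| by rewrite mulr_ge0.
    have := ler_wpM2l h rs'; rewrite expr2; lra.
  have k2 : `|r| * `|r| <= tau * `|s| ^+ 2.
    have h := ler_pM r0 r0 rs' rs'; apply: le_trans h _.
    have -> : tau * `|s| * (tau * `|s|) = tau * (tau * `|s| ^+ 2) by ring.
    by rewrite ler_wpM2l ?(ltW tau0)// ler_piMl// exprn_ge0.
  have k1' := ler_wpM2l (ltW c0) k1; have k2' := ler_wpM2l (ltW c0) k2.
  rewrite [`|r| * (_ * _)]mulrC in b2.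
  have ss : 0 <= `|s| ^+ 2 by rewrite exprn_ge0.
  have k3 := ler_wpM2l ss tauv.
  have k4 : 0 <= `|s| ^+ 2 * v u' by rewrite mulr_ge0// ltW.
  move: b1 b2 b3; rewrite !ler_norml => /andP[b1 _] /andP[b2 _] /andP[b3 _].
  rewrite -/(v r) in b3.
  move: b1 b2 b3 k1' k2' k3 k4; clear.
  move: (dotp (s *: u' *m V) r) (dotp (r *m V) (s *: u')) (v r) (v u') => *.
  lra.
Qed.

End Escape.

(** * The unstable quadratic form *)

Section Unstable.
Variable R : realType.

Lemma unitmx_inj n (A : 'M[R]_n) : (forall v : 'rV[R]_n, v *m A = 0 -> v = 0) -> A \in unitmx.
Proof. by move=> H; rewrite -row_free_unit; apply/row_freeP/row_freeP; exact: inj_row_free. Qed.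

(** The characteristic polynomial has at most [n] roots and there are [n + 1] distinct candidates;
    the index [i.+2] keeps them strictly below [1 + s]. *)
Lemma exists_noneigenvalue n (B : 'M[R]_n) (s : R) : 0 < s ->
  exists g, [/\ 1 < g, g < 1 + s & B - g%:M \in unitmx].
Proof.
move=> s0.
pose f (i : nat) : R := 1 + s / (i.+2)%:R.
have f1 i : 1 < f i by rewrite ltrDl divr_gt0.
have f2 i : f i < 1 + s by rewrite ltrD2l ltr_pdivrMr// ltr_pMr// ltr1n.
have finj : injective f.
  move=> i j /addrI /(mulfI (lt0r_neq0 s0)) /invr_inj /eqP.
  by rewrite eqr_nat => /eqP [].
have [i Hi] : exists i, ~~ root (char_poly B) (f i).
  apply: contrapT => H.
  have : (size [seq f i | i <- iota 0 n.+1] < size (char_poly B))%N.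
    apply: max_poly_roots; first by rewrite -size_poly_eq0 size_char_poly.
      apply/allP => _ /mapP[i _ ->]; apply: contrapT => /negP ri.
      by apply: H; exists i.
    by rewrite map_inj_uniq// iota_uniq.
  by rewrite size_map size_iota size_char_poly ltnn.
exists (f i); split => //; apply: unitmx_inj => v vB; apply/eqP; apply: contraT => v0.
move: Hi; rewrite -eigenvalue_root_char => /negP; case.
apply/eigenvalueP; exists v => //.
by move: vB; rewrite mulmxBr mul_mx_scalar => /eqP; rewrite subr_eq0 => /eqP.
Qed.

Variables (d p q : nat) (M2 D : 'M[R]_d) (C : 'M[R]_(d, p + q)) (alpha : R).
Hypotheses (M2s : M2^T = M2) (Ds : D^T = D).
Hypothesis pd : forall u : 'rV[R]_d, u *m C = 0 -> u != 0 -> 0 < dotp (u *m M2) u.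
Hypothesis Cinj : forall l : 'rV[R]_(p + q), l *m C^T = 0 -> l = 0.

Let Km := kkt_mx M2 C.

(** For [(a, l)] in the kernel, [a] is tangent and pairing the first equation with [a] removes [l];
    so [a = 0] by definiteness, and then [l = 0] by injectivity. *)
Lemma kkt_mx_unit : Km \in unitmx.
Proof.
apply: unitmx_inj => v; rewrite -[v]hsubmxK /Km /kkt_mx mul_row_block mulmx0 addr0.
set a := lsubmx v; set l := rsubmx v.
rewrite -[0]hsubmxK => /eq_row_mx[]; rewrite !linear0 => h1 h2.
have a0 : a = 0.
  apply/eqP; apply: contraT => a0; have := pd h2 a0.
  have -> : a *m M2 = - (l *m C^T) by apply/eqP; rewrite -addr_eq0 h1.
  by rewrite dotpNl dotp_mulmx trmxK h2 dotp0r oppr0 ltxx.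
rewrite a0 mul0mx add0r in h1.
by rewrite a0 (Cinj h1) row_mx0.
Qed.

Let E := ulsubmx (invmx Km).

Lemma Km_sym : Km^T = Km.
Proof. by rewrite /Km /kkt_mx tr_block_mx M2s trmxK trmx0. Qed.

Lemma E_sym : E^T = E.
Proof.
have h : (invmx Km)^T = invmx Km by rewrite trmx_inv Km_sym.
by rewrite /E -[in RHS]h -trmx_ulsub.
Qed.

Lemma KiK : invmx Km *m Km = 1%:M. Proof. exact: mulVmx kkt_mx_unit. Qed.

Lemma EC0 : E *m C = 0.
Proof.
have := KiK; rewrite -[invmx Km]submxK {2}/Km /kkt_mx mulmx_block scalar_mx_block.
by move=> /eq_block_mx[_ h _ _]; rewrite mulmx0 addr0 in h.
Qed.

Lemma EM2 : exists X, E *m M2 = 1%:M - X *m C^T.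
Proof.
have := KiK; rewrite -[invmx Km]submxK {2}/Km /kkt_mx mulmx_block scalar_mx_block.
move=> /eq_block_mx[h _ _ _]; exists (ursubmx (invmx Km)).
by rewrite -h addrK.
Qed.

(** [E] inverts [M2] on tangent vectors: the corner block of [Km^-1 Km = 1] reads
    [E M2 = 1 - X C^T], and the transpose of the last term vanishes on the kernel of [C]. *)
Lemma tangentM2E (t : 'rV[R]_d) : t *m C = 0 -> t *m M2 *m E = t.
Proof.
move=> tC; have [X h] := EM2.
have -> : t *m M2 *m E = t *m (E *m M2)^T by rewrite trmx_mul E_sym M2s mulmxA.
by rewrite h linearB/= trmx1 mulmxBr mulmx1 trmx_mul trmxK mulmxA tC mul0mx subr0.
Qed.

Let N := M2 - D.
Let A : 'M[R]_d := (1 - alpha)%:M + alpha *: (N *m E).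

Lemma mulE_tangent (z : 'rV[R]_d) : z *m E *m C = 0.
Proof. by rewrite -mulmxA EC0 mulmx0. Qed.

Lemma tangentA (t : 'rV[R]_d) : t *m C = 0 -> t *m A = t - alpha *: (t *m D *m E).
Proof.
move=> tC; rewrite /A mulmxDr mul_mx_scalar -scalemxAr /N mulmxBl mulmxBr !mulmxA.
by rewrite tangentM2E// scalerBr scalerBl scale1r addrA subrK.
Qed.

Lemma tangentA_tangent (t : 'rV[R]_d) : t *m C = 0 -> t *m A *m C = 0.
Proof. by move=> tC; rewrite tangentA// mulmxBl tC -scalemxAl mulE_tangent scaler0 subr0. Qed.

(** On tangent vectors [A = 1 - alpha D E] and [E] inverts [M2]; both sides become
    [<x M2, a> - alpha <x D, a>], which is symmetric. *)
Lemma A_selfadjoint (x a : 'rV[R]_d) : x *m C = 0 -> a *m C = 0 ->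
  dotp (x *m A *m M2) a = dotp (x *m M2) (a *m A).
Proof.
move=> xC aC; rewrite !tangentA// mulmxBl dotpBl dotpBr; congr (_ - _).
rewrite -scalemxAl dotpZl dotpZr; congr (_ * _).
rewrite (dotp_mulmx (x *m D *m E) M2 a) M2s (dotp_mulmx (x *m D) E) E_sym tangentM2E//.
rewrite (dotpC (x *m M2)) (dotp_mulmx (a *m D) E) E_sym tangentM2E//.
by rewrite dotp_mulmx Ds dotpC.
Qed.

Let ip (a b : 'rV[R]_d) := dotp (a *m M2) b.

Let ip_ge0 (t : 'rV[R]_d) : t *m C = 0 -> 0 <= ip t t.
Proof.
move=> tC; have [->|t0] := eqVneq t 0; first by rewrite /ip mul0mx dotp0l.
by rewrite ltW//; exact: pd.
Qed.

Let ipC a b : ip a b = ip b a.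
Proof. by rewrite /ip dotp_mulmx M2s dotpC. Qed.

(** With [r = u D E], the squared [M2]-norm of [u A] is that of [u], minus [2 alpha <u D, u>], plus
    [alpha^2] times that of [r]: both changes increase it. *)
Lemma unstable_direction (u : 'rV[R]_d) : 0 < alpha -> u *m C = 0 -> dotp (u *m D) u < 0 ->
  0 < ip u u /\ ip u u < ip (u *m A) (u *m A).
Proof.
move=> al0 uC uD.
have u0 : u != 0 by apply: contraTneq uD => ->; rewrite mul0mx dotp0l ltxx.
split; first exact: pd.
set r := u *m D *m E.
have rC : r *m C = 0 by exact: mulE_tangent.
have ru : ip r u = dotp (u *m D) u.
  by rewrite /ip /r (dotp_mulmx _ M2) M2s (dotp_mulmx (u *m D) E) E_sym tangentM2E.
have ur : ip u r = dotp (u *m D) u by rewrite ipC.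
have -> : ip (u *m A) (u *m A) = ip u u - 2 * alpha * dotp (u *m D) u + alpha ^+ 2 * ip r r.
  rewrite tangentA// -/r {1}/ip mulmxBl -scalemxAl dotpBl !dotpBr !dotpZl !dotpZr.
  rewrite -/(ip u u) -/(ip u r) -/(ip r u) -/(ip r r) ru ur; ring.
have : 0 <= alpha ^+ 2 * ip r r by rewrite mulr_ge0 ?ip_ge0// exprn_ge0// ltW.
have : alpha * dotp (u *m D) u < 0 by rewrite pmulr_rlt0.
lra.
Qed.

(** [M2] is assumed positive only on the kernel of [C]. The form is therefore built from [M2] on the
    range of the projection [P], and from a large negative multiple of the Euclidean square on the
    complement. *)
Lemma unstable_form (u : 'rV[R]_d) : 0 < alpha < 1 -> u *m C = 0 -> dotp (u *m D) u < 0 ->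
  exists (V : 'M[R]_d) (g : R), [/\ 1 <= g,
    forall z : 'rV[R]_d, z != 0 -> 0 < dotp (z *m (A *m V *m A^T - g *: V)) z &
    0 < dotp (u *m V) u].
Proof.
move=> /andP[al0 al1] uC uD.
have [uu0 uuA] := unstable_direction al0 uC uD.
have s0 : 0 < ip (u *m A) (u *m A) / ip u u - 1.
  by rewrite subr_gt0 ltr_pdivlMr// mul1r.
(* The upper bound on [g] makes the form positive at [u]; avoiding the eigenvalues of [A *m A] makes
   [B] below injective. *)
have [g [g1 g2 gu]] := exists_noneigenvalue (A *m A) s0.
rewrite addrC subrK ltr_pdivlMr// in g2.
(* Right multiplication by [P] is a projection onto the kernel of [C]: its values are tangent by
   [E *m C = 0], and it fixes tangent vectors. *)
pose P := M2 *m E.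
have PC (z : 'rV[R]_d) : z *m P *m C = 0 by rewrite /P mulmxA mulE_tangent.
have PT (t : 'rV[R]_d) : t *m C = 0 -> t *m P = t by move=> tC; rewrite /P mulmxA tangentM2E.
pose G := A *m M2 *m A^T - g *: M2.
pose vT a := dotp (a *m G) a.
have vTE a : vT a = ip (a *m A) (a *m A) - g * ip a a.
  by rewrite /vT /G mulmxBr dotpBl -scalemxAr dotpZl !mulmxA dotp_mulmx trmxK.
have dotp_mulmx2 (z : 'rV[R]_d) (X Y : 'M[R]_d) : dotp (z *m (X *m Y *m X^T)) z =
  dotp (z *m X *m Y) (z *m X).
  by rewrite !mulmxA dotp_mulmx trmxK.
(* The component along the range of P carries the form vT, with a gap coming
   from |t (A A - g)|^2; the complementary component is contracted. *)
pose B := A *m A - g%:M.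
(* Completed by the square of the complementary component, the form [|t B|^2] becomes definite on
   the whole space, so [posdef_bound] applies. *)
pose B0 := P *m (B *m M2 *m B^T) *m P^T + (1%:M - P) *m 1%:M *m (1%:M - P)^T.
have B0E (z : 'rV[R]_d) : dotp (z *m B0) z = ip (z *m P *m B) (z *m P *m B)
    + dotp (z - z *m P) (z - z *m P).
  have h1 := dotp_mulmx2 z P (B *m M2 *m B^T); have h2 := dotp_mulmx2 (z *m P) B M2.
  have h3 := dotp_mulmx2 z (1%:M - P) 1%:M.
  rewrite /B0 (mulmxDr z) (dotpDl (_ *m _)) h1 h2 h3.
  by rewrite mulmx1 (mulmxBr z) mulmx1.
have BT (t : 'rV[R]_d) : t *m C = 0 -> t *m B *m C = 0.
  move=> tC; rewrite /B mulmxBr mulmxBl mulmxA mul_mx_scalar -scalemxAl tC scaler0 subr0.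
  by rewrite !tangentA_tangent.
have B0pd (z : 'rV[R]_d) : z != 0 -> 0 < dotp (z *m B0) z.
  move=> z0; rewrite B0E.
  have h1 : 0 <= ip (z *m P *m B) (z *m P *m B) by apply: ip_ge0; exact: BT.
  have h2 := dotp_ge0 (z - z *m P).
  have [zP|zP] := eqVneq (z - z *m P) 0; last first.
    rewrite ltr_wpDl// lt_neqAle h2 andbT eq_sym; apply: contra zP => /eqP/dotp_eq0 ->.
    by [].
  have zzP : z *m P = z by apply/eqP; rewrite eq_sym -subr_eq0; apply/eqP.
  have zC : z *m C = 0 by rewrite -zzP.
  rewrite zzP ltr_pwDl ?zzP//; last by rewrite subrr dotp0l.
  apply: pd; first exact: BT.
  apply: contra z0 => /eqP zB; apply/eqP.
  by rewrite -[z](mulmxK gu) zB mul0mx.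
have [e e0 He] := posdef_bound B0pd.
have gap (t : 'rV[R]_d) : t *m C = 0 -> vT (t *m A) - g * vT t >= e * `|t| ^+ 2.
  move=> tC; apply: le_trans (He t) _.
  rewrite B0E PT// subrr dotp0l addr0 !vTE.
  have tAC := tangentA_tangent tC.
  have sa : ip (t *m A *m A) t = ip (t *m A) (t *m A) by apply: A_selfadjoint.
  have sa' : ip t (t *m A *m A) = ip (t *m A) (t *m A) by rewrite ipC.
  rewrite /B mulmxBr mulmxA mul_mx_scalar {1}/ip mulmxBl -scalemxAl dotpBl !dotpBr !dotpZl !dotpZr.
  rewrite -/(ip t t) -/(ip (t *m A *m A) (t *m A *m A)) -/(ip (t *m A *m A) t).
  rewrite -/(ip t (t *m A *m A)) sa sa'.
  by rewrite le_eqVlt; apply/orP; left; apply/eqP; ring.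
pose cG : R := d%:R * (d%:R * `|G|) + 1.
have cG0 : 0 < cG by rewrite ltr_wpDl// !mulr_ge0.
pose F := alpha *: (N *m E).
have FC (z : 'rV[R]_d) : z *m F *m C = 0.
  by rewrite /F -scalemxAr -scalemxAl mulmxA mulE_tangent scaler0.
pose a1 : R := d%:R * `|A| + 1. pose f1 : R := d%:R * `|F| + 1.
have a10 : 0 < a1 by rewrite ltr_wpDl// mulr_ge0.
have f10 : 0 < f1 by rewrite ltr_wpDl// mulr_ge0.
have aA (z : 'rV_d) : `|z *m A| <= a1 * `|z|.
  by apply: le_trans (mulmx_norm_le _ _) _; rewrite mulrAC ler_wpM2r// lerDl.
have fF (z : 'rV_d) : `|z *m F| <= f1 * `|z|.
  by apply: le_trans (mulmx_norm_le _ _) _; rewrite mulrAC ler_wpM2r// lerDl.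
pose K1 := 2 * cG * a1 * f1; pose K2 := cG * f1 ^+ 2.
have K10 : 0 < K1 by rewrite !mulr_gt0.
have K20 : 0 < K2 by rewrite mulr_gt0// exprn_gt0.
pose kap := g - (1 - alpha) ^+ 2.
have kap0 : 0 < kap.
  have : (1 - alpha) ^+ 2 <= 1 by rewrite expr_le1// ?subr_ge0 ?ltW//; lra.
  rewrite /kap; lra.
(* The cross terms [K1 |a| |b|] cost [e / 2 |a|^2] and [K1^2 / (2 e) |b|^2], the form at [b F] costs
   [K2 |b|^2], and 1 is kept for strictness. *)
pose c := (K2 + K1 ^+ 2 / (2 * e) + 1) / kap.
have cp : 0 <= K1 ^+ 2 / (2 * e) by rewrite divr_ge0 ?exprn_ge0 ?mulr_ge0// ltW.
pose V := P *m G *m P^T - c *: ((1%:M - P) *m 1%:M *m (1%:M - P)^T).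
have VE (z : 'rV[R]_d) : dotp (z *m V) z = vT (z *m P) - c * dotp (z - z *m P) (z - z *m P).
  rewrite /V (mulmxBr z) dotpBl -scalemxAr dotpZl (dotp_mulmx2 z P G) (dotp_mulmx2 z (1%:M - P) 1%:M).
  by rewrite mulmx1 (mulmxBr z) mulmx1.
exists V, g; split; first exact: ltW.
- move=> z z0.
  have -> : dotp (z *m (A *m V *m A^T - g *: V)) z = dotp (z *m A *m V) (z *m A) - g * dotp (z *m V) z.
    by rewrite mulmxBr dotpBl -scalemxAr dotpZl dotp_mulmx2.
  rewrite !VE.
  set a := z *m P; set b := z - a.
  have aC : a *m C = 0 by exact: PC.
  have bP : b *m P = 0 by rewrite /b mulmxBl (PT a)// -/a subrr.
  have zE : z = a + b by rewrite /b addrC subrK.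
  (* As [F] has tangent values, the complementary component of [z A] is exactly [(1 - alpha) b]. *)
  have zAE : z *m A = a *m A + b *m F + (1 - alpha) *: b.
    by rewrite {1}zE mulmxDl -addrA; congr (_ + _); rewrite /A mulmxDr mul_mx_scalar addrC.
  have zAP : z *m A *m P = a *m A + b *m F.
    rewrite zAE mulmxDl -scalemxAl bP scaler0 addr0 mulmxDl !PT//.
    exact: tangentA_tangent.
  have zAb : z *m A - z *m A *m P = (1 - alpha) *: b by rewrite zAP zAE addrC addKr.
  rewrite zAb zAP dotpZl dotpZr.
  have -> : vT (a *m A + b *m F) = vT (a *m A) + dotp (a *m A *m G) (b *m F)
      + dotp (b *m F *m G) (a *m A) + vT (b *m F).
    by rewrite /vT mulmxDl dotpDl !dotpDr; ring.
  have q1 := qform_bound G (a *m A) (b *m F); have q2 := qform_bound G (b *m F) (a *m A).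
  have q3 := qform_bound G (b *m F) (b *m F).
  have r1 : `|a *m A| * `|b *m F| <= a1 * f1 * (`|a| * `|b|).
    have := ler_pM (normr_ge0 _) (normr_ge0 _) (aA a) (fF b).
    by move=> h; apply: le_trans h _; rewrite le_eqVlt; apply/orP; left; apply/eqP; ring.
  have r2 : `|b *m F| * `|b *m F| <= f1 ^+ 2 * `|b| ^+ 2.
    have := ler_pM (normr_ge0 _) (normr_ge0 _) (fF b) (fF b).
    by move=> h; apply: le_trans h _; rewrite le_eqVlt; apply/orP; left; apply/eqP; ring.
  rewrite [`|b *m F| * `|a *m A|]mulrC in q2.
  have r1' := ler_wpM2l (ltW cG0) r1; have r2' := ler_wpM2l (ltW cG0) r2.
  have gp := gap a aC.
  have bb := sqr_norm_le_dotp b.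
  have ck : c * kap * dotp b b >= (K2 + K1 ^+ 2 / (2 * e) + 1) * `|b| ^+ 2.
    rewrite /c divfK ?gt_eqF// ler_wpM2l// !addr_ge0// ltW//.
  have sq : 0 <= e / 2 * (`|a| - K1 / e * `|b|) ^+ 2 by rewrite mulr_ge0 ?sqr_ge0// divr_ge0// ltW.
  have sqE : e / 2 * (`|a| - K1 / e * `|b|) ^+ 2 =
     e / 2 * `|a| ^+ 2 - K1 * (`|a| * `|b|) + K1 ^+ 2 / (2 * e) * `|b| ^+ 2.
    by field; rewrite gt_eqF.
  have pos : 0 < e / 2 * `|a| ^+ 2 + `|b| ^+ 2.
    have [b0|b0] := eqVneq b 0.
      have a0 : a != 0 by apply: contra z0 => /eqP a0; rewrite zE a0 b0 addr0.
      by rewrite ltr_pwDl ?exprn_ge0// mulr_gt0 ?divr_gt0// exprn_gt0// normr_gt0.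
    rewrite ltr_wpDl ?mulr_ge0 ?exprn_ge0 ?divr_ge0 ?(ltW e0)//.
    by rewrite exprn_gt0// normr_gt0.
  move: q1 q2 q3; rewrite !ler_norml -/cG -/(vT (b *m F)) => /andP[q1 _] /andP[q2 _] /andP[q3 _].
  rewrite sqE in sq.
  have ck' : c * (g - (1 - alpha) ^+ 2) * dotp b b >= (K2 + K1 ^+ 2 / (2 * e) + 1) * `|b| ^+ 2 by [].
  have K1E : K1 * (`|a| * `|b|) = 2 * (cG * (a1 * f1 * (`|a| * `|b|))) by rewrite /K1; ring.
  have K2E : K2 * `|b| ^+ 2 = cG * (f1 ^+ 2 * `|b| ^+ 2) by rewrite /K2; ring.
  move: q1 q2 q3 r1' r2' gp ck' sq pos K1E K2E.
  move: (vT (a *m A)) (vT a) (vT (b *m F)) (dotp (a *m A *m G) _) (dotp (b *m F *m G) _)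
    (cG * (`|a *m A| * _)) (cG * (`|b *m F| * _)) (dotp b b) (`|a| ^+ 2) (`|b| ^+ 2)
    (`|a| * `|b|) (K1 ^+ 2 / _) => *.
  lra.
- rewrite VE PT// subrr dotp0l mulr0 subr0 vTE; lra.
Qed.

End Unstable.

(** * From active manifolds to local equations *)

Section Geometry.
Variable R : realType.

Lemma sdiff_comp n m q (F : 'rV[R]_n -> 'rV[R]_m) (G : 'rV[R]_m -> 'rV[R]_q) x J K :
  sdiff F x J -> sdiff G (F x) K -> sdiff (fun y => G (F y)) x (J *m K).
Proof.
move=> sF sG e e0.
have FF : Filter (nbhs (x, x)) := nbhs_filter (x, x).
have s0 (t : 'rV[R]_n * 'rV[R]_n) : 0 <= `|t.1 - t.2| by [].
have cF : F @ x --> F x := sdiff_cvg sF.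
have c1 : (fun t : 'rV[R]_n * 'rV[R]_n => F t.1) @ nbhs (x, x) --> F x.
  by apply: cvg_comp cF; exact: cvg_fst.
have c2 : (fun t : 'rV[R]_n * 'rV[R]_n => F t.2) @ nbhs (x, x) --> F x.
  by apply: cvg_comp cF; exact: cvg_snd.
have O : obig (nbhs (x, x)) (fun t => `|t.1 - t.2|)
    (fun t : 'rV[R]_n * 'rV[R]_n => F t.1 - F t.2).
  by have [L L0 HL] := sdiff_lipschitz sF; exists L.
have o1 := osm_sdiff FF sG c1 c2 O.
have o2 : osm (nbhs (x, x)) (fun t => `|t.1 - t.2|)
    (fun t : 'rV[R]_n * 'rV[R]_n => F t.1 - F t.2 - (t.1 - t.2) *m J) by [].
have o3 := osmD FF o1 (osm_mulmxr FF K o2).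
apply: (osm_eq FF o3 _ e0).
by apply: nearW => t /=; rewrite (mulmxBl (F t.1 - F t.2)) mulmxA addrA subrK.
Qed.

(* Directions tangent to {P = 0} are velocities of curves in {P = 0}, hence are
   annihilated by the derivative of any map vanishing on that set. *)
Lemma kernel_jacobian_sub n q s (P : 'rV[R]_n -> 'rV[R]_q) (G : 'rV[R]_n -> 'rV[R]_s)
    (x : 'rV[R]_n) (Ji : 'M[R]_(q, n)) (J : 'M[R]_(n, s)) (u : 'rV[R]_n) :
  Cp 1 P -> Ji *m 'J P x = 1%:M -> P x = 0 -> sdiff G x J -> G x = 0 ->
  (\forall y \near x, P y = 0 -> G y = 0) -> u *m 'J P x = 0 -> u *m J = 0.
Proof.
move=> cP JiP Px sG Gx sub uP; apply/eqP; rewrite -normr_eq0 eq_le normr_ge0 andbT.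
have curve := nbhs_singleton (tangent_curve cP JiP Px) Px u uP.
apply: (@le0_of_small _ _ (`|u| + 1 + n%:R * `|J|)); first by rewrite !addr_ge0// mulr_ge0.
move=> e e0 e1.
have near1 : \forall y \near x, (P y = 0 -> G y = 0) /\ `|G y - G x - (y - x) *m J| <= e * `|y - x|.
  near=> y; split; first by near: y.
  by near: y; exact: (near_diag_left (sG e e0)).
have [del /= del0 Hdel] := (@nbhs_ballP _ _ x _).1 near1.
have un0 : 0 <= `|u| + 1 by rewrite addr_ge0.
have : \forall t \near (0 : R)^'+, `|u *m J| <= e * (`|u| + 1 + n%:R * `|J|).
  near=> t.
  have t0 : 0 < t by near: t; exact: nbhs_right_gt.
  have [y1 Py1 Hy1] : exists2 y1, P y1 = 0 & `|y1 - (x + t *: u)| <= e * t.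
    by near: t; exact: curve.
  set c := y1 - (x + t *: u) in Hy1.
  have yx : y1 - x = t *: u + c by rewrite /c [RHS]addrC opprD addrA subrK.
  have nyx : `|y1 - x| <= t * (`|u| + 1).
    rewrite yx mulrDr mulr1; apply: le_trans (ler_normD _ _) _.
    rewrite normrZ gtr0_norm// lerD2l; apply: le_trans Hy1 _.
    by rewrite ler_piMl// ltW.
  have ts : t * (`|u| + 1) < del by near: t; exact: near_right_scale.
  have xb : ball x del y1 by rewrite -ball_normE /ball_ /= distrC; exact: le_lt_trans nyx ts.
  have [Gy Hy] := Hdel y1 xb.
  rewrite Gx (Gy Py1) subrr add0r normrN in Hy.
  have uE : t *: (u *m J) = (y1 - x) *m J - c *m J.
    by rewrite yx mulmxDl addrK -scalemxAl.
  rewrite -(ler_pM2l t0).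
  have -> : t * `|u *m J| = `|t *: (u *m J)| by rewrite normrZ gtr0_norm.
  rewrite uE; apply: le_trans (ler_normB _ _) _.
  have h1 : e * `|y1 - x| <= e * (t * (`|u| + 1)) by rewrite ler_pM2l.
  have h2 := mulmx_norm_le c J.
  have h3 : n%:R * `|c| * `|J| <= n%:R * `|J| * (e * t).
    by rewrite mulrAC ler_wpM2l// mulr_ge0.
  have -> : t * (e * (`|u| + 1 + n%:R * `|J|)) = e * (t * (`|u| + 1)) + n%:R * `|J| * (e * t) by ring.
  by apply: lerD; [exact: le_trans Hy h1|exact: le_trans h2 h3].
by move=> /filter_ex[].
Unshelve. all: by end_near.
Qed.

Lemma local_equation_near n k (A : set 'rV[R]_n) (x : 'rV[R]_n) (G : 'rV[R]_n -> 'rV[R]_(n - k)) :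
  local_equation 2 A x G -> \forall y \near x, A y <-> G y = 0.
Proof.
move=> [_ _ _ [W [oW Wx AW]]].
have : \forall y \near x, W y by exact: open_nbhs_nbhs.
apply: filterS => y Wy; split => [Ay|Gy].
  have : (A `&` W) y by []. by rewrite AW => -[].
have : [set y | W y /\ G y = 0] y by []. by rewrite -AW => -[].
Qed.

(** If [w] is a subgradient of [phi] near [v], then [w - v] is a short subgradient of the tilted
    function; the positive infimum off [A] then forces the point into [A]. *)
Lemma active_data_exists rho n k (phi : 'rV[R]_n -> \bar R) (x v : 'rV[R]_n) (A : set 'rV[R]_n)
    (G : 'rV[R]_n -> 'rV[R]_(n - k)) : 0 <= rho -> A x ->
  local_equation 2 A x G -> active_manifold_for 2 phi x v A ->
  exists Pi g, active_data rho phi x v G Pi g.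
Proof.
move=> rho0 Ax lG [_ [_ _ [U [nU _ sm inf]]]].
have AG := local_equation_near lG; have [_ cG rk _] := lG.
have Ux : U x := nbhs_singleton nU.
have [V [g [nV cg gE]]] := sm x (conj Ax Ux).
have /row_fullP[Pi PiJ] : row_full ('J G x) by rewrite /row_full rk.
exists Pi, g; split => //.
- by apply/(nbhs_singleton AG).
- near=> y => Gy.
  have Ay' : A y <-> G y = 0 by near: y.
  have Uy : U y by near: y.
  have Vy : V y by near: y.
  have Ay : A y by apply/Ay'.
  have := gE y (conj Ay Uy) Vy.
  by case: (phi y) => [a|//|//] /= [<-]; rewrite subrK.
- have [e e0 He] : exists2 e : R, 0 < e & forall y w, U y -> ~ A y ->
      subdiff (fun y => phi y - (dotp v y)%:E)%E y w -> e <= enorm w.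
    move: inf; set S := [set s | _].
    have lb s : S s -> (ereal_inf S <= s)%E by exact: ereal_inf_lbound.
    have lb' y w : U y -> ~ A y -> subdiff (fun y => phi y - (dotp v y)%:E)%E y w ->
        (ereal_inf S <= (enorm w)%:E)%E by move=> *; apply: lb; exists y, w.
    case: (ereal_inf S) lb' => [a||] lb' // a0.
      by exists a => // y w Uy nA /(lb' y w Uy nA); rewrite lee_fin.
    (* An infinite infimum means that there is no subgradient off [A], so any positive bound
       serves. *)
    by exists 1 => // y w Uy nA /(lb' y w Uy nA).
  exists (e / (n%:R + 1)); first by rewrite divr_gt0// ltr_wpDl.
  near=> y => w; rewrite ltr_pdivlMr ?ltr_wpDl// => wv gw.
  have Ay' : A y <-> G y = 0 by near: y.
  have Uy : U y by near: y.
  apply/Ay'; apply: contrapT => nA.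
  have := He y (w - v) Uy nA (gsub_subdiff rho0 (gsub_tilt v gw)).
  apply/negP; rewrite -ltNge; apply: le_lt_trans (enorm_le _) _.
  apply: le_lt_trans wv; rewrite mulrC ler_wpM2l// lerDl//.
Unshelve. all: by end_near.
Qed.

End Geometry.

(** * Negative curvature *)

Section ParabolicBound.
Variable R : realType.

Lemma limf_einf_ge (T : topologicalType) (F : set_system T) (f : T -> \bar R) (a : \bar R) :
  (\forall z \near F, (a <= f z)%E) -> (a <= limf_einf f F)%E.
Proof.
move=> H; rewrite limf_einfE.
apply: le_trans (ereal_sup_ubound _); last by exists [set z | (a <= f z)%E].
by apply: le_ereal_inf_tmp => _ [z /= ? <-].
Qed.

Lemma qform_perturb n (D : 'M[R]_n) (u s : 'rV[R]_n) : `|s| <= 1 ->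
  dotp (u *m D) u - (n%:R * (n%:R * `|D|) + 1) * (2 * `|u| + 1) * `|s|
    <= dotp ((u + s) *m D) (u + s).
Proof.
move=> s1; set C := _ + 1.
have C0 : 0 <= C by rewrite addr_ge0// !mulr_ge0.
have := qform_bound D u s; have := qform_bound D s u; have := qform_bound D s s.
rewrite -/C !ler_norml => /andP[h1 _] /andP[h2 _] /andP[h3 _].
have ss : C * (`|s| * `|s|) <= C * `|s| by rewrite ler_wpM2l// ler_piMl.
rewrite mulmxDl dotpDl !dotpDr.
have -> : C * (2 * `|u| + 1) * `|s| = C * (`|u| * `|s|) + C * (`|s| * `|u|) + C * `|s| by ring.
move: h1 h2 h3 ss; move: (dotp _ _) (dotp _ _) (dotp _ _) (dotp _ _) (C * _) (C * _) (C * _) (C * _) => *.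
lra.
Qed.

(** A parabolic arc is [x + t (u + s)] with [s = (t / 2) w'] tending to 0. The lower bound has no
    first-order term, so the acceleration drops out in the limit, and [<u D, u> >= 0] would make
    every parabolic subderivative nonnegative. *)
Lemma d2_quadratic_lower n (phi : 'rV[R]_n -> \bar R) x u (D : 'M[R]_n) :
  phi x \is a fin_num ->
  (forall e : R, 0 < e -> \forall y \near x,
     (phi x + (dotp ((y - x) *m D) (y - x) / 2 - e * `|y - x| ^+ 2)%:E <= phi y)%E) ->
  (d2 phi x u < 0)%E -> dotp (u *m D) u < 0.
Proof.
(* A negative value excludes the default [+oo], so it is a parabolic subderivative at some [w]. *)
move=> fx low; rewrite /d2; case: xgetP => [_ -> [fc [w <-]]|//] neg.
rewrite ltNge; apply/negP => uD; move: neg; apply/negP; rewrite -leNgt.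
set pz := parabolic_subderivative _ _ _ _.
suff H (e : R) : 0 < e -> ((- e)%:E <= pz)%E.
  apply/lee_addgt0Pr => e e0; have := H e e0.
  case: pz {H} => [a||]; last by rewrite leeNy_eq.
    by rewrite lee_fin => ea; change (0%:E <= (a + e)%:E)%E; rewrite lee_fin; lra.
  by move=> _; rewrite addye// leey.
move=> e0; rewrite /pz /parabolic_subderivative; apply: limf_einf_ge.
set C : R := (n%:R * (n%:R * `|D|) + 1) * (2 * `|u| + 1).
have C0 : 0 < C by rewrite mulr_gt0// ltr_wpDl// !mulr_ge0.
have u10 : 0 < `|u| + 1 by rewrite ltr_wpDl.
pose e1 := e / (4 * (`|u| + 1) ^+ 2).
have e10 : 0 < e1 by rewrite divr_gt0// mulr_gt0// exprn_gt0.
have [del /= del0 Hdel] := (@nbhs_ballP _ _ x _).1 (low e1 e10).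
pose G := filter_prod (0 : R)^'+ (nbhs w).
have t1 (P : R -> Prop) : (\forall t \near (0 : R)^'+, P t) -> \forall z \near G, P (z : R * 'rV[R]_n).1.
  by move=> H; exact: (@cvg_fst _ _ _ _ _ _ H).
have t2 : \forall z \near G, `|w - (z : R * 'rV[R]_n).2| < 1.
  by have H := near_dist w ltr01; exact: (@cvg_snd _ _ _ _ _ _ H).
have w10 : 0 <= `|w| + 1 by rewrite addr_ge0.
have eC : 0 < e / (2 * C) by rewrite divr_gt0// mulr_gt0.
have T0 := t1 _ (nbhs_right_gt 0).
have T1 := t1 _ (near_right_scale w10 ltr01).
have T2 := t1 _ (near_right_scale w10 eC).
have T3 := t1 _ (near_right_scale (ltW u10) del0).
near=> z.
have z0 : 0 < z.1 by near: z.
have h1 : z.1 * (`|w| + 1) < 1 by near: z.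
have h2 : z.1 * (`|w| + 1) < e / (2 * C) by near: z.
have h3 : z.1 * (`|u| + 1) < del by near: z.
have zw : `|w - z.2| < 1 by near: z.
have z2 : `|z.2| <= `|w| + 1.
  have -> : z.2 = w - (w - z.2) by rewrite subKr.
  by apply: le_trans (ler_normB _ _) _; rewrite lerD2l ltW.
set s := (z.1 / 2) *: z.2.
have ns : `|s| <= z.1 * (`|w| + 1).
  rewrite normrZ gtr0_norm ?divr_gt0//; apply: ler_pM => //; first by rewrite divr_ge0// ltW.
  by rewrite ler_pdivrMr// ler_peMr ?ler1n// ltW.
have s1 : `|s| <= 1 by apply: le_trans ns (ltW h1).
set y := x + z.1 *: u + (z.1 ^+ 2 / 2) *: z.2.
have yx : y - x = z.1 *: (u + s).
  rewrite /y -(addrA x) [LHS]addrC addKr scalerDr /s scalerA; congr (_ + _ *: _).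
  by rewrite expr2 mulrA.
have nus : `|u + s| <= `|u| + 1 by apply: le_trans (ler_normD _ _) _; rewrite lerD2l.
have nyx : `|y - x| <= z.1 * (`|u| + 1) by rewrite yx normrZ gtr0_norm// ler_pM2l.
have xb : ball x del y by rewrite -ball_normE /ball_ /= distrC; exact: le_lt_trans nyx h3.
have := Hdel y xb => /=.
have tt : 0 < z.1 ^+ 2 / 2 by rewrite divr_gt0// exprn_gt0.
have q1 := qform_perturb D u s1.
have q2 : (n%:R * (n%:R * `|D|) + 1) * (2 * `|u| + 1) * `|s| <= e / 2.
  apply: (@le_trans _ _ (C * (e / (2 * C)))).
    by rewrite ler_pM2l//; apply: le_trans ns (ltW h2).
  by rewrite le_eqVlt; apply/orP; left; apply/eqP; field; rewrite gt_eqF.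
have q3 : e1 * `|u + s| ^+ 2 <= e / 4.
  apply: (@le_trans _ _ (e1 * (`|u| + 1) ^+ 2)).
    by rewrite ler_pM2l// ler_pXn2r// nnegrE// ltW.
  by rewrite le_eqVlt; apply/orP; left; apply/eqP; rewrite /e1; field; rewrite gt_eqF.
have low2 : - e * (z.1 ^+ 2 / 2) <= dotp ((y - x) *m D) (y - x) / 2 - e1 * `|y - x| ^+ 2.
  rewrite yx -scalemxAl dotpZl dotpZr normrZ (gtr0_norm z0) exprMn.
  have -> : z.1 * (z.1 * dotp ((u + s) *m D) (u + s)) / 2 - e1 * (z.1 ^+ 2 * `|u + s| ^+ 2) =
    (dotp ((u + s) *m D) (u + s) - 2 * (e1 * `|u + s| ^+ 2)) * (z.1 ^+ 2 / 2) by field.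
  rewrite ler_pM2r//.
  move: uD q1 q2 q3; move: (dotp _ _) (dotp _ _) (_ * `|s|) (e1 * _) => *; lra.
move: fx; case: (phi x) => [px _|//|//].
case: (phi y) => [py|_|//].
  rewrite -!EFinD lee_fin => hy; rewrite -EFinM lee_fin ler_pdivlMr//.
  apply: le_trans low2 _; rewrite -lerBrDl// in hy; move: hy; lra.
by rewrite addye// gt0_mulye ?leey// lte_fin invr_gt0.
Unshelve. all: by end_near.
Qed.

End ParabolicBound.

(** * Second-order expansion of the composite Lagrangian *)

Section LagrangianTaylor.
Variable R : realType.

(** Because [D] vanishes at [F x0], the curvature of [F] does not enter and strict differentiability
    of [F] is enough. *)
Lemma taylor2_comp n m (F : 'rV[R]_n -> 'rV[R]_m) x0 (J : 'M[R]_(n, m))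
    (L : 'rV[R]_m -> R) D (H : 'M[R]_m) :
  sdiff F x0 J -> C2at L (F x0) D H -> D (F x0) = 0 ->
  forall e : R, 0 < e -> \forall y \near x0,
    `|L (F y) - L (F x0) - dotp ((y - x0) *m (J *m H *m J^T)) (y - x0) / 2| <= e * `|y - x0| ^+ 2.
Proof.
move=> sF CL D0 e e0.
have [l l0 Hl] := sdiff_lipschitz sF.
set c : R := m%:R * (m%:R * `|H|) + 1.
have c0 : 0 < c by rewrite ltr_wpDl// !mulr_ge0.
set b : R := n%:R * `|J|.
have b0 : 0 <= b by rewrite mulr_ge0.
pose s := l ^+ 2 + c * (l + b).
have s0 : 0 < s by rewrite addr_gt0 ?exprn_gt0// mulr_gt0// ltr_wpDr.
pose e1 := e / s.
have e10 : 0 < e1 by rewrite divr_gt0.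
have cF : F @ x0 --> F x0 := sdiff_cvg sF.
have T1 : \forall y \near x0, `|L (F y) - L (F x0) - dotp (D (F x0)) (F y - F x0)
    - dotp ((F y - F x0) *m H) (F y - F x0) / 2| <= e1 * `|F y - F x0| ^+ 2.
  exact: (cF _ (taylor2 CL e10)).
have T2 : \forall y \near x0, `|F y - F x0| <= l * `|y - x0|.
  exact: (near_diag_left Hl).
have T3 : \forall y \near x0, `|F y - F x0 - (y - x0) *m J| <= e1 * `|y - x0|.
  exact: (near_diag_left (sF e1 e10)).
near=> y.
have t1 : `|L (F y) - L (F x0) - dotp (D (F x0)) (F y - F x0)
    - dotp ((F y - F x0) *m H) (F y - F x0) / 2| <= e1 * `|F y - F x0| ^+ 2 by near: y.
have t2 : `|F y - F x0| <= l * `|y - x0| by near: y.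
have t3 : `|F y - F x0 - (y - x0) *m J| <= e1 * `|y - x0| by near: y.
move: t1 t2 t3; rewrite D0 dotp0l subr0; move: (F y - F x0) (y - x0) => dF dy t1 t2 t3.
have t4 : `|dy *m J| <= b * `|dy|.
  by apply: le_trans (mulmx_norm_le _ _) _; rewrite /b mulrAC.
have -> : dotp (dy *m (J *m H *m J^T)) dy = dotp (dy *m J *m H) (dy *m J).
  by rewrite !mulmxA [RHS]dotpC (dotp_mulmx dy J) dotpC.
have qE : dotp (dF *m H) dF - dotp (dy *m J *m H) (dy *m J)
   = dotp ((dF - dy *m J) *m H) dF + dotp (dy *m J *m H) (dF - dy *m J).
  by rewrite mulmxBl dotpBl dotpBr; ring.
have q1 := qform_bound H (dF - dy *m J) dF; have q2 := qform_bound H (dy *m J) (dF - dy *m J).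
rewrite -/c in q1 q2.
have n0 : 0 <= `|dy| by [].
have r1 : `|dF - dy *m J| * `|dF| <= e1 * l * `|dy| ^+ 2.
  apply: le_trans (ler_pM (normr_ge0 _) (normr_ge0 _) t3 t2) _.
  by rewrite le_eqVlt; apply/orP; left; apply/eqP; ring.
have r2 : `|dy *m J| * `|dF - dy *m J| <= e1 * b * `|dy| ^+ 2.
  apply: le_trans (ler_pM (normr_ge0 _) (normr_ge0 _) t4 t3) _.
  by rewrite le_eqVlt; apply/orP; left; apply/eqP; ring.
have r3 : e1 * `|dF| ^+ 2 <= e1 * l ^+ 2 * `|dy| ^+ 2.
  by rewrite -mulrA ler_pM2l// -exprMn ler_pXn2r// nnegrE// mulr_ge0// ltW.
have r1' := ler_wpM2l (ltW c0) r1; have r2' := ler_wpM2l (ltW c0) r2.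
have eE : e * `|dy| ^+ 2 = e1 * l ^+ 2 * `|dy| ^+ 2 + c * (e1 * l * `|dy| ^+ 2) + c * (e1 * b * `|dy| ^+ 2).
  have -> : e = e1 * s by rewrite /e1 divfK// gt_eqF.
  by rewrite /s; ring.
have p1 : 0 <= c * (e1 * l * `|dy| ^+ 2)
  by exact: (mulr_ge0 (ltW c0) (mulr_ge0 (mulr_ge0 (ltW e10) (ltW l0)) (exprn_ge0 _ n0))).
have p2 : 0 <= c * (e1 * b * `|dy| ^+ 2)
  by exact: (mulr_ge0 (ltW c0) (mulr_ge0 (mulr_ge0 (ltW e10) b0) (exprn_ge0 _ n0))).
rewrite eE; move: t1 q1 q2 r3 r1' r2' qE p1 p2; rewrite !ler_norml => /andP[+ +] /andP[+ +] /andP[+ +].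
move: (L (F y) - L (F x0)) (dotp (dF *m H) dF) (dotp (dy *m J *m H) (dy *m J)) (dotp _ _) (dotp _ _)
  (e1 * `|dF| ^+ 2) (c * _) (c * _) (c * _) (c * _) (_ * `|dy| ^+ 2).
by move=> x1 x2 x3 x4 x5 x6 x7 x8 x9 x10 x11 *; apply/andP; split; lra.
Unshelve. all: by end_near.
Qed.

(** The curvature of [F] enters only through [<w0, F>], whose gradient at [x0] is cancelled by the
    linear term in [y]. *)
Lemma lagrangian_taylor n m (F : 'rV[R]_n -> 'rV[R]_m) x0 (w0 : 'rV[R]_m)
    (Lr : 'rV[R]_n -> R) Dr Hr (Lh : 'rV[R]_m -> R) Dh Hh Dw K :
  sdiff F x0 ('J F x0) -> C2at Lr x0 Dr Hr -> Dr x0 = 0 ->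
  C2at Lh (F x0) Dh Hh -> Dh (F x0) = 0 ->
  C2at (fun y => dotp w0 (F y)) x0 Dw K -> Dw x0 = w0 *m ('J F x0)^T ->
  let L y := Lr y + Lh (F y) + dotp w0 (F y) + dotp (- (w0 *m ('J F x0)^T)) y in
  forall e : R, 0 < e -> \forall y \near x0,
    `|L y - L x0 - dotp ((y - x0) *m ('J F x0 *m Hh *m ('J F x0)^T + Hr + K)) (y - x0) / 2|
      <= e * `|y - x0| ^+ 2.
Proof.
move=> sF Cr Dr0 Ch Dh0 Cw Dw0 L e e0.
have e3 : 0 < e / 3 by rewrite divr_gt0.
have T1 := taylor2_comp sF Ch Dh0 e3.
have T2 := taylor2 Cr e3; have T3 := taylor2 Cw e3.
near=> y.
have t1 : `|Lh (F y) - Lh (F x0) - dotp ((y - x0) *m ('J F x0 *m Hh *m ('J F x0)^T)) (y - x0) / 2|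
  <= e / 3 * `|y - x0| ^+ 2 by near: y.
have t2 : `|Lr y - Lr x0 - dotp (Dr x0) (y - x0) - dotp ((y - x0) *m Hr) (y - x0) / 2|
      <= e / 3 * `|y - x0| ^+ 2 by near: y.
have t3 : `|dotp w0 (F y) - dotp w0 (F x0) - dotp (Dw x0) (y - x0) - dotp ((y - x0) *m K) (y - x0) / 2|
      <= e / 3 * `|y - x0| ^+ 2 by near: y.
rewrite Dr0 dotp0l in t2; rewrite Dw0 dotpBr in t3.
rewrite /L !mulmxDr !dotpDl !dotpNl.
move: t1 t2 t3; move: ('J F x0) => J.
have -> : e * `|y - x0| ^+ 2 = 3 * (e / 3 * `|y - x0| ^+ 2) by field.
rewrite !ler_norml => /andP[+ +] /andP[+ +] /andP[+ +].
move: (e / 3 * _) (dotp (_ *m (J *m Hh *m J^T)) _) (dotp (_ *m Hr) _) (dotp (_ *m K) _) (dotp (w0 *m J^T) y)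
  (dotp (w0 *m J^T) x0) (dotp w0 (F y)) (dotp w0 (F x0)) (Lh (F y)) (Lh (F x0)) (Lr y) (Lr x0).
by move=> *; apply/andP; split; lra.
Unshelve. all: by end_near.
Qed.

End LagrangianTaylor.

(** * The prox-linear map near the saddle point *)

Section SaddlePoint.
Variable R : realType.

(** All consequences of an active manifold, phrased along an arbitrary filter. It is applied to [r]
    along [S x] and to [h] along the model point, with their subgradients. *)
Lemma active_path rho n q (phi : 'rV[R]_n -> \bar R) (p0 u0 : 'rV[R]_n)
    (P : 'rV[R]_n -> 'rV[R]_q) Pi g : 0 <= rho ->
  active_data rho phi p0 u0 P Pi g -> gsub rho phi p0 u0 ->
  exists (L : 'rV[R]_n -> R) (DL : 'rV[R]_n -> 'rV[R]_n) (H : 'M[R]_n),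
  [/\ C2at L p0 DL H /\ DL p0 = 0,
    \forall y \near p0, P y = 0 -> phi y = (L y + dotp u0 y)%:E,
    forall u, u *m 'J P p0 = 0 -> - rho * dotp u u <= dotp (u *m H) u &
    forall T (F : set_system T) (FF : Filter F) (y v : T -> 'rV[R]_n),
      y @ F --> p0 -> v @ F --> u0 -> (\forall t \near F, gsub rho phi (y t) (v t)) ->
      (\forall t \near F, P (y t) = 0) /\
      exists2 l : T -> 'rV[R]_q, l @ F --> (0 : 'rV[R]_q) &
        \forall t \near F, v t - u0 = DL (y t) + l t *m ('J P (y t))^T].
Proof.
move=> rho0 act sub0.
have [lam [H [C2L DL0 mult small]]] := active_lagrangian rho0 act sub0.
exists (fun y => g y + dotp lam (P y)), (fun y => grad g y + lam *m ('J P y)^T), H.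
have [_ _ _ phiE [e e0 He]] := act.
split; first by split.
- near=> y => Py; rewrite Py dotp0r addr0; move: Py; near: y; exact: phiE.
- by move=> u; exact: (active_curvature act sub0 C2L DL0).
move=> T F FF y v cy cv gv.
have Py : \forall t \near F, P (y t) = 0.
  have h1 : \forall t \near F, forall v, `|v - u0| < e -> gsub rho phi (y t) v -> P (y t) = 0.
    exact: (cy _ He).
  have e2 : 0 < e / 2 by rewrite divr_gt0.
  have h2 : \forall t \near F, `|u0 - v t| <= e / 2 by exact: (cvg_near cv e2).
  near=> t.
  have k1 : forall v, `|v - u0| < e -> gsub rho phi (y t) v -> P (y t) = 0 by near: t.
  have k2 : `|u0 - v t| <= e / 2 by near: t.
  apply: (k1 (v t)); last by near: t.
  by rewrite distrC; apply: le_lt_trans k2 _; rewrite ltr_pdivrMr// ltr_pMr// ltr1n.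
split => //.
pose eqn t (l : 'rV[R]_q) := v t - u0 = grad g (y t) + lam *m ('J P (y t))^T + l *m ('J P (y t))^T.
have ex : \forall t \near F, exists l, eqn t l.
  have h1 : \forall t \near F, P (y t) = 0 -> forall v, gsub rho phi (y t) v ->
      exists l, v - u0 = grad g (y t) + lam *m ('J P (y t))^T + l *m ('J P (y t))^T.
    exact: (cy _ mult).
  near=> t.
  have k1 : P (y t) = 0 -> forall v, gsub rho phi (y t) v ->
      exists l, v - u0 = grad g (y t) + lam *m ('J P (y t))^T + l *m ('J P (y t))^T by near: t.
  have k2 : P (y t) = 0 by near: t.
  have k3 : gsub rho phi (y t) (v t) by near: t.
  exact: k1 k2 _ k3.
pose l t := xget (0 : 'rV[R]_q) (eqn t).
have eql : \forall t \near F, eqn t (l t).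
  near=> t.
  have [l0 k0] : exists l, eqn t l by near: t.
  exact: (xgetI (0 : 'rV[R]_q) k0).
exists l => //.
apply: cvg_of_near => e1 e10.
have [del del0 Hdel] := small e1 e10.
have h1 : \forall t \near F, forall (v : 'rV[R]_n) (l : 'rV[R]_q),
    `|v - u0| <= del -> v - u0 = grad g (y t) + lam *m ('J P (y t))^T + l *m ('J P (y t))^T -> `|l| <= e1.
  exact: (cy _ Hdel).
have h2 : \forall t \near F, `|u0 - v t| <= del by exact: (cvg_near cv del0).
near=> t; rewrite sub0r normrN.
have k1 : forall (v : 'rV[R]_n) (l : 'rV[R]_q), `|v - u0| <= del ->
   v - u0 = grad g (y t) + lam *m ('J P (y t))^T + l *m ('J P (y t))^T -> `|l| <= e1 by near: t.
have k2 : `|u0 - v t| <= del by near: t.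
have k3 : eqn t (l t) by near: t.
by apply: k1 k3; rewrite distrC.
Unshelve. all: by end_near.
Qed.

Lemma sdiff_damped n (S : 'rV[R]_n -> 'rV[R]_n) x A alpha : 0 < alpha < 1 ->
  sdiff S x A -> sdiff (damped alpha S) x ((1 - alpha)%:M + alpha *: A).
Proof.
move=> /andP[a0 a1] sS e e0; have := sS e e0; apply: filterS => t Ht.
have -> : damped alpha S t.1 - damped alpha S t.2 - (t.1 - t.2) *m ((1 - alpha)%:M + alpha *: A) =
   alpha *: (S t.1 - S t.2 - (t.1 - t.2) *m A).
  rewrite /damped mulmxDr mul_mx_scalar -scalemxAr.
  by apply/rowP => i; rewrite !mxE; ring.
rewrite normrZ gtr0_norm//; apply: le_trans Ht.
by rewrite ler_piMl// ltW.
Qed.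

Variables (d m p q : nat) (F : 'rV[R]_d -> 'rV[R]_m) (h : 'rV[R]_m -> R).
Variables (r : 'rV[R]_d -> \bar R) (rho mu : R) (x0 : 'rV[R]_d) (w0 : 'rV[R]_m).
Variables (P : 'rV[R]_d -> 'rV[R]_p) (Q : 'rV[R]_m -> 'rV[R]_q).
Variables (Pi : 'M[R]_(p, d)) (Qi : 'M[R]_(q, m)) (gr : 'rV[R]_d -> R^o) (gh : 'rV[R]_m -> R^o).
Let J0 := 'J F x0.
Let JP := 'J P x0.
Let JQ := 'J Q (F x0).
Let v0 := - (w0 *m J0^T).
Hypotheses (cF : Cp 2 F) (ch : rconvex h) (nr : avoids_ninfty r) (lr : lsc r).
Hypotheses (rho0 : 0 <= rho) (cr : weakly_convex rho r) (mu0 : 0 < mu) (murho : mu * rho < 1).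
Hypotheses (actr : active_data rho r x0 v0 P Pi gr)
  (acth : active_data 0 (EFin \o h) (F x0) w0 Q Qi gh).
Hypotheses (subr : gsub rho r x0 v0) (subh : hsub h (F x0) w0).
Hypothesis transversal : forall c : 'rV[R]_m, exists (a : 'rV[R]_d) (b : 'rV[R]_m),
  [/\ a *m JP = 0, b *m JQ = 0 & c = a *m J0 + b].

(** Dual form of transversality: [w] is orthogonal to the image of the tangent vectors of the first
    manifold and to those of the second, which together span the space. *)
Lemma transversal_eq0 (w : 'rV[R]_m) (l : 'rV[R]_p) (k : 'rV[R]_q) :
  w *m J0^T = l *m JP^T -> w = k *m JQ^T -> w = 0.
Proof.
move=> wl wk; apply: dotp_eq0.
have [a [b [aP bQ wE]]] := transversal w.
rewrite {2}wE dotpDr.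
have -> : dotp w (a *m J0) = 0.
  by rewrite dotpC dotp_mulmx wl dotpC dotp_mulmx trmxK aP dotp0r.
by rewrite wk dotp_mulmx trmxK bQ dotp0r addr0.
Qed.

Lemma kktC_inj (l : 'rV[R]_(p + q)) : l *m (kktC J0 JP JQ)^T = 0 -> l = 0.
Proof.
rewrite -[l]hsubmxK /kktC tr_row_mx mul_row_col.
set l1 := lsubmx l; set l2 := rsubmx l => h0.
have w0' : l2 *m JQ^T = 0.
  apply: (@transversal_eq0 _ (- l1) l2) => //.
  rewrite mulNmx; apply/eqP; rewrite -addr_eq0 addrC; apply/eqP.
  by move: h0; rewrite trmx_mul mulmxA.
have inj a b (G : 'M[R]_(a, b)) (Gi : 'M[R]_(b, a)) (k : 'rV[R]_b) :
    Gi *m G = 1%:M -> k *m G^T = 0 -> k = 0.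
  by move=> GG kG; rewrite -[k]mulmx1 -[1%:M]trmx1 -GG trmx_mul mulmxA kG mul0mx.
have [_ _ PJ _ _] := actr; have [_ _ QJ _ _] := acth.
have l20 : l2 = 0 by exact: inj QJ w0'.
have l10 : l1 = 0 by apply: (inj _ _ _ _ _ PJ); move: h0; rewrite l20 mul0mx addr0.
by rewrite l10 l20 row_mx0.
Qed.

(** Each admissible subgradient at the base point is a fixed vector plus a normal vector. The
    difference of two multipliers is thus normal to both manifolds in the sense of
    [transversal_eq0]. *)
Lemma multiplier_unique (w : 'rV[R]_m) :
  hsub h (F x0) w -> gsub rho r x0 (- (w *m J0^T)) -> w = w0.
Proof.
move=> hw rw; apply/eqP; rewrite -subr_eq0; apply/eqP.
have [_ P0 _ _ _] := actr; have [_ Q0 _ _ _] := acth.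
have mr := nbhs_singleton (active_multiplier rho0 actr) P0.
have mh := nbhs_singleton (active_multiplier (lexx 0) acth) Q0.
have [l1 h1] := mr _ rw; have [l2 h2] := mr _ subr.
have [k1 h3] := mh _ ((gsub_hsub _ _ _).2 hw).
have [k2 h4] := mh _ ((gsub_hsub _ _ _).2 subh).
apply: (@transversal_eq0 _ (l2 - l1) (k1 - k2)).
  rewrite !mulmxBl.
  have : (- (w *m J0^T) - v0) - (v0 - v0) = l1 *m JP^T - l2 *m JP^T.
    by rewrite h1 h2 opprD addrACA subrr add0r.
  rewrite subrr subr0 /v0 opprK => e.
  by rewrite -[w *m _ - _]opprB -[_ - w *m _]addrC e opprB.
have : (w - w0) - (w0 - w0) = k1 *m JQ^T - k2 *m JQ^T.
  by rewrite h3 h4 opprD addrACA subrr add0r.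
by rewrite subrr subr0 mulmxBl.
Qed.

Let S := prox_linear F h r mu.
Let W x := xget (0 : 'rV[R]_m) (stationary F h r rho mu x (S x)).

Let Fc : F @ x0 --> F x0. Proof. exact: sdiff_cvg (Cp1_sdiff x0 (Cp2_Cp1 cF)). Qed.
Let Jc : jacobian F @ x0 --> J0. Proof. exact: Cp2_jacobian_cvg. Qed.
Let nF : Filter (nbhs x0) := nbhs_filter x0.

Let near_stationary (del : R) : 0 < del ->
  \forall x \near x0, `|x0 - S x| <= del /\ stationary F h r rho mu x (S x) (W x).
Proof.
move=> del0; have := kkt_near ch rho0 nr lr cr mu0 murho Fc Jc subh subr del0.
apply: filterS => x [y [w [xy st]]].
have SE : S x = y by exact: (stationary_prox nr mu0 murho st).
rewrite SE; split => //; rewrite /W SE.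
exact: (xgetI (0 : 'rV[R]_m) st).
Qed.

Let Sc : S @ x0 --> x0.
Proof.
by apply: (cvg_of_near (F := nbhs x0)) => e e0; have := near_stationary e0; apply: filterS => x [].
Qed.

Let SB : (fun x => S x - x) @ x0 --> (0 : 'rV[R]_d).
Proof. by rewrite -(subrr x0); exact: (cvgB Sc (@cvg_id _ (nbhs x0))). Qed.

Let zc : (fun x => model F x (S x)) @ x0 --> F x0.
Proof.
have := cvgD Fc (cvg_mulmx nF SB Jc); rewrite mul0mx addr0; exact.
Qed.

Let near_subh : \forall x \near x0, hsub h (model F x (S x)) (W x).
Proof. by have := near_stationary ltr01; apply: filterS => x [_ []]. Qed.

Let near_subr : \forall x \near x0,
  gsub rho r (S x) (- (W x *m ('J F x)^T) - mu^-1 *: (S x - x)).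
Proof. by have := near_stationary ltr01; apply: filterS => x [_ []]. Qed.

(** Stated along any finer filter: it is used with ultrafilters, before the convergence of [W] is
    known, and then with [nbhs x0]. *)
Let vc (U : set_system 'rV[R]_d) (w : 'rV[R]_m) (FU : Filter U) : nbhs x0 `<=` U -> W @ U --> w ->
  (fun x => - (W x *m ('J F x)^T) - mu^-1 *: (S x - x)) @ U --> - (w *m J0^T).
Proof.
move=> xU Ww.
have JU : jacobian F @ U --> J0 by move=> B nB; exact: (xU _ (Jc nB)).
have SU : (fun x => S x - x) @ U --> (0 : 'rV[R]_d) by move=> B nB; exact: (xU _ (SB nB)).
rewrite -[X in _ --> X]subr0 -(scaler0 _ mu^-1).
apply: (cvgB (F := U)); last exact: (cvgZl_tmp (F := U)).
apply: (cvgN (F := U)); apply: cvg_mulmx => //; exact: cvg_trmx.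
Qed.

(** [W] is bounded near [x0], and each ultrafilter limit is a multiplier at the base point by
    closedness of the subgradient relations; uniqueness identifies it. *)
Let Wc : W @ x0 --> w0.
Proof.
have [M HM] := hsub_bounded (F x0) ch.
apply: (@ultra_unique_cvg R _ (nbhs x0) (nbhs_pfilter x0) _ _ _ M).
  have h2 : 0 < (2^-1 : R) by [].
  have h1 : \forall x \near x0, `|F x0 - model F x (S x)| <= 2^-1 by exact: (cvg_near zc h2).
  near=> x; apply: (HM (model F x (S x))); last by near: x.
  by rewrite distrC; near: x.
move=> U w UU xU Ww.
have PU : ProperFilter U := ultra_proper.
have zU : (fun x => model F x (S x)) @ U --> F x0 by move=> B nB; exact: (xU _ (zc nB)).
have SU : S @ U --> x0 by move=> B nB; exact: (xU _ (Sc nB)).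
apply: multiplier_unique.
  apply/gsub_hsub; apply: (gsub_closed (F := U) (x1 := F x0) _ _ _ zU Ww) => //.
  - exact: lsc_EFin (rconvex_continuous ch).
  - by apply: xU; have := near_subh; apply: filterS => x /gsub_hsub.
apply: (gsub_closed (F := U) (x1 := x0) nr lr _ SU (vc _ xU Ww)).
  by have [] := subr.
by apply: xU; exact: near_subr.
Unshelve. all: by end_near.
Qed.

Lemma saddle_escape alpha (M : set 'rV[R]_d) (u : 'rV[R]_d) : 0 < alpha < 1 -> M x0 ->
  (\forall y \near x0, M y -> P y = 0 /\ Q (F y) = 0) ->
  u *m JP = 0 -> u *m (J0 *m JQ) = 0 ->
  (d2 (fun y => composite F h r y + indicator R M y)%E x0 u < 0)%E ->
  exists2 U : set 'rV[R]_d, nbhs x0 U &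
    lebesgue_outer [set x | U x /\
      forall k : nat, U (iter k (damped alpha (prox_linear F h r mu)) x)] = 0%E.
Proof.
move=> al Mx0 MPQ uP uQ d2neg.
have gsubh : gsub 0 (EFin \o h) (F x0) w0 by exact/gsub_hsub.
have [Lr [Dr [Hr [[Cr Dr0] rE curvr pathr]]]] := active_path rho0 actr subr.
have [Lh [Dh [Hh [[Ch Dh0] hE curvh pathh]]]] := active_path (lexx 0) acth gsubh.
have [PS [l lc eql]] := pathr _ (nbhs x0) nF _ _ Sc (vc nF (fun _ => id) Wc) near_subr.
have near_gsubh : \forall x \near x0, gsub 0 (EFin \o h) (model F x (S x)) (W x).
  by have := near_subh; apply: filterS => x /gsub_hsub.
have [QS [k kc eqk]] := pathh _ (nbhs x0) nF _ _ zc Wc near_gsubh.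
have [[cP _] P0 PiJ _ _] := actr; have [[cQ _] Q0 QiJ _ _] := acth.
set K := hess (fun y => dotp w0 (F y) : R^o) x0.
have Cw : C2at (fun y => dotp w0 (F y)) x0 (fun y => w0 *m ('J F y)^T) K.
  exact: Cp2_C2at_dotpl.
(* [D] is written so that [M2 - D] is the coefficient of [dx] in the linearized system; the terms in
   [mu] cancel and leave the Hessian of the Lagrangian. *)
pose M2 := kkt_hess J0 Hr Hh mu; pose D := M2 - (mu^-1%:M - K).
have Hrs := C2at_sym Cr; have Hhs := C2at_sym Ch; have Ks := C2at_sym Cw.
have M2s : M2^T = M2.
  by rewrite /M2 /kkt_hess !linearD/= tr_scalar_mx !trmx_mul trmxK Hrs Hhs mulmxA.
have Ds : D^T = D by rewrite /D linearB/= M2s linearB/= tr_scalar_mx Ks.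
pose C := kktC J0 JP JQ.
have CE (z : 'rV[R]_d) : z *m C = 0 <-> z *m JP = 0 /\ z *m (J0 *m JQ) = 0.
  rewrite /C /kktC mul_mx_row; split => [|[-> ->]]; last by rewrite row_mx0.
  by rewrite -[0]hsubmxK => /eq_row_mx[]; rewrite !linear0.
have M2E (z : 'rV[R]_d) : dotp (z *m M2) z =
    dotp (z *m J0 *m Hh) (z *m J0) + dotp (z *m Hr) z + mu^-1 * dotp z z.
  rewrite /M2 /kkt_hess !mulmxDr !dotpDl mul_mx_scalar dotpZl !mulmxA.
  by rewrite (dotp_mulmx _ J0^T) trmxK.
(* The curvature bound of [r] contributes at least [- rho |z|^2], that of the convex [h] at least 0,
   and [mu^-1] exceeds [rho]. *)
have pd (z : 'rV[R]_d) : z *m C = 0 -> z != 0 -> 0 < dotp (z *m M2) z.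
  move=> /CE[zP zQ] z0; rewrite M2E.
  have c1 := curvr z zP.
  have c2 : 0 <= dotp (z *m J0 *m Hh) (z *m J0).
    have zQ' : z *m J0 *m 'J Q (F x0) = 0 by rewrite -mulmxA.
    by have := curvh _ zQ'; rewrite oppr0 mul0r.
  have zz : 0 < dotp z z.
    rewrite lt_neqAle dotp_ge0 andbT eq_sym; apply: contra z0 => /eqP/dotp_eq0 ->.
    by [].
  have : rho * dotp z z < mu^-1 * dotp z z.
    by rewrite ltr_pM2r// -[mu^-1]mul1r ltr_pdivlMr// mulrC.
  move: c1 c2; rewrite mulNr; lra.
have unit := kkt_mx_unit pd kktC_inj.
have sS : sdiff S x0 ((mu^-1%:M - K) *m ulsubmx (invmx (kkt_mx M2 C))).
  apply: (kkt_sdiff cF cP cQ Cr.2 Ch.2 Cw.2 Sc Wc lc kc _ _ PS QS unit) => //.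
  by have := eql; apply: filterS => x; rewrite /v0 opprK.
have uD : dotp (u *m D) u < 0.
  have DE : D = J0 *m Hh *m J0^T + Hr + K.
    by rewrite /D /M2 /kkt_hess opprB [K - _]addrC addrA addrK.
  have T := lagrangian_taylor (Cp1_sdiff x0 (Cp2_Cp1 cF)) Cr Dr0 Ch Dh0 Cw erefl.
  pose L y := Lr y + Lh (F y) + dotp w0 (F y) + dotp v0 y.
  have hE' : \forall y \near x0, Q (F y) = 0 -> (EFin \o h) (F y) = (Lh (F y) + dotp w0 (F y))%:E.
    exact: (Fc hE).
  have fE y : P y = 0 -> Q (F y) = 0 -> (P y = 0 -> r y = (Lr y + dotp v0 y)%:E) ->
      (Q (F y) = 0 -> (EFin \o h) (F y) = (Lh (F y) + dotp w0 (F y))%:E) ->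
      composite F h r y = (L y)%:E.
    move=> Py Qy /(_ Py) ry /(_ Qy) /= hy; rewrite /composite ry hy -EFinD; congr EFin.
    by rewrite /L; ring.
  have f0 := fE x0 P0 Q0 (nbhs_singleton rE) (nbhs_singleton hE').
  have p0 : composite F h r x0 + indicator R M x0 = (L x0)%:E.
    by rewrite f0 /indicator; case: asboolP => // _; rewrite adde0.
  apply: (d2_quadratic_lower _ _ d2neg); first by rewrite p0.
  move=> e e0; have Te := T e e0; near=> y; rewrite p0.
  have MPQy : M y -> P y = 0 /\ Q (F y) = 0 by near: y.
  have rEy : P y = 0 -> r y = (Lr y + dotp v0 y)%:E by near: y.
  have hEy : Q (F y) = 0 -> (EFin \o h) (F y) = (Lh (F y) + dotp w0 (F y))%:E by near: y.
  (* Off [M] the value is [+oo] and the bound is trivial; on [M] the function equals [L]. *)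
  rewrite /indicator; case: asboolP => My; last first.
    have : r y != -oo%E := nr y.
    by rewrite /composite; case: (r y) => // *; rewrite ?addeA ?addey// leey.
  have [Py Qy] := MPQy My; rewrite (fE y Py Qy rEy hEy) adde0 -EFinD lee_fin.
  have : `|L y - L x0 - dotp ((y - x0) *m (J0 *m Hh *m J0^T + Hr + K)) (y - x0) / 2|
      <= e * `|y - x0| ^+ 2 by near: y.
  rewrite -DE ler_norml => /andP[+ _].
  move: (L y) (L x0) (dotp _ _) (e * _) => *; lra.
have uC : u *m C = 0 by exact/CE.
have [V [g [g1 Vpd Vu]]] := unstable_form M2s Ds pd kktC_inj al uC uD.
have NE : M2 - D = mu^-1%:M - K by rewrite /D subKr.
rewrite NE in Vpd.
exact: (cone_escape (sdiff_damped al sS) g1 Vpd Vu).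
Unshelve. all: by end_near.
Qed.

End SaddlePoint.

(** * Tangent vectors of the composite manifold, and conclusion *)

Section TangentSpace.
Variable R : realType.

(** Membership in [tangent_space] comes with some local equation of unspecified dimension. This
    lemma moves to any chosen map vanishing on the set, such as [P] or the composition of [Q] with
    [F] on [M]. *)
Lemma tangent_space_kernel n s (A : set 'rV[R]_n) (x u : 'rV[R]_n)
    (G : 'rV[R]_n -> 'rV[R]_s) J : A x -> tangent_space 2 A x u ->
  sdiff G x J -> (\forall y \near x, A y -> G y = 0) -> u *m J = 0.
Proof.
move=> Ax [k [P [lP uP]]] sG AG; rewrite diffJ in uP.
have AP := local_equation_near lP; have [_ cP rk _] := lP.
have /row_fullP[Pi PiJ] : row_full ('J P x) by rewrite /row_full rk.
have Px : P x = 0 by apply/(nbhs_singleton AP).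
apply: (kernel_jacobian_sub (Cp2_Cp1 cP) PiJ Px sG (nbhs_singleton AG Ax) _ uP).
near=> y => Py.
have h1 : A y <-> P y = 0 by near: y.
have h2 : A y -> G y = 0 by near: y.
by apply: h2; apply/h1.
Unshelve. all: by end_near.
Qed.

End TangentSpace.

Theorem theorem5p6 (R : realType) (d m : nat)
    (F : 'rV[R]_d -> 'rV[R]_m) (h : 'rV[R]_m -> R) (r : 'rV[R]_d -> \bar R)
    (rho beta mu alpha : R) (xbar : 'rV[R]_d)
    (F_C2 : Cp 2 F)
    (h_convex : convex_function setT h)
    (r_ninfty : avoids_ninfty r)
    (r_closed : closed_fun r)
    (rho_gt0 : 0 < rho)
    (r_weakly_convex : weakly_convex rho r)
    (beta_gt0 : 0 < beta)
    (h_approx : forall x y : 'rV[R]_d,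
       `|h (F y) - h (F x + 'd F x (y - x))| <= beta / 2 * enorm (y - x) ^+ 2)
    (xbar_saddle : composite_strict_saddle F h r xbar)
    (mu_bounds : 0 < mu < (rho + 2 * beta)^-1)
    (alpha_bounds : 0 < alpha < 1)
    (alpha_damping :
       alpha * (1 + (1 + Num.sqrt (2 * beta * mu
                                     / (1 - mu * beta - mu * rho)))
                    * Num.max 1 ((mu * rho + mu * beta)
                                   / (1 - mu * rho - 2 * mu * beta))) < 1) :
  exists2 U : set 'rV[R]_d, nbhs xbar U &
    lebesgue_outer
      [set x | U x /\
        forall k : nat, U (iter k (damped alpha (prox_linear F h r mu)) x)]
    = 0%E.
Proof.
have [M [[_ [w [v [A [H [[sdh sdr wv] [smA smH Ax Hx tr] actA actH ME]]]]]] [u [tgt d2neg]]]] :=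
  xbar_saddle.
have [kP HP] := smA; have [_ [P lP]] := HP _ Ax.
have [kQ HQ] := smH; have [_ [Q lQ]] := HQ _ Hx.
have vE : v = - (w *m ('J F xbar)^T) by apply/eqP; rewrite -addr_eq0 addrC wv.
have ch := convex_function_rconvex h_convex.
have rho0 := ltW rho_gt0.
have [mu0 mu1] := andP mu_bounds.
have murho : mu * rho < 1.
  have s0 : 0 < rho + 2 * beta by rewrite addr_gt0// mulr_gt0.
  move: mu1; rewrite -[_^-1]mul1r ltr_pdivlMr// => mu1.
  by apply: le_lt_trans mu1; rewrite ler_pM2l// lerDl mulr_ge0// ltW.
have subr := subdiff_gsub rho0 r_ninfty r_weakly_convex sdr.
have avh : avoids_ninfty (EFin \o h) by [].
have /gsub_hsub subh := subdiff_gsub (lexx 0) avh (rconvex_weakly_convex ch) sdh.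
have [Pi [gr actr]] := active_data_exists rho0 Ax lP actA.
have [Qi [gh acth]] := active_data_exists (lexx 0) Hx lQ actH.
rewrite vE in actr subr.
have [[cP _] _ _ _ _] := actr; have [[cQ _] _ _ _ _] := acth.
have sP := Cp1_sdiff xbar (Cp2_Cp1 cP); have sQ := Cp1_sdiff (F xbar) (Cp2_Cp1 cQ).
have sF := Cp1_sdiff xbar (Cp2_Cp1 F_C2).
have AP : \forall y \near xbar, A y -> P y = 0.
  by have := local_equation_near lP; apply: filterS => y [].
have HQ0 : \forall z \near F xbar, H z -> Q z = 0.
  by have := local_equation_near lQ; apply: filterS => z [].
have HQF : \forall y \near xbar, H (F y) -> Q (F y) = 0 by exact: (sdiff_cvg sF HQ0).
(* Transversality is transferred from the equations hidden in the tangent spaces to the chosen [P]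
   and [Q]. *)
have trans (c : 'rV[R]_m) : exists (a : 'rV[R]_d) (b : 'rV[R]_m),
    [/\ a *m 'J P xbar = 0, b *m 'J Q (F xbar) = 0 & c = a *m 'J F xbar + b].
  have : setT c by []. rewrite -tr => -[a ta [b tb <-]]; exists a, b; split.
  - exact: tangent_space_kernel Ax ta sP AP.
  - exact: tangent_space_kernel Hx tb sQ HQ0.
  - by rewrite diffJ.
have Mx : M xbar by rewrite ME.
have MPQ : \forall y \near xbar, M y -> P y = 0 /\ Q (F y) = 0.
  near=> y; rewrite ME => -[Ay Hy]; split.
    by move: Ay; near: y.
  by move: Hy; near: y.
have uP : u *m 'J P xbar = 0.
  apply: (tangent_space_kernel Mx tgt sP).
  by apply: filterS MPQ => y h1 /h1[].
have uQ : u *m ('J F xbar *m 'J Q (F xbar)) = 0.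
  apply: (tangent_space_kernel Mx tgt (sdiff_comp sF sQ)).
  by apply: filterS MPQ => y h1 /h1[].
exact: (saddle_escape F_C2 ch r_ninfty (closed_fun_lsc r_closed) rho0
  r_weakly_convex mu0 murho actr acth subr subh trans alpha_bounds Mx MPQ uP uQ d2neg).
Unshelve. all: by end_near.
Qed.
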